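(* Let $k$ be a number field, let $f:\mathbb{P}^n_k\to\mathbb{P}^m_k$ be a morphism of degree $d\ge 1$ (with $n,m\ge1$), and let $\Lambda\subset\mathbb{P}^n_k$ be a positive-dimensional $k$-linear subspace. Then $$\Phi_m\bigl(f(\Lambda(k))\bigr)=\mathscr{D}_{f,\Lambda}\cdot\mathrm{Cl}(k)^d,$$ where the right-hand side is the set of products of an element of $\mathscr{D}_{f,\Lambda}$ and an element of $\mathrm{Cl}(k)^d$. In particular, $\Phi_m\bigl(f(\Lambda(k))\bigr)$ is a finite union of cosets of $\mathrm{Cl}(k)^d$.
   Context: $\mathcal{O}_k$ is the ring of integers of $k$, $\mathrm{Cl}(k)$ its ideal class group, and $\mathrm{Cl}(k)^d=\{c^d:c\in\mathrm{Cl}(k)\}$. For $N\ge1$, $\Phi_N:\mathbb{P}^N(k)\to\mathrm{Cl}(k)$ sends $[x_0:\cdots:x_N]$ to the class of the fractional ideal $x_0\mathcal{O}_k+\cdots+x_N\mathcal{O}_k$. $\Omega_k^f$ is the set of finite places of $k$; for $v\in\Omega_k^f$, $\mathfrak{p}_v$ is the corresponding prime ideal, $k_v$ the completion, and $\mathrm{ord}_v$ the normalized valuation on $k_v$ (with $\mathrm{ord}_v(0)=+\infty$). A morphism $f:\mathbb{P}^n_k\to\mathbb{P}^m_k$ of degree $d$ is one with $f^*\mathcal{O}_{\mathbb{P}^m_k}(1)\simeq\mathcal{O}_{\mathbb{P}^n_k}(d)$; it can be written as $f([x_0:\cdots:x_n])=[F_0(x):\cdots:F_m(x)]$ with $F_0,\ldots,F_m\in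 k[X_0,\ldots,X_n]$ homogeneous of degree $d$ without common nontrivial zero over $\overline{k}$. Put $F=(F_0,\ldots,F_m)$. For $v\in\Omega_k^f$ and $P=[x_0:\cdots:x_n]\in\mathbb{P}^n(k_v)$, the local defect is $$\delta_{F,v}(P):=\min_{0\le i\le m}\mathrm{ord}_v(F_i(x))-d\min_{0\le j\le n}\mathrm{ord}_v(x_j)\in\mathbb{Z},$$ which does not depend on the choice of homogeneous coordinates of $P$. A positive-dimensional $k$-linear subspace is $\Lambda=\mathbb{P}(V)$, the space of lines in a $k$-subspace $V\subset k^{n+1}$ of dimension at least $2$. Put $D_{F,v,\Lambda}:=\delta_{F,v}(\Lambda(k_v))\subset\mathbb{Z}$. Each $D_{F,v,\Lambda}$ is finite and $D_{F,v,\Lambda}=\{0\}$ for all but finitely many $v$. Define $$\mathscr{D}_{f,\Lambda}:=\Bigl\{\prod_{v\in\Omega_k^f}[\mathfrak{p}_v]^{a_v}\;:\;a_v\in D_{F,v,\Lambda}\text{ for every }v\Bigr\}\subset\mathrm{Cl}(k),$$ where all products are finite; this set does not depend on the choice of $F$ representing $f$. *)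

(* Defs.v *)
From HB Require Import structures.
From mathcomp Require Import all_boot all_order all_algebra all_field.
From mathcomp Require Import mpoly.
From mathcomp Require Import boolp classical_sets functions constructive_ereal.
From mathcomp Require Import zify.

Set Implicit Arguments.
Unset Strict Implicit.
Unset Printing Implicit Defensive.

Import Order.TTheory GRing.Theory Num.Theory.
Local Open Scope classical_set_scope.
Local Open Scope ring_scope.

(* Normalized discrete valuations, with value +oo at 0; the value -oo of \bar int
   is excluded. *)
Record discreteValuation (K : fieldType) := DiscreteValuation {
  ord :> K -> \bar int;
  ord_pinfty : forall x, ord x = +oo%E <-> x = 0;
  ord_neq_ninfty : forall x, ord x != -oo%E;
  ordM : forall x y, ord (x * y) = (ord x + ord y)%E;
  ord_ultra : forall x y, (mine (ord x) (ord y) <= ord (x + y)%R)%E;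
  ord_uniformizer : exists x, ord x = 1%:E }.

Section ValuationTheory.
Variables (K : fieldType) (w : discreteValuation K).
Implicit Types x y : K.

Lemma ord0 : w 0 = +oo%E. Proof. exact/ord_pinfty. Qed.

Lemma ord_fin x : x != 0 -> exists a : int, w x = a%:E.
Proof.
case wx : (w x) => [a||] x0; first by exists a.
  by move/ord_pinfty: wx x0 => ->; rewrite eqxx.
by have := ord_neq_ninfty w x; rewrite wx.
Qed.

Lemma ord1 : w 1 = 0%:E.
Proof.
have [a wa] := ord_fin (oner_neq0 K).
have := ordM w 1 1; rewrite mulr1 wa => -[] ?; congr (_%:E); lia.
Qed.

Lemma ordN x : w (- x) = w x.
Proof.
have n10 : (-1 : K) != 0 by rewrite oppr_eq0 oner_neq0.
have [a wa] := ord_fin n10.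
have := ordM w (-1) (-1); rewrite mulrNN mulr1 ord1 wa => -[] ha.
have -> : - x = (-1) * x by rewrite mulN1r.
have a0 : a = 0 by lia.
by rewrite ordM wa a0 add0e.
Qed.

Lemma ordV x (a : int) : w x = a%:E -> w x^-1 = (- a)%:E.
Proof.
move=> wx; have x0 : x != 0 by apply/eqP => /(ord_pinfty w); rewrite wx.
have [b wb] : exists b : int, w x^-1 = b%:E by apply: ord_fin; rewrite invr_eq0.
have := ordM w x x^-1; rewrite divff // ord1 wx wb => -[] ?.
by congr (_%:E); lia.
Qed.

Lemma ordD_ge x y e : (e <= w x)%E -> (e <= w y)%E -> (e <= w (x + y)%R)%E.
Proof. by move=> ex ey; apply: le_trans (ord_ultra w x y); rewrite le_min ex. Qed.

Lemma ordB_ge x y e : (e <= w x)%E -> (e <= w y)%E -> (e <= w (x - y)%R)%E.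
Proof. by move=> ex ey; apply: ordD_ge => //; rewrite ordN. Qed.

Lemma ordBC x y : w (x - y) = w (y - x).
Proof. by rewrite -ordN opprB. Qed.

Lemma ord_lt x y : (w x < w (y - x)%R)%E -> w y = w x.
Proof.
move=> lt_x; apply/eqP; rewrite eq_le; apply/andP; split; last first.
  by rewrite -(subrK x y); apply: ordD_ge => //; exact: ltW.
rewrite leNgt; apply/negP => lt_y.
have : (mine (w y) (w (y - x)%R) <= w x)%E.
  have -> : w x = w (y - (y - x)) by rewrite subKr.
  by apply: ordB_ge; rewrite ge_min lexx ?orbT.
by rewrite leNgt lt_min lt_y lt_x.
Qed.

Lemma ordX x (a : int) (j : nat) : w x = a%:E -> w (x ^+ j) = (a *+ j)%:E.
Proof.
move=> vx; elim: j => [|j IH]; first by rewrite expr0 ord1.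
by rewrite exprS ordM vx IH -EFinD mulrS.
Qed.

End ValuationTheory.

Section Completion.
Variables (K : fieldType) (w : discreteValuation K).
Implicit Types u : nat -> K.

Definition cauchy u := forall N : int, exists n0 : nat, forall i j : nat,
  (n0 <= i)%N -> (n0 <= j)%N -> (N%:E <= w (u i - u j)%R)%E.

Definition null u := forall N : int, exists n0 : nat, forall i : nat,
  (n0 <= i)%N -> (N%:E <= w (u i))%E.

(* [u] has eventually constant valuation [e]; for a Cauchy sequence that is not
   null this always happens, with [e] finite. *)
Definition eventual_ord u (e : \bar int) := exists n0 : nat, forall i : nat,
  (n0 <= i)%N -> w (u i) = e.

Lemma cauchy_cst x : cauchy (cst x).
Proof. by move=> N; exists 0%N => i j _ _; rewrite subrr ord0 leey. Qed.

Lemma cauchyB u v : cauchy u -> cauchy v -> cauchy (u - v).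
Proof.
move=> cu cv N; have [a ha] := cu N; have [b hb] := cv N.
exists (maxn a b) => i j; rewrite !geq_max => /andP[ai bi] /andP[aj bj].
have -> : (u - v) i - (u - v) j = (u i - u j) - (v i - v j).
  by rewrite fctE !opprD !opprK addrACA.
by apply: ordB_ge; [exact: ha|exact: hb].
Qed.

Lemma cauchy_bounded u : cauchy u -> exists (B : int) (n0 : nat),
  forall i, (n0 <= i)%N -> (B%:E <= w (u i))%E.
Proof.
move=> /(_ 0)[n0 hn0].
have [u0|/(ord_fin w)[a wa]] := eqVneq (u n0) 0.
  exists 0, n0 => i hi; have := hn0 i n0 hi (leqnn _).
  by rewrite u0 subr0.
exists (Num.min a 0), n0 => i hi; rewrite -(subrK (u n0) (u i)).
apply: ordD_ge.
  by apply: le_trans (hn0 _ _ hi (leqnn _)); rewrite lee_fin ge_min lexx orbT.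
by rewrite wa lee_fin ge_min lexx.
Qed.

Lemma ordM_ge x y (a b : int) : (a%:E <= w x)%E -> (b%:E <= w y)%E ->
  ((a + b)%R%:E <= w (x * y)%R)%E.
Proof. by move=> ax bY; rewrite ordM EFinD leeD. Qed.

Lemma cauchyM u v : cauchy u -> cauchy v -> cauchy (u * v).
Proof.
move=> cu cv N; have [B [b hb]] := cauchy_bounded cu.
have [C [c hc]] := cauchy_bounded cv.
have [m hm] := cu (N - C); have [p hp] := cv (N - B).
exists (maxn (maxn b c) (maxn m p)) => i j.
rewrite !geq_max => /andP[/andP[bi ci] /andP[mi pi]].
move=> /andP[/andP[bj cj] /andP[mj pj]].
have -> : (u * v) i - (u * v) j = (u i - u j) * v i + u j * (v i - v j).
  by rewrite fctE mulrBl mulrBr addrA subrK.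
apply: ordD_ge.
  by rewrite -(subrK C N); apply: ordM_ge; [exact: hm|exact: hc].
by rewrite -(subrKC B N); apply: ordM_ge; [exact: hb|exact: hp].
Qed.

Lemma null_cauchy u : null u -> cauchy u.
Proof.
move=> nu N; have [a ha] := nu N; exists a => i j ai aj.
by apply: ordB_ge; apply: ha.
Qed.

Lemma nullB u v : null u -> null v -> null (u - v).
Proof.
move=> nu nv N; have [a ha] := nu N; have [b hb] := nv N.
exists (maxn a b) => i; rewrite geq_max => /andP[ai bi].
by apply: ordB_ge; [exact: ha|exact: hb].
Qed.

Lemma nullM u v : cauchy u -> null v -> null (u * v).
Proof.
move=> cu nv N; have [B [b hb]] := cauchy_bounded cu.
have [m hm] := nv (N - B).
exists (maxn b m) => i; rewrite geq_max => /andP[bi mi].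
by rewrite -(subrKC B N); apply: ordM_ge; [exact: hb|exact: hm].
Qed.

Lemma cauchy_eventual u : cauchy u -> ~ null u ->
  exists a : int, eventual_ord u a%:E.
Proof.
move=> cu /existsNP[N /forallNP nN]; have [n0 hn0] := cu N.
have /existsNP[i0 /not_implyP[n0i0 /negP]] := nN n0; rewrite -ltNge => lt_i0.
have /(ord_fin w)[a wa] : u i0 != 0.
  by apply: contraTneq lt_i0 => ->; rewrite ord0 -leNgt leey.
exists a, n0 => i ni; rewrite -wa; apply: ord_lt.
by apply: lt_le_trans lt_i0 _; exact: hn0.
Qed.

Lemma eventual_null u (a : int) : null u -> ~ eventual_ord u a%:E.
Proof.
move=> /(_ (a + 1))[n hn] [p hp].
have := hn (maxn n p) (leq_maxl _ _); rewrite hp ?leq_maxr // lee_fin; lia.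
Qed.

Lemma eventual_uniq u v (e f : \bar int) : null (u - v) ->
  eventual_ord u e -> eventual_ord v f -> e = f.
Proof.
move=> nuv.
have wlg u' v' (a : int) g : null (u' - v') -> eventual_ord u' a%:E ->
    eventual_ord v' g -> g = a%:E.
  move=> /(_ (a + 1))[n hn] [p hp] [q hq].
  pose i := maxn n (maxn p q).
  have ni : (n <= i)%N by rewrite leq_max leqnn.
  have pi : (p <= i)%N by rewrite !leq_max leqnn orbT.
  have qi : (q <= i)%N by rewrite !leq_max leqnn !orbT.
  rewrite -(hp _ pi) -(hq _ qi); apply: ord_lt.
  rewrite ordBC; apply: lt_le_trans (hn _ ni); rewrite hp // lte_fin; lia.
have nvu : null (v - u).
  by move=> N; have [n hn] := nuv N; exists n => i ni; rewrite fctE ordBC; apply: hn.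
move=> hu hv; case: e hu => [a||] hu.
- by rewrite (wlg _ _ _ _ nuv hu hv).
- case: f hv => [b||] hv //; first by rewrite (wlg _ _ _ _ nvu hv hu).
  by case: hv => n /(_ n (leqnn _)) h; have := ord_neq_ninfty w (v n); rewrite h.
- by case: hu => n /(_ n (leqnn _)) h; have := ord_neq_ninfty w (u n); rewrite h.
Qed.

Lemma cauchyV u : cauchy u -> ~ null u -> cauchy (fun i => (u i)^-1).
Proof.
move=> cu nu N; have [a [p hp]] := cauchy_eventual cu nu.
have [n hn] := cu (N + a + a); exists (maxn n p) => i j.
rewrite !geq_max => /andP[ni pi] /andP[nj pj].
have nz l : (p <= l)%N -> u l != 0.
  by move=> pl; apply/eqP => /(ord_pinfty w); rewrite hp.
have -> : (u i)^-1 - (u j)^-1 = (u j - u i) * ((u i)^-1 * (u j)^-1).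
  by rewrite mulrBl mulrCA divff ?nz // mulr1 mulrA divff ?nz // mul1r.
have -> : N = (N + a + a) + (- a - a) by lia.
apply: ordM_ge; first exact: hn.
by rewrite ordM !(ordV (hp _ _)).
Qed.

Definition cauchy_pred : {pred nat -> K} := fun u => `[< cauchy u >].

Lemma cauchy_subring : subring_closed cauchy_pred.
Proof.
split=> [|u v /asboolP cu /asboolP cv|u v /asboolP cu /asboolP cv].
- by apply/asboolP; exact: cauchy_cst.
- by apply/asboolP; exact: cauchyB.
- by apply/asboolP; exact: cauchyM.
Qed.
HB.instance Definition _ :=
  GRing.isSubringClosed.Build (nat -> K) cauchy_pred cauchy_subring.

Definition cauchySeq := {u : nat -> K | cauchy_pred u}.
HB.instance Definition _ := SubChoice.on cauchySeq.
HB.instance Definition _ := [SubChoice_isSubComNzRing of cauchySeq by <:].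

Lemma cauchySeqP (u : cauchySeq) : cauchy (val u).
Proof. exact/asboolP/(valP u). Qed.

Definition null_pred : {pred cauchySeq} := fun s => `[< null (val s) >].

Lemma null_zmod : zmod_closed null_pred.
Proof.
split=> [|u v /asboolP cu /asboolP cv]; apply/asboolP.
  by move=> N; exists 0%N => i _; rewrite ord0 leey.
exact: nullB.
Qed.
HB.instance Definition _ := GRing.isZmodClosed.Build cauchySeq null_pred null_zmod.

Lemma null_ideal :
  1 \notin null_pred /\ forall s, {in null_pred, forall t, s * t \in null_pred}.
Proof.
split=> [|u v /asboolP nv]; last by apply/asboolP/nullM => //; exact: cauchySeqP.
apply/asboolP => /(_ 1)[n /(_ n (leqnn _))].
by rewrite ord1 lee_fin.
Qed.
HB.instance Definition _ := isProperIdeal.Build cauchySeq null_pred null_ideal.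

(* Cauchy sequences modulo null sequences. *)
Definition completion := {ideal_quot null_pred}.
HB.instance Definition _ := GRing.ComNzRing.on completion.

Local Open Scope quotient_scope.

Definition climit (u : cauchySeq) : completion := \pi_{ideal_quot null_pred} u.

Implicit Types s t : cauchySeq.

Lemma climit_surj (x : completion) : exists s, x = climit s.
Proof. by exists (repr (x : {ideal_quot null_pred})); rewrite /climit reprK. Qed.

Lemma climit_eq s t : climit s = climit t <-> null (val s - val t).
Proof.
have <- : (s - t \in null_pred) <-> null (val s - val t) by split=> /asboolP.
have E := Quotient.idealrBE null_pred s t.
split=> [h|h]; first by rewrite E; apply/eqP.
by apply/eqP; rewrite E in h.
Qed.

Lemma climit0 : climit 0 = 0. Proof. by rewrite /climit piE. Qed.
Lemma climit1 : climit 1 = 1. Proof. by rewrite /climit piE. Qed.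
Lemma climitD s t : climit (s + t) = climit s + climit t.
Proof. by rewrite /climit piE. Qed.
Lemma climitB s t : climit (s - t) = climit s - climit t.
Proof. by rewrite /climit piE. Qed.
Lemma climitM s t : climit (s * t) = climit s * climit t.
Proof. by rewrite /climit piE. Qed.

Lemma climit_eq0 s : climit s = 0 <-> null (val s).
Proof. by rewrite -climit0 climit_eq /= subr0. Qed.

Definition mkCauchy u (cu : cauchy u) : cauchySeq :=
  exist (fun u => cauchy_pred u) u (asboolT cu).

Lemma completion_inv (x : completion) : exists y : completion,
  (x != 0 -> y * x = 1) /\ (x = 0 -> y = 0).
Proof.
have [->|xn0] := eqVneq x 0; first by exists 0; split.
have [s xs] := climit_surj x; have cs := cauchySeqP s.
have ns : ~ null (val s).
  by move/climit_eq0; rewrite -xs => x0; rewrite x0 eqxx in xn0.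
pose t : cauchySeq := mkCauchy (cauchyV cs ns).
exists (climit t); split=> [_|x0]; last by rewrite x0 eqxx in xn0.
rewrite xs -climitM -climit1; apply/climit_eq => N.
have [a [n hn]] := cauchy_eventual cs ns; exists n => i ni.
suff -> : (val (t * s) - val (1 : cauchySeq)) i = 0 by rewrite ord0 leey.
rewrite -[LHS]/((val s i)^-1 * val s i - 1) mulVf ?subrr //.
by apply/eqP => /(ord_pinfty w); rewrite hn.
Qed.

Definition cinv (x : completion) : completion := projT1 (cid (completion_inv x)).

Lemma cmulVf (x : completion) : x != 0 -> cinv x * x = 1.
Proof. by rewrite /cinv; case: cid => y /= []. Qed.

Lemma cinv0 : cinv 0 = 0.
Proof. by rewrite /cinv; case: cid => y /= [_]; apply. Qed.

HB.instance Definition _ := GRing.ComNzRing_isField.Build completion cmulVf cinv0.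

Definition completion_embed (x : K) : completion :=
  climit (mkCauchy (cauchy_cst x)).

Lemma completion_embed_zmod : zmod_morphism completion_embed.
Proof. by move=> x y; rewrite -climitB; congr climit; apply: val_inj. Qed.

Lemma completion_embed_monoid : monoid_morphism completion_embed.
Proof.
split=> [|x y]; first by rewrite -climit1; congr climit; apply: val_inj.
by rewrite -climitM; congr climit; apply: val_inj.
Qed.

HB.instance Definition _ :=
  GRing.isZmodMorphism.Build K completion completion_embed completion_embed_zmod.
HB.instance Definition _ :=
  GRing.isMonoidMorphism.Build K completion completion_embed completion_embed_monoid.

Definition completion_ord_fun (x : completion) : \bar int :=
  xget +oo%E [set e | exists2 s, x = climit s & eventual_ord (val s) e].

Lemma completion_ordE s e :
  eventual_ord (val s) e -> completion_ord_fun (climit s) = e.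
Proof.
move=> se; rewrite /completion_ord_fun; case: xgetP => [f _ [t st tf]|/(_ e)]; last first.
  by case; exists s.
by apply: eventual_uniq tf se; apply/climit_eq.
Qed.

Lemma climit_ord (x : completion) : exists s,
  x = climit s /\ eventual_ord (val s) (completion_ord_fun x).
Proof.
have [s xs] := climit_surj x.
have [ns|ns] := pselect (null (val s)).
  have x0 : x = climit 0 by rewrite xs climit0; apply/climit_eq0.
  have ev0 : eventual_ord (val (0 : cauchySeq)) +oo%E.
    by exists 0%N => i _; rewrite ord0.
  by exists 0; rewrite x0 (completion_ordE ev0).
have [a sa] := cauchy_eventual (@cauchySeqP s) ns.
by exists s; rewrite {2}xs (completion_ordE sa).
Qed.

Lemma completion_ord_pinfty (x : completion) :
  completion_ord_fun x = +oo%E <-> x = 0.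
Proof.
have [s [xs]] := climit_ord x; move: (completion_ord_fun x) => e se.
split=> [e0|x0].
  rewrite xs; apply/climit_eq0 => N; case: se => n hn; exists n => i /hn ->.
  by rewrite e0 leey.
have /climit_eq0 ns : climit s = 0 by rewrite -xs.
case: e se => [a /eventual_null//||[n /(_ n (leqnn _)) hn]] //.
by have := ord_neq_ninfty w (val s n); rewrite hn.
Qed.

Lemma completion_ord_neq (x : completion) : completion_ord_fun x != -oo%E.
Proof.
have [s [xs [n /(_ n (leqnn _)) <-]]] := climit_ord x; exact: ord_neq_ninfty.
Qed.

Lemma completion_ordM (x y : completion) : completion_ord_fun (x * y) =
  (completion_ord_fun x + completion_ord_fun y)%E.
Proof.
have [s [xs [n hn]]] := climit_ord x; have [t [yt [m hm]]] := climit_ord y.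
rewrite {1}xs {1}yt -climitM; apply: completion_ordE; exists (maxn n m) => i.
by rewrite geq_max => /andP[ni mi]; rewrite ordM hn ?hm.
Qed.

Lemma completion_ord_ultra (x y : completion) :
  (mine (completion_ord_fun x) (completion_ord_fun y) <=
     completion_ord_fun (x + y)%R)%E.
Proof.
have [xy0|xy0] := eqVneq (x + y) 0.
  by move/completion_ord_pinfty: xy0 => ->; rewrite leey.
have [s [xs [n hn]]] := climit_ord x; have [t [yt [m hm]]] := climit_ord y.
have st : x + y = climit (s + t) by rewrite climitD -xs -yt.
have nst : ~ null (val (s + t)).
  by move/climit_eq0; rewrite -st => h; rewrite h eqxx in xy0.
have [a ha] := cauchy_eventual (@cauchySeqP (s + t)) nst.
rewrite st (completion_ordE ha); case: ha => p hp.
pose i := maxn p (maxn n m).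
rewrite -(hn i) ?leq_max ?leqnn ?orbT // -(hm i) ?leq_max ?leqnn ?orbT //.
by rewrite -(hp i) ?leq_max ?leqnn //; exact: ord_ultra.
Qed.

Lemma completion_ord_embed_fun x : completion_ord_fun (completion_embed x) = w x.
Proof. by apply: completion_ordE; exists 0%N. Qed.

Lemma completion_ord_unif : exists x, completion_ord_fun x = 1%:E.
Proof.
have [x wx] := ord_uniformizer w.
by exists (completion_embed x); rewrite completion_ord_embed_fun.
Qed.

Definition completion_ord : discreteValuation completion :=
  DiscreteValuation completion_ord_pinfty completion_ord_neq
    completion_ordM completion_ord_ultra completion_ord_unif.

Lemma completion_ord_embed x : completion_ord (completion_embed x) = w x.
Proof. exact: completion_ord_embed_fun. Qed.

Lemma climit_tail s (N : int) : exists n0 : nat, forall n, (n0 <= n)%N ->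
  (N%:E <= completion_ord (climit s - completion_embed (val s n))%R)%E.
Proof.
have [n0 hn] := cauchySeqP s N; exists n0 => n n0n.
pose c : cauchySeq := mkCauchy (cauchy_cst (val s n)).
have -> : climit s - completion_embed (val s n) = climit (s - c).
  by rewrite climitB.
have [ns|ns] := pselect (null (val (s - c))).
  by move/climit_eq0: ns => ->; rewrite ord0 leey.
have [a ha] := cauchy_eventual (@cauchySeqP (s - c)) ns.
rewrite /= (completion_ordE ha); case: ha => p hp.
rewrite -(hp (maxn n p)) ?leq_maxr //; apply: hn => //.
exact: leq_trans n0n (leq_maxl _ _).
Qed.

End Completion.

Section Complete.
Variables (K : fieldType) (w : discreteValuation K).
Local Notation Kw := (completion w).
Local Notation ordw := (completion_ord w).

Lemma completion_dense (x : Kw) (N : int) :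
  exists y : K, (N%:E <= ordw (x - completion_embed w y)%R)%E.
Proof.
have [s ->] := climit_surj x; have [n hn] := climit_tail s N.
by exists (val s n); exact: hn.
Qed.

Lemma completion_complete (x : nat -> Kw) : cauchy ordw x ->
  exists y : Kw, forall N : int, exists n0 : nat, forall n, (n0 <= n)%N ->
    (N%:E <= ordw (x n - y)%R)%E.
Proof.
move=> cx; pose u (n : nat) := projT1 (cid (completion_dense (x n) n)).
have hu (n : nat) : (n%:Z%:E <= ordw (x n - completion_embed w (u n))%R)%E.
  by rewrite /u; case: cid.
have hu' (N : int) (n : nat) : (`|N| <= n)%N ->
    (N%:E <= ordw (x n - completion_embed w (u n))%R)%E.
  by move=> Nn; apply: le_trans (hu n); rewrite lee_fin; lia.
have cu : cauchy w u.
  move=> N; have [n hn] := cx N; exists (maxn n `|N|) => i j.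
  rewrite !geq_max => /andP[ni Ni] /andP[nj Nj].
  rewrite -completion_ord_embed rmorphB /=.
  have -> : completion_embed w (u i) - completion_embed w (u j) =
      (x i - x j) - ((x i - completion_embed w (u i)) -
                     (x j - completion_embed w (u j))).
    by rewrite opprD opprB addrACA [_ - x i]addrC addNKr opprB opprB addKr.
  apply: (@ordB_ge _ ordw); [exact: hn|apply: (@ordB_ge _ ordw); exact: hu'].
exists (climit (mkCauchy cu)) => N.
have [n hn] := climit_tail (mkCauchy cu) N; exists (maxn n `|N|) => i.
rewrite geq_max => /andP[ni Ni].
rewrite -(subrK (completion_embed w (u i)) (x i)) -addrA.
by apply: ordD_ge; [exact: hu'|rewrite ordBC; exact: hn].
Qed.

End Complete.

Section FractionalIdeals.
Variable k : fieldExtType rat.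

Definition ringOfIntegers : set k := [set x | integralOver (intr : int -> k) x].
Local Notation O := ringOfIntegers.

Lemma intr_neq0 (m : int) : m != 0 -> m%:~R != 0 :> k.
Proof.
move=> m0; rewrite -(rmorph_int (in_alg k)) fmorph_eq0 intr_eq0 //.
Qed.

Lemma integral_denominator (x : k) :
  exists2 m : int, m != 0 & O (m%:~R * x).
Proof.
have /polyOver1P[p pE] := minPolyOver 1 x.
have [q [a a0 pq]] := rat_poly_scale p.
have px0 : root (map_poly (in_alg k) p) x by rewrite -pE root_minPoly.
have p0 : p != 0.
  apply/eqP => p0; have := monic_neq0 (monic_minPoly 1 x).
  by rewrite pE p0 rmorph0 eqxx.
have q0 : q != 0 by apply: contraNneq p0 => q0; rewrite pq q0 rmorph0 scaler0.
pose qk := map_poly (intr : int -> k) q.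
have qx0 : qk.[x] = 0.
  have a0k : (in_alg k a%:~R^-1) != 0 by rewrite fmorph_eq0 invr_eq0 intr_eq0.
  move: px0; rewrite pq linearZ /= /root hornerZ mulf_eq0.
  case/orP => [|/eqP <-].
    by rewrite scaler_eq0 oner_eq0 orbF invr_eq0 intr_eq0 (negPf a0).
  rewrite /qk -map_poly_comp; congr (_.[x]); apply: eq_map_poly => c /=.
  by rewrite -[_%:A]/(in_alg k c%:~R) rmorph_int.
pose c := lead_coef q; exists c; first by rewrite lead_coef_eq0.
have ck0 : c%:~R != 0 :> k by apply: intr_neq0; rewrite lead_coef_eq0.
have szq : size q = (size q).-2.+2.
  have : (1 < size q)%N.
    have -> : size q = size qk by rewrite size_map_poly_id0.
    have qk0 : qk != 0 by rewrite map_poly_eq0_id0.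
    apply: (root_size_gt1 qk0); exact/eqP/qx0.
  by case: (size q) => [|[|]].
set s := (size q).-2 in szq.
pose r : {poly int} := \poly_(i < s.+2) (if i == s.+1 then 1 else q`_i * c ^+ (s - i)).
have lead_r : r`_s.+1 = 1 by rewrite coef_poly ltnSn eqxx.
have size_r : size r = s.+2.
  by rewrite size_poly_eq // eqxx oner_eq0.
exists r; first by rewrite monicE /lead_coef size_r lead_r.
apply/eqP/(mulfI ck0); rewrite mulr0 -[RHS](mulr0 (c%:~R ^+ s.+1)) -qx0.
rewrite (@horner_coef_wide _ s.+2 qk); last by rewrite /qk -szq size_poly.
rewrite (@horner_coef_wide _ s.+2); last by rewrite -{1}size_r size_poly.
rewrite !mulr_sumr; apply: eq_bigr => i _.
rewrite !coef_map_id0 // coef_poly ltn_ord exprMn !mulrA; congr (_ * _).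
case: eqP => [->|/eqP i_s] /=.
  by rewrite mulr1 -exprS /c lead_coefE szq exprSr.
rewrite rmorphM rmorphXn /= mulrCA -mulrA [RHS]mulrC; congr (_ * _).
rewrite -exprS -exprD; congr (_ ^+ _); have := ltn_ord i; lia.
Qed.

(* Nonzero fractional ideals: nonzero O_k-submodules of k with a common
   denominator in O_k. *)
Record fracIdeal := FracIdeal {
  fideal :> k -> Prop;
  fidealD : forall x y, fideal x -> fideal y -> fideal (x + y);
  fidealZ : forall a x, O a -> fideal x -> fideal (a * x);
  fideal_neq0 : exists2 x, x != 0 & fideal x;
  fideal_denom : exists c, [/\ c != 0, O c & forall x, fideal x -> O (c * x)] }.

HB.instance Definition _ := gen_eqMixin fracIdeal.
HB.instance Definition _ := gen_choiceMixin fracIdeal.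

Lemma fracIdealP (I J : fracIdeal) : fideal I = fideal J -> I = J.
Proof.
case: I J => [I a b c d] [J e f g h] /= IJ; subst J.
by congr FracIdeal; exact: Prop_irrelevance.
Qed.

Lemma Ok0 : O 0. Proof. exact: integral0. Qed.
Lemma Ok1 : O 1. Proof. exact: integral1. Qed.
Lemma OkD x y : O x -> O y -> O (x + y). Proof. exact: integral_add. Qed.
Lemma OkM x y : O x -> O y -> O (x * y). Proof. exact: integral_mul. Qed.
Lemma Okint (m : int) : O m%:~R. Proof. exact: integral_id. Qed.

Lemma fideal0 (I : fracIdeal) : I 0.
Proof.
have [x _ Ix] := fideal_neq0 I.
by rewrite -(mul0r x); apply: fidealZ => //; exact: Ok0.
Qed.

Lemma fideal_sum (I : fracIdeal) (T : Type) (s : seq T) (P : pred T) (F : T -> k) :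
  (forall i, P i -> I (F i)) -> I (\sum_(i <- s | P i) F i).
Proof.
by move=> h; apply: big_ind => //; [exact: fideal0|exact: fidealD].
Qed.

Lemma one_denom : exists c : k, [/\ c != 0, O c & forall x, O x -> O (c * x)].
Proof. by exists 1; split=> [||x]; rewrite ?oner_neq0 ?mul1r //; exact: Ok1. Qed.

Definition fideal1 : fracIdeal :=
  @FracIdeal O OkD OkM (ex_intro2 _ _ 1 (oner_neq0 k) Ok1) one_denom.

Section Generated.
Variables (n : nat) (x : 'rV[k]_n).

Definition generated_set : set k :=
  [set y | exists a : 'rV[k]_n, (forall i, O (a 0 i)) /\ y = \sum_i a 0 i * x 0 i].

Lemma generatedD y z : generated_set y -> generated_set z -> generated_set (y + z).
Proof.
move=> [a [Oa ->]] [b [Ob ->]]; exists (a + b); split=> [i|].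
  by rewrite mxE; exact: OkD.
by rewrite -big_split; apply: eq_bigr => i _; rewrite mxE mulrDl.
Qed.

Lemma generatedZ c y : O c -> generated_set y -> generated_set (c * y).
Proof.
move=> Oc [a [Oa ->]]; exists (c *: a); split=> [i|].
  by rewrite mxE; exact: OkM.
by rewrite mulr_sumr; apply: eq_bigr => i _; rewrite mxE mulrA.
Qed.

Lemma generated_neq0 : x != 0 -> exists2 y, y != 0 & generated_set y.
Proof.
move=> /rV0Pn[i xi]; exists (x 0 i) => //.
exists (delta_mx 0 i); split=> [j|].
  by rewrite mxE; case: (_ && _); [exact: Ok1|exact: Ok0].
rewrite (bigD1 i) //= big1 ?addr0 ?mxE ?eqxx ?mul1r // => j ji.
by rewrite mxE (negPf ji) andbF mul0r.
Qed.

Lemma generated_denom :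
  exists c, [/\ c != 0, O c & forall y, generated_set y -> O (c * y)].
Proof.
have d i : exists m : int, m != 0 /\ O (m%:~R * x 0 i).
  by have [m] := integral_denominator (x 0 i); exists m.
pose m i := projT1 (cid (d i)).
have m0 i : m i != 0 by rewrite /m; case: cid => ? [].
have mO i : O ((m i)%:~R * x 0 i) by rewrite /m; case: cid => ? [].
exists (\prod_i m i)%:~R; split.
- by apply: intr_neq0; apply/prodf_neq0.
- exact: Okint.
move=> _ [a [Oa ->]]; rewrite mulr_sumr.
apply: (big_ind O) => [||i _]; [exact: Ok0|exact: OkD|].
rewrite mulrCA; apply: OkM => //; rewrite (bigD1 i) //= intrM mulrAC.
by apply: OkM => //; exact: Okint.
Qed.

Definition generated (x0 : x != 0) : fracIdeal :=
  FracIdeal generatedD generatedZ (generated_neq0 x0) generated_denom.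
End Generated.

Section Product.
Variables I J : fracIdeal.

Definition product_set : set k := [set z | exists s : seq (k * k),
  (forall p, p \in s -> I p.1 /\ J p.2) /\ z = \sum_(p <- s) p.1 * p.2].

Lemma productD y z : product_set y -> product_set z -> product_set (y + z).
Proof.
move=> [s [hs ->]] [t [ht ->]]; exists (s ++ t); rewrite big_cat; split=> // p.
by rewrite mem_cat => /orP[]; [exact: hs|exact: ht].
Qed.

Lemma productZ c y : O c -> product_set y -> product_set (c * y).
Proof.
move=> Oc [s [hs ->]]; exists [seq (c * p.1, p.2) | p <- s]; split.
  by move=> _ /mapP[p /hs[Ip Jp] ->]; split=> //; exact: fidealZ.
by rewrite big_map mulr_sumr; apply: eq_bigr => p _; rewrite mulrA.
Qed.

Lemma product_mul x y : I x -> J y -> product_set (x * y).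
Proof.
move=> Ix Jy; exists [:: (x, y)]; rewrite big_seq1; split=> // p.
by rewrite inE => /eqP->.
Qed.

Lemma product_neq0 : exists2 y, y != 0 & product_set y.
Proof.
have [x x0 Ix] := fideal_neq0 I; have [y y0 Jy] := fideal_neq0 J.
by exists (x * y); [rewrite mulf_neq0|exact: product_mul].
Qed.

Lemma product_denom :
  exists c, [/\ c != 0, O c & forall y, product_set y -> O (c * y)].
Proof.
have [c [c0 Oc Ic]] := fideal_denom I; have [d [d0 Od Jd]] := fideal_denom J.
exists (c * d); split=> [||_ [s [hs ->]]]; [by rewrite mulf_neq0|exact: OkM|].
rewrite mulr_sumr big_seq; apply: (big_ind O) => [||p /hs[Ip Jp]].
- exact: Ok0.
- exact: OkD.
by rewrite mulrACA; apply: OkM; [exact: Ic|exact: Jd].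
Qed.

Definition fidealM : fracIdeal :=
  FracIdeal productD productZ product_neq0 product_denom.
End Product.

Lemma fidealM_sub (I J L : fracIdeal) :
  (forall x y, I x -> J y -> L (x * y)) -> forall z, fidealM I J z -> L z.
Proof.
move=> h _ [s [hs ->]]; rewrite big_seq; apply: fideal_sum => p /hs[]; exact: h.
Qed.

Lemma fidealMC I J : fidealM I J = fidealM J I.
Proof.
by apply: fracIdealP; apply/seteqP; split=> z; apply: fidealM_sub => x y ? ?;
  rewrite mulrC; exact: product_mul.
Qed.

Lemma fidealMA I J L : fidealM I (fidealM J L) = fidealM (fidealM I J) L.
Proof.
apply: fracIdealP; apply/seteqP; split=> z; apply: fidealM_sub => x y.
  move=> Ix [s [hs ->]]; rewrite mulr_sumr big_seq.
  apply: fideal_sum => p /hs[Jp Lp]; rewrite mulrA.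
  by apply: product_mul => //; exact: product_mul.
move=> [s [hs ->]] Ly; rewrite mulr_suml big_seq.
apply: fideal_sum => p /hs[Ip Jp]; rewrite -mulrA.
by apply: product_mul => //; exact: product_mul.
Qed.

Lemma fidealM1 I : fidealM fideal1 I = I.
Proof.
apply: fracIdealP; apply/seteqP; split=> z.
  by apply: fidealM_sub => x y Ox Iy; exact: fidealZ.
by move=> Iz; rewrite -[z]mul1r; apply: product_mul => //; exact: Ok1.
Qed.

Section Inverse.
Variable I : fracIdeal.

(* The ideal quotient (O_k : I). *)
Definition inverse_set : set k := [set y | forall x, I x -> O (y * x)].

Lemma inverseD y z : inverse_set y -> inverse_set z -> inverse_set (y + z).
Proof. by move=> hy hz x Ix; rewrite mulrDl; apply: OkD; [exact: hy|exact: hz]. Qed.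

Lemma inverseZ c y : O c -> inverse_set y -> inverse_set (c * y).
Proof. by move=> Oc hy x Ix; rewrite -mulrA; apply: OkM => //; exact: hy. Qed.

Lemma inverse_neq0 : exists2 y, y != 0 & inverse_set y.
Proof. by have [c [c0 _ hc]] := fideal_denom I; exists c. Qed.

Lemma inverse_denom :
  exists c, [/\ c != 0, O c & forall y, inverse_set y -> O (c * y)].
Proof.
have [x x0 Ix] := fideal_neq0 I; have [c [c0 Oc Ic]] := fideal_denom I.
exists (c * x); split=> [||y hy]; [by rewrite mulf_neq0|exact: Ic|].
by rewrite -mulrA [x * y]mulrC; apply: OkM => //; exact: hy.
Qed.

Definition fidealV : fracIdeal :=
  FracIdeal inverseD inverseZ inverse_neq0 inverse_denom.
End Inverse.

Definition ideal_equiv (I J : fracIdeal) : bool :=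
  `[< exists2 c : k, c != 0 & fideal J = [set c * x | x in fideal I] >].

Lemma scale_setK (c : k) (A : set k) : c != 0 ->
  [set c^-1 * x | x in [set c * x | x in A]] = A.
Proof.
by move=> c0; rewrite image_comp -[RHS]image_id; apply: eq_imagel => x _ /=;
  rewrite mulKf.
Qed.

Lemma ideal_equiv_class : equiv_class_of ideal_equiv.
Proof.
have symm I J : ideal_equiv I J -> ideal_equiv J I.
  move=> /asboolP[c c0 JI]; apply/asboolP; exists c^-1; first by rewrite invr_eq0.
  by rewrite JI scale_setK.
split=> [I|I J|J I L].
- apply/asboolP; exists 1; first exact: oner_neq0.
  by rewrite -[LHS]image_id; apply: eq_imagel => x _ /=; rewrite mul1r.
- by apply/idP/idP; exact: symm.
- move=> /asboolP[c c0 JI] /asboolP[d d0 LJ]; apply/asboolP; exists (d * c).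
    by rewrite mulf_neq0.
  by rewrite LJ JI image_comp; apply: eq_imagel => x _ /=; rewrite mulrA.
Qed.

Canonical ideal_equiv_rel := EquivRelPack ideal_equiv_class.

(* Nonzero fractional ideals modulo principal ones. Multiplication and inversion
   are induced by I * J and (O_k : I); the commutative monoid laws are proved
   below. That (O_k : I) is inverse to I, i.e. that O_k is a Dedekind domain, is
   not needed to define any of the operations. *)
Definition classGroup := {eq_quot ideal_equiv}%qT.
HB.instance Definition _ := Choice.on classGroup.
HB.instance Definition _ := EqQuotient.on classGroup.
Local Open Scope quotient_scope.

Definition idealClass (I : fracIdeal) : classGroup := \pi_classGroup I.

Lemma idealClassP I J : idealClass I = idealClass J <->
  exists2 c : k, c != 0 & fideal J = [set c * x | x in fideal I].
Proof.
rewrite /idealClass; split=> [/eqP|h]; first by rewrite eqmodE => /asboolP.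
by apply/eqP; rewrite eqmodE; apply/asboolP.
Qed.

Definition cl_one : classGroup := idealClass fideal1.
Definition cl_mul (a b : classGroup) := idealClass (fidealM (repr a) (repr b)).
Definition cl_inv (a : classGroup) := idealClass (fidealV (repr a)).

Lemma idealClass_surj (a : classGroup) : exists I, a = idealClass I.
Proof. by exists (repr a); rewrite /idealClass reprK. Qed.

Lemma idealClass_repr I :
  exists2 c : k, c != 0 & fideal (repr (idealClass I)) = [set c * x | x in fideal I].
Proof. by apply/idealClassP; rewrite /idealClass reprK. Qed.

Lemma cl_mulE I J : cl_mul (idealClass I) (idealClass J) = idealClass (fidealM I J).
Proof.
have [c c0 cI] := idealClass_repr I; have [d d0 dJ] := idealClass_repr J.
apply/esym/idealClassP; exists (c * d); first by rewrite mulf_neq0.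
apply/seteqP; split=> [z [s [hs ->]]|_ [z [s [hs ->]] <-]]; last first.
  rewrite mulr_sumr big_seq; apply: fideal_sum => p /hs[Ip Jp].
  rewrite mulrACA; apply: product_mul; [rewrite cI|rewrite dJ].
    by exists p.1.
  by exists p.2.
exists ((c * d)^-1 * (\sum_(p <- s) p.1 * p.2)); last by rewrite mulVKf ?mulf_neq0.
rewrite mulr_sumr big_seq; apply: fideal_sum => p /hs[]; rewrite cI dJ.
move=> [x Ix <-] [y Jy <-]; rewrite mulrACA mulKf ?mulf_neq0 //.
exact: product_mul.
Qed.

Lemma cl_invE I : cl_inv (idealClass I) = idealClass (fidealV I).
Proof.
have [c c0 cI] := idealClass_repr I.
apply/esym/idealClassP; exists c^-1; first by rewrite invr_eq0.
apply/seteqP; split=> [y hy|_ [y hy <-] x].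
  exists (c * y); last by rewrite mulKf.
  move=> x Ix; rewrite mulrAC mulrC; apply: hy.
  by rewrite cI; exists x.
rewrite cI => -[z Iz <-]; rewrite mulrACA mulVf // mul1r; exact: hy.
Qed.

Lemma cl_mulC : commutative cl_mul.
Proof.
move=> a b; have [I ->] := idealClass_surj a; have [J ->] := idealClass_surj b.
by rewrite !cl_mulE fidealMC.
Qed.

Lemma cl_mulA : associative cl_mul.
Proof.
move=> a b c; have [I ->] := idealClass_surj a; have [J ->] := idealClass_surj b.
by have [L ->] := idealClass_surj c; rewrite !cl_mulE fidealMA.
Qed.

Lemma cl_mul1 : left_id cl_one cl_mul.
Proof.
by move=> a; have [I ->] := idealClass_surj a; rewrite cl_mulE fidealM1.
Qed.

Lemma cl_mulr1 : right_id cl_one cl_mul.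
Proof. by move=> a; rewrite cl_mulC cl_mul1. Qed.

HB.instance Definition _ :=
  isMonoid.Build classGroup cl_mulA cl_mul1 cl_mulr1.
HB.instance Definition _ := hasInv.Build classGroup cl_inv.
HB.instance Definition _ := Monoid.isComLaw.Build classGroup 1%g *%g
  cl_mulA cl_mulC cl_mul1.

Definition cl_expz (c : classGroup) (a : int) : classGroup :=
  match a with Posz j => c ^+ j | Negz j => c ^- j.+1 end%g.

End FractionalIdeals.

HB.instance Definition _ (K : fieldType) := gen_eqMixin (discreteValuation K).
HB.instance Definition _ (K : fieldType) := gen_choiceMixin (discreteValuation K).

Arguments ringOfIntegers : clear implicits.

Section FinitePlaces.
Variable k : fieldExtType rat.

(* A finite place is represented by its unique normalized discrete valuation. *)
Definition finitePlace := discreteValuation k.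
HB.instance Definition _ := Choice.on finitePlace.
Variable v : finitePlace.

Lemma ord_nat_ge0 (j : nat) : (0%:E <= v j%:R)%E.
Proof.
elim: j => [|j IH]; first by rewrite ord0 leey.
by rewrite -addn1 natrD; apply: ordD_ge => //; rewrite ord1.
Qed.

Lemma ord_int_ge0 (m : int) : (0%:E <= v m%:~R)%E.
Proof. by case: m => j; rewrite ?NegzE ?mulrNz ?ordN; exact: ord_nat_ge0. Qed.

Lemma ord_sum_ge (T : Type) (s : seq T) (P : pred T) (F : T -> k) e :
  (forall i, P i -> (e <= v (F i))%E) -> (e <= v (\sum_(i <- s | P i) F i)%R)%E.
Proof.
move=> h; apply: (big_ind (fun y => e <= v y)%E) => //; first by rewrite ord0 leey.
by move=> x y; exact: ordD_ge.
Qed.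

Lemma ord_integral_ge0 (x : k) : ringOfIntegers k x -> (0%:E <= v x)%E.
Proof.
move=> [p pmon /rootP px]; have [->|/(ord_fin v)[a va]] := eqVneq x 0.
  by rewrite ord0 leey.
rewrite va lee_fin leNgt; apply/negP => a_lt0.
have [s szp] : exists s, size p = s.+1.
  by exists (size p).-1; rewrite prednK // size_poly_gt0 monic_neq0.
move: px; rewrite (@horner_coef_wide _ s.+1) -?szp ?size_poly //.
rewrite szp big_ord_recr /= coef_map_id0 //.
have -> : p`_s = 1 by move/monicP: pmon; rewrite lead_coefE szp.
rewrite mul1r => /eqP; rewrite addr_eq0 => /eqP sumE.
have : ((a *+ s - a)%R%:E <= v (x ^+ s)%R)%E.
  rewrite -ordN -sumE; apply: ord_sum_ge => i _; rewrite coef_map_id0 //.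
  rewrite ordM (ordX i va); apply: (@le_trans _ _ (0%:E + (a *+ i)%R%:E)%E).
    rewrite add0e lee_fin; case: (s) i => [[]//|s' i].
    rewrite mulrSr addrK; apply: ler_wnMn2l; [exact: ltW|by rewrite -ltnS].
  by apply: leeD => //; exact: ord_int_ge0.
by rewrite (ordX s va) lee_fin; lia.
Qed.

Definition prime_set : set k := [set x | ringOfIntegers k x /\ (0%:E < v x)%E].

Lemma primeD x y : prime_set x -> prime_set y -> prime_set (x + y).
Proof.
move=> [Ox vx] [Oy vy]; split; first exact: OkD.
by apply: lt_le_trans (ord_ultra v x y); rewrite lt_min vx.
Qed.

Lemma primeZ a x : ringOfIntegers k a -> prime_set x -> prime_set (a * x).
Proof.
move=> Oa [Ox vx]; split; first exact: OkM.
rewrite ordM; apply: lt_le_trans vx _; rewrite -[leLHS]add0e.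
by apply: leeD => //; exact: ord_integral_ge0.
Qed.

Lemma prime_neq0 : exists2 x, x != 0 & prime_set x.
Proof.
have [x vx] := ord_uniformizer v; have [m m0 Omx] := integral_denominator x.
exists (m%:~R * x).
  rewrite mulf_neq0 ?intr_neq0 //; apply/eqP => x0.
  by have := ord0 v; rewrite -x0 vx.
split=> //; rewrite ordM vx.
apply: (@lt_le_trans _ _ (0%:E + 1%:E)%E); first by rewrite add0e lte_fin.
by apply: leeD => //; exact: ord_int_ge0.
Qed.

Lemma prime_denom : exists c : k,
  [/\ c != 0, ringOfIntegers k c & forall x, prime_set x -> ringOfIntegers k (c * x)].
Proof.
by exists 1; split=> [||x [Ox _]]; rewrite ?oner_neq0 ?mul1r //; exact: Ok1.
Qed.

Definition primeIdeal : fracIdeal k :=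
  FracIdeal primeD primeZ prime_neq0 prime_denom.

End FinitePlaces.

Section Projective.
Variable K : fieldType.

(* P^N(K) as the set of lines of K^(N+1). *)
Definition projSpace (N : nat) := {P : {vspace 'rV[K]_N.+1} | \dim P == 1%N}.

Definition homCoords N (P : projSpace N) : 'rV[K]_N.+1 := vpick (val P).

Lemma dim_line N (x : 'rV[K]_N.+1) : x != 0 -> \dim <[x]>%VS == 1%N.
Proof. by rewrite dim_vline => ->. Qed.

Definition point N (x : 'rV[K]_N.+1) (x0 : x != 0) : projSpace N :=
  exist _ <[x]>%VS (dim_line x0).

Lemma homCoords_neq0 N (P : projSpace N) : homCoords P != 0.
Proof.
rewrite vpick0; apply/eqP => P0.
by have := valP P; rewrite P0 dimv0.
Qed.

Lemma point_homCoords N (P : projSpace N) : point (homCoords_neq0 P) = P.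
Proof.
apply: val_inj => /=; apply/eqP; rewrite eqEdim -memvE memv_pick /=.
by rewrite (eqP (valP P)) dim_vline homCoords_neq0.
Qed.

Lemma homCoords_point N (x : 'rV[K]_N.+1) (x0 : x != 0) :
  exists2 c : K, c != 0 & homCoords (point x0) = c *: x.
Proof.
have /vlineP[c cE] : homCoords (point x0) \in <[x]>%VS by exact: memv_pick.
exists c => //; apply: contraNneq (homCoords_neq0 (point x0)) => c0.
by rewrite cE c0 scale0r.
Qed.

(* The K-points of P(L). *)
Definition linearSubspace N (L : {vspace 'rV[K]_N.+1}) : set (projSpace N) :=
  [set P | (val P <= L)%VS].

End Projective.

(* L tensored with E, inside E^(N+1). *)
Definition baseChange (K E : fieldType) (j : {rmorphism K -> E}) (N : nat)
    (L : {vspace 'rV[K]_N.+1}) : {vspace 'rV[E]_N.+1} :=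
  <<[seq map_mx j b | b <- vbasis L]>>%VS.

Definition polyEval (K : fieldType) (n m : nat)
    (F : 'I_m.+1 -> {mpoly K[n.+1]}) (x : 'rV[K]_n.+1) : 'rV[K]_m.+1 :=
  \row_i (F i).@[x 0].

(* A degree d morphism P^n -> P^m, given by forms of degree d without common
   nontrivial zero over kbar; the forms are determined by the morphism up to a
   common scalar. The intended [iota] is an algebraic closure of k. *)
Record projMorphism (k kbar : fieldType) (iota : {rmorphism k -> kbar})
    (n m d : nat) := ProjMorphism {
  forms : 'I_m.+1 -> {mpoly k[n.+1]};
  forms_homog : forall i, forms i \is d.-homog;
  forms_nozero : forall x : 'rV[kbar]_n.+1,
    polyEval (fun i => map_mpoly iota (forms i)) x = 0 -> x = 0 }.

Section Morphism.
Variables (k kbar : fieldType) (iota : {rmorphism k -> kbar}) (n m d : nat).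
Variable f : projMorphism iota n m d.

Lemma polyEval_map (K E : fieldType) (j : {rmorphism K -> E})
    (F : 'I_m.+1 -> {mpoly K[n.+1]}) (x : 'rV[K]_n.+1) :
  polyEval (fun i => map_mpoly j (F i)) (map_mx j x) = map_mx j (polyEval F x).
Proof.
apply/rowP => i; rewrite !mxE; set p := F i.
have -> : map_mpoly j p = \sum_(mu <- msupp p) j p@_mu *: 'X_[mu].
  rewrite [in LHS](mpolyE p) (raddf_sum (map_mpoly j)).
  apply: eq_bigr => mu _.
  by rewrite -[LHS]/(map_mpoly j (p@_mu *: 'X_[mu])) map_mpolyZ map_mpolyX.
rewrite (raddf_sum (meval _)) [in RHS]mevalE (raddf_sum j).
apply: eq_bigr => mu _.
rewrite -[LHS]/((j p@_mu *: 'X_[mu]).@[_]) mevalZ mevalX [RHS](rmorphM j).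
rewrite rmorph_prod /=; congr (_ * _).
by apply: eq_bigr => l _; rewrite mxE rmorphXn.
Qed.

Lemma forms_neq0 (x : 'rV[k]_n.+1) : x != 0 -> polyEval (forms f) x != 0.
Proof.
apply: contraNneq => Fx0; rewrite -(map_mx_eq0 iota); apply/eqP.
by apply: (forms_nozero (p := f)); rewrite polyEval_map Fx0 map_mx0.
Qed.

Definition projMap (P : projSpace k n) : projSpace k m :=
  point (forms_neq0 (homCoords_neq0 P)).

Lemma meval_homog (K : fieldType) (p : {mpoly K[n.+1]}) (c : K)
    (x : 'rV[K]_n.+1) :
  p \is d.-homog -> p.@[(c *: x) 0] = c ^+ d * p.@[x 0].
Proof.
move=> /dhomogP hp; rewrite !mevalE mulr_sumr big_seq [RHS]big_seq.
apply: eq_bigr => mu /hp dmu; rewrite [RHS]mulrCA; congr (_ * _).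
have -> : d = (\sum_i mu i)%N by rewrite -dmu -mdegE.
by rewrite -prodrXr -big_split; apply: eq_bigr => i _; rewrite mxE exprMn.
Qed.

Lemma polyEval_scale (K : fieldType) (F : 'I_m.+1 -> {mpoly K[n.+1]}) (c : K)
    (x : 'rV[K]_n.+1) :
  (forall i, F i \is d.-homog) -> polyEval F (c *: x) = c ^+ d *: polyEval F x.
Proof. by move=> hF; apply/rowP => i; rewrite !mxE meval_homog. Qed.

Lemma point_scale (K : fieldType) N (c : K) (x y : 'rV[K]_N.+1)
    (x0 : x != 0) (y0 : y != 0) : y = c *: x -> point y0 = point x0.
Proof.
move=> yx; apply: val_inj => /=; apply/eqP; rewrite eqEdim -memvE !dim_vline x0 y0.
by rewrite andbT; apply/vlineP; exists c.
Qed.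

Lemma projMap_point (x : 'rV[k]_n.+1) (x0 : x != 0) :
  projMap (point x0) = point (forms_neq0 x0).
Proof.
have [c c0 xE] := homCoords_point x0.
by apply: (@point_scale _ _ (c ^+ d)); rewrite xE polyEval_scale //; exact: forms_homog.
Qed.

End Morphism.

Section Defect.
Variables (K : fieldType) (w : discreteValuation K).

Definition minOrd N (x : 'rV[K]_N) : \bar int := \big[mine/+oo%E]_(i < N) w (x 0 i).

(* [fine] sends +oo to 0, but both minima are finite for the forms of a
   projMorphism over a completion of k. *)
Definition localDefect n m (d : nat) (F : 'I_m.+1 -> {mpoly K[n.+1]})
    (P : projSpace K n) : int :=
  fine (minOrd (polyEval F (homCoords P))) - d%:Z * fine (minOrd (homCoords P)).

Lemma minOrd_fin N (x : 'rV[K]_N) : x != 0 -> exists a : int, minOrd x = a%:E.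
Proof.
move=> /rV0Pn[i xi]; have [a wa] := ord_fin w xi.
have : (minOrd x <= a%:E)%E.
  by rewrite -wa /minOrd (bigD1 i) //= ge_min lexx.
have : minOrd x != -oo%E.
  apply: (big_ind (fun e => e != -oo%E)) => // [e f|j _]; last exact: ord_neq_ninfty.
  by rewrite minEle; case: ifP.
by case: (minOrd x) => // b; exists b.
Qed.

Lemma minOrd_scale N (c : K) (x : 'rV[K]_N) (a : int) : w c = a%:E ->
  minOrd (c *: x) = (a%:E + minOrd x)%E.
Proof.
move=> wc; rewrite /minOrd.
rewrite (big_morph (fun e => a%:E + e)%E (id1 := +oo%E) (op1 := mine)) //.
  by apply: eq_bigr => i _; rewrite mxE ordM wc.
by move=> e f /=; rewrite minEle [RHS]minEle leeD2lE //; case: ifP.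
Qed.

Lemma localDefect_point n m d (F : 'I_m.+1 -> {mpoly K[n.+1]})
    (x : 'rV[K]_n.+1) (x0 : x != 0) :
  (forall i, F i \is d.-homog) -> polyEval F x != 0 ->
  localDefect d F (point x0) =
    fine (minOrd (polyEval F x)) - d%:Z * fine (minOrd x).
Proof.
move=> hF Fx; have [c c0 xE] := homCoords_point x0; have [a wc] := ord_fin w c0.
rewrite /localDefect xE (polyEval_scale _ _ hF).
rewrite (minOrd_scale _ (ordX d wc)) (minOrd_scale _ wc).
have [b ->] := minOrd_fin Fx; have [e ->] := minOrd_fin x0 => /=.
by rewrite -mulr_natl mulrDr opprD addrACA -natz subrr add0r.
Qed.

End Defect.

Section Main.
Variable k : fieldExtType rat.

Definition Phi N (P : projSpace k N) : classGroup k :=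
  idealClass (generated (homCoords_neq0 P)).

Lemma Phi_point N (x : 'rV[k]_N.+1) (x0 : x != 0) :
  Phi (point x0) = idealClass (generated x0).
Proof.
have [c c0 xE] := homCoords_point x0; apply/esym/idealClassP; exists c => //.
apply/seteqP; split=> [y [a [Oa ->]]|_ [_ [a [Oa ->]] <-]].
  exists (\sum_i a 0 i * x 0 i); first by exists a.
  by rewrite mulr_sumr; apply: eq_bigr => i _; rewrite xE mxE mulrCA.
exists a; split=> //.
by rewrite mulr_sumr; apply: eq_bigr => i _; rewrite xE mxE mulrCA.
Qed.

Definition classPowers (d : nat) : set (classGroup k) :=
  [set (c ^+ d)%g | c in [set: classGroup k]].

Variables (kbar : fieldType) (iota : {rmorphism k -> kbar}) (n m d : nat).
Variables (f : projMorphism iota n m d) (L : {vspace 'rV[k]_n.+1}).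

Definition defectSet (v : finitePlace k) : set int :=
  [set localDefect (completion_ord v) d
         (fun i => map_mpoly (completion_embed v) (forms f i)) P |
     P in linearSubspace (baseChange (completion_embed v) L)].

(* The class of prod_v p_v^(a v), the product being over the finite set [S]
   outside which [a] vanishes. *)
Definition defectClasses : set (classGroup k) :=
  [set c | exists (a : finitePlace k -> int) (S : seq (finitePlace k)),
     [/\ forall v, defectSet v (a v), uniq S, forall v, v \notin S -> a v = 0 &
       c = (\big[*%g/1%g]_(v <- S) cl_expz (idealClass (primeIdeal v)) (a v))%g]].

End Main.

Arguments classPowers : clear implicits.

(* Main.v *)
Require Import Defs.
From HB Require Import structures.
From mathcomp Require Import all_boot all_order all_algebra all_field.
From mathcomp Require Import mpoly.
From mathcomp Require Import boolp classical_sets functions constructive_ereal.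
From mathcomp Require Import zify ring.

(** The ideal generated by the values [F_i(x)] is, place by place, the product of
    the [d]-th power of the ideal generated by the coordinates of [x] and of the
    primes [p_v] raised to the local defects of [x]. Taking classes gives one
    inclusion. For the other one, local defects [a_v] and a class [c] being given,
    one looks for a rational point of the subspace that is [v]-adically close to a
    point with defect [a_v] at all places of a finite set, and whose coordinates
    generate a given ideal in the class [c]. Such a point exists by strong
    approximation, because the subspace has at least two coordinates: once the
    first one is chosen, the others can be made coprime to it at the finitely many
    remaining places ([global_point]).

    For this to work the defect must vanish at almost all places. As the forms
    have no common zero, powers of the coordinates are combinations of the forms
    ([homogeneous_nullstellensatz]), and the coefficients of these combinations
    bound the defect ([delta_bound]). The same bound shows that the classes of
    products of local defects are finite in number, whence the finite union of
    cosets. The Nullstellensatz is derived from the extension theorem for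
    specializations ([chevalley]): a generic point of projective space, divided by
    its coordinate of least valuation, specializes to a common zero of the forms
    as soon as no power of some coordinate lies in their ideal.

    Since a finite place is a normalized discrete valuation, arithmetic in the
    ring of integers is developed from valuations. The local ring at a nonzero
    prime is a valuation ring because in any polynomial equation of [x] the leading
    coefficient [a] gives two algebraic integers [a] and [a * x] ([prufer]). It is
    discrete because elements with different values modulo the value of the residue
    characteristic are linearly independent over the rationals
    ([value_chain_bound], [prime_place]); the same argument bounds the number of
    places above a prime number ([places_above_bound]). Membership in a fractional
    ideal can then be tested at the finite places ([ideal_local]), so that ideals
    and their classes can be replaced by their orders ([classHasOrd]). *)

Set Implicit Arguments.
Unset Strict Implicit.
Unset Printing Implicit Defensive.

Import Order.TTheory GRing.Theory Num.Theory.
Local Open Scope classical_set_scope.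
Local Open Scope ring_scope.

(** * Extending specializations to valuation rings *)

(** Zorn's lemma for families of sets above a given one; it produces both
    valuation rings and maximal ideals below. *)
Lemma Zorn_above (T : Type) (P : set (set T)) (A0 : set T) : P A0 ->
    (forall F : set (set T), F `<=` P -> F !=set0 -> total_on F subset ->
       P (\bigcup_(X in F) X)) ->
  exists A, [/\ A0 `<=` A, P A & forall B, A `<=` B -> P B -> B `<=` A].
Proof.
move=> PA0 Pchain.
have [F FP Ftot|A [PA Amax]] := @Zorn_bigcup _ [set A | P (A0 `|` A)].
  have [F0|/set0P Fn0] := eqVneq F set0.
    by rewrite /= F0 bigcup_set0 setU0.
  rewrite /=; have -> : A0 `|` \bigcup_(X in F) X = \bigcup_(X in [set A0 `|` Y | Y in F]) X.
    rewrite bigcup_image; apply/seteqP; split=> x.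
      case: Fn0 => Y FY [A0x|[Z FZ Zx]]; first by exists Y => //; left.
      by exists Z => //; right.
    by move=> [Y FY [|Yx]]; [left|right; exists Y].
  apply: Pchain => [_ [Y /FP PY <-] //||_ _ [Y FY <-] [Z FZ <-]].
    by case: Fn0 => Y FY; exists (A0 `|` Y), Y.
  by have [YZ|ZY] := Ftot _ _ FY FZ; [left|right]; exact: setUS.
exists (A0 `|` A); split=> // B AB PB x Bx; apply: contrapT => nx.
apply: (Amax B); last by rewrite /= setUidr // => y A0y; apply: AB; left.
split; last by move=> /(_ x Bx) Ax; apply: nx; right.
by move=> y Ay; apply: AB; right.
Qed.

Section Specializations.
Variables (K : fieldType) (E : closedFieldType).
Implicit Types rho : set (K * E).

(** A ring homomorphism from a subring of [K] to [E], given by its graph, so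
    that extending it is enlarging a set. *)
Definition specialization rho :=
  [/\ rho (1, 1), forall p q, rho p -> rho q -> rho (p - q),
      forall p q, rho p -> rho q -> rho (p * q) & forall y, rho (0, y) -> y = 0].

Section Closure.
Variable rho : set (K * E).
Hypothesis rhoS : specialization rho.

Lemma spec1 : rho (1, 1). Proof. by case: rhoS. Qed.
Lemma specB p q : rho p -> rho q -> rho (p - q). Proof. by case: rhoS => _ + _ _; exact. Qed.
Lemma specM p q : rho p -> rho q -> rho (p * q). Proof. by case: rhoS => _ _ + _; exact. Qed.
Lemma spec_fun y : rho (0, y) -> y = 0. Proof. by case: rhoS => _ _ _; exact. Qed.
Lemma spec0 : rho 0. Proof. by rewrite -(subrr (1, 1)); apply: specB; exact: spec1. Qed.
Lemma specN p : rho p -> rho (- p).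
Proof. by move=> hp; rewrite -sub0r; apply: specB => //; exact: spec0. Qed.
Lemma specD p q : rho p -> rho q -> rho (p + q).
Proof. by move=> hp hq; rewrite -[q]opprK; apply: specB => //; exact: specN. Qed.
Lemma spec_sum (I : Type) (r : seq I) (P : pred I) F :
  (forall i, P i -> rho (F i)) -> rho (\sum_(i <- r | P i) F i).
Proof. by move=> h; apply: big_ind => //; [exact: spec0|exact: specD]. Qed.
Lemma specX p j : rho p -> rho (p ^+ j).
Proof.
by move=> hp; elim: j => [|j IH]; [exact: spec1|rewrite exprS; exact: specM].
Qed.
Lemma spec_inj x y z : rho (x, y) -> rho (x, z) -> y = z.
Proof.
move=> hy hz; apply/eqP; rewrite -subr_eq0; apply/eqP/spec_fun.
by have := specB hy hz; rewrite -[_ - _]/(x - x, y - z) subrr.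
Qed.

End Closure.

Lemma specialization_chain (F : set (set (K * E))) :
  F `<=` specialization -> F !=set0 -> total_on F subset ->
  specialization (\bigcup_(X in F) X).
Proof.
move=> FS [X0 FX0] Ftot.
have two p q : (\bigcup_(X in F) X) p -> (\bigcup_(X in F) X) q ->
    exists2 X, F X & X p /\ X q.
  move=> [X FX Xp] [Y FY Yq]; have [XY|YX] := Ftot _ _ FX FY.
    by exists Y => //; split=> //; exact: XY.
  by exists X => //; split=> //; exact: YX.
split.
- by exists X0 => //; exact: spec1 (FS _ FX0).
- by move=> p q /two h /h[X FX [Xp Xq]]; exists X => //; exact: specB (FS _ FX) _ _ _ _.
- by move=> p q /two h /h[X FX [Xp Xq]]; exists X => //; exact: specM (FS _ FX) _ _ _ _.
- by move=> y [X FX]; exact: spec_fun (FS _ FX) _.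
Qed.

Section Maximal.
Variable rho : set (K * E).
Hypotheses (rhoS : specialization rho)
  (rho_max : forall sigma, rho `<=` sigma -> specialization sigma -> sigma `<=` rho).

(** The pairs [(a / x ^ j, b / y ^ j)] form the extension to the localization
    at [x], which maximality forces to be trivial. *)
Lemma max_specV x y : rho (x, y) -> y != 0 -> rho (x^-1, y^-1).
Proof.
move=> xy y0.
have x0 : x != 0.
  by apply: contraNneq y0 => x0; rewrite x0 in xy; rewrite (spec_fun rhoS xy).
pose sigma := [set p : K * E | exists j a, rho a /\ p = (a.1 / x ^+ j, a.2 / y ^+ j)].
apply: (rho_max (sigma := sigma)); last first.
- by exists 1%N, (1, 1); split; [exact: spec1|rewrite /= !expr1 !mul1r].
- split.
  + by exists 0%N, (1, 1); split; [exact: spec1|rewrite /= !expr0 !divr1].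
  + move=> _ _ [i [a [ha ->]]] [j [b [hb ->]]]; exists (i + j)%N.
    exists (a * (x, y) ^+ j - b * (x, y) ^+ i); split.
      by apply: specB => //; apply: specM => //; exact: specX.
    have h1 : forall l, ((x, y) ^+ l : K * E) = (x ^+ l, y ^+ l).
      by elim=> // l IH; rewrite !exprS IH.
    rewrite !h1 -[LHS]/(a.1 / x ^+ i - b.1 / x ^+ j, a.2 / y ^+ i - b.2 / y ^+ j).
    rewrite -[in RHS]/(_, _) /= !exprD; congr (_, _); field;
    by rewrite ?expf_neq0.
  + move=> _ _ [i [a [ha ->]]] [j [b [hb ->]]]; exists (i + j)%N, (a * b).
    split; first exact: specM.
    by rewrite -[RHS]/(_, _) /= !exprD !invfM; congr (_, _); rewrite mulrACA.
  + move=> z [j [[a b] [ha [/esym/eqP]]]].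
    rewrite mulf_eq0 invr_eq0 expf_eq0 (negPf x0) andbF orbF => /eqP a0 ->.
    by rewrite a0 in ha; rewrite /= (spec_fun rhoS ha) mul0r.
- by move=> p hp; exists 0%N, p; split=> //; rewrite !expr0 !divr1 -surjective_pairing.
Qed.

(** Polynomials over the graph [rho]: [numer] has coefficients in the domain and
    [resid] is its image under the homomorphism. *)
Definition over (P : {poly (K * E)%type}) := forall i, rho P`_i.
Definition numer (P : {poly (K * E)%type}) : {poly K} := map_poly fst P.
Definition resid (P : {poly (K * E)%type}) : {poly E} := map_poly snd P.

Lemma overC p : rho p -> over p%:P.
Proof. by move=> hp i; rewrite coefC; case: eqP => // _; exact: spec0. Qed.

Lemma overB P Q : over P -> over Q -> over (P - Q).
Proof. by move=> hP hQ i; rewrite coefB; apply: specB. Qed.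

Lemma overM P Q : over P -> over Q -> over (P * Q).
Proof.
by move=> hP hQ i; rewrite coefM; apply: spec_sum => // j _; apply: specM.
Qed.

Lemma overXn j : over 'X^j.
Proof.
by move=> i; rewrite coefXn; case: eqP => _; [exact: spec1|exact: spec0].
Qed.

Lemma horner_pair (P : {poly (K * E)%type}) t b :
  P.[(t, b)] = ((numer P).[t], (resid P).[b]).
Proof.
rewrite [LHS]surjective_pairing; congr (_, _).
  by rewrite /numer -[t in RHS]/((t, b).1) horner_map.
by rewrite /resid -[b in RHS]/((t, b).2) horner_map.
Qed.

(** If [t] could be sent to [b], then [rho] would not be maximal; the obstruction
    is a polynomial relation on [t] whose residue does not vanish at [b]. *)
Lemma extend_fail t b : (forall c, ~ rho (t, c)) ->
  exists P, [/\ over P, (numer P).[t] = 0 & (resid P).[b] != 0].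
Proof.
move=> nt; apply: contrapT => nP; apply: (nt b).
apply: (rho_max (sigma := [set P.[(t, b)] | P in over])).
- by move=> p hp; exists p%:P; [exact: overC|rewrite hornerC].
- split.
  + by exists 1%:P; [apply: overC; exact: spec1|rewrite hornerC].
  + by move=> _ _ [P hP <-] [Q hQ <-]; exists (P - Q); [exact: overB|rewrite !hornerE].
  + by move=> _ _ [P hP <-] [Q hQ <-]; exists (P * Q); [exact: overM|rewrite hornerM].
  + move=> y [P hP]; rewrite horner_pair => -[Pt Pb]; apply: contrapT => y0.
    by apply: nP; exists P; split=> //; rewrite Pb; apply/eqP.
- by exists 'X; [rewrite -['X]expr1; exact: overXn|rewrite hornerX].
Qed.

(** The residues of the relations on [t] form an ideal of polynomials, and by
    [extend_fail] they have no common root in [E]. A nonzero residue of minimal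
    degree would divide all the others, hence have a common root with them,
    unless it is constant. *)
Lemma resid_unit t : (forall c, ~ rho (t, c)) ->
  exists P, [/\ over P, (numer P).[t] = 0 & size (resid P) = 1%N].
Proof.
move=> nt.
pose good n := `[< exists P, [/\ over P, (numer P).[t] = 0, resid P != 0 &
  size (resid P) = n] >].
have exg : exists n, good n.
  have [P [oP Pt P0]] := extend_fail 0 nt.
  exists (size (resid P)); apply/asboolP; exists P; split=> //.
  by apply: contraNneq P0 => ->; rewrite horner0.
case: (ex_minnP exg) => _ /asboolP[P [oP Pt P0 <-]] Pmin.
have [/closed_rootP[b rb]|] := boolP (size (resid P) != 1%N); last first.
  by move/negPn/eqP; exists P.
pose good' n := `[< exists Q, [/\ over Q, (numer Q).[t] = 0, (resid Q).[b] != 0 &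
  size (resid Q) = n] >].
have exg' : exists n, good' n.
  have [Q [oQ Qt Q0]] := extend_fail b nt.
  by exists (size (resid Q)); apply/asboolP; exists Q.
case: (ex_minnP exg') => _ /asboolP[Q [oQ Qt Qb <-]] Qmin.
have Q0 : resid Q != 0 by apply: contraNneq Qb => ->; rewrite horner0.
have lePQ : (size (resid P) <= size (resid Q))%N.
  by apply: Pmin; apply/asboolP; exists Q.
pose lP := P`_(size (resid P)).-1; pose lQ := Q`_(size (resid Q)).-1.
have lP2 : lP.2 = lead_coef (resid P) by rewrite lead_coefE coef_map.
have lQ2 : lQ.2 = lead_coef (resid Q) by rewrite lead_coefE coef_map.
have lP0 : lP.2 != 0 by rewrite lP2 lead_coef_eq0.
have oV : rho (lP.1^-1, lP.2^-1).
  by apply: max_specV => //; rewrite -surjective_pairing; exact: oP.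
pose c : K * E := lQ * (lP.1^-1, lP.2^-1).
have oc : rho c by apply: specM => //; exact: oQ.
pose e := (size (resid Q) - size (resid P))%N.
(* One step of division by [resid P] keeps the value at the root [b]. *)
pose Q' := Q - c%:P * 'X^e * P.
have oQ' : over Q'.
  by apply: overB => //; apply: overM => //; apply: overM; [exact: overC|exact: overXn].
have nQ' : (numer Q').[t] = 0.
  have := congr1 fst (horner_pair Q' t 0); rewrite /= => <-.
  rewrite /Q' hornerD hornerN hornerM !horner_pair Pt Qt.
  by rewrite -[LHS]/(0 - _ * 0) mulr0 subr0.
have rQ' : resid Q' = resid Q - c.2%:P * 'X^e * resid P.
  rewrite /Q'; move: (c) => a.
  by rewrite /resid rmorphB !rmorphM /= map_polyXn map_polyC.
have Q'b : (resid Q').[b] != 0.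
  by rewrite rQ' hornerD hornerN hornerM (rootP rb) mulr0 subr0.
have : (size (resid Q) <= size (resid Q'))%N.
  by apply: Qmin; apply/asboolP; exists Q'.
have szP : (0 < size (resid P))%N by rewrite size_poly_gt0.
suff : (size (resid Q') <= (size (resid Q)).-1)%N.
  by move: szP lePQ; clear; lia.
apply/leq_sizeP => j hj; rewrite rQ' coefB -mulrA coefCM coefXnM.
have [hj'|hj'] := ltnP j e; first by move: hj' hj szP; rewrite /e; clear; lia.
have [jE|jN] := eqVneq j (size (resid Q)).-1.
  have -> : (j - e)%N = (size (resid P)).-1 by rewrite jE /e; move: szP lePQ; clear; lia.
  rewrite -lead_coefE jE -lead_coefE -lP2 -lQ2 -[c.2]/(lQ.2 / lP.2).
  by rewrite divfK // subrr.
have hj2 : (size (resid Q) <= j)%N by move: hj jN; clear; lia.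
have hjP : (size (resid P) <= j - e)%N.
  by rewrite /e; move: szP lePQ hj2; clear; lia.
by rewrite (nth_default _ hj2) (nth_default _ hjP) mulr0 subr0.
Qed.

(** The maximal ideal of the domain of [rho] generates the unit ideal after
    adjoining [t]. *)
Definition unit_relation (t : K) N := exists p : {poly K},
  [/\ p.[t] = 0, (size p <= N)%N, rho (p`_0, 1) & forall i, (0 < i)%N -> rho (p`_i, 0)].

Lemma unit_relationP t : (forall c, ~ rho (t, c)) -> exists N, unit_relation t N.
Proof.
move=> /resid_unit[P [oP Pt szP]].
have c0 : (P`_0).2 != 0.
  have -> : (P`_0).2 = lead_coef (resid P) by rewrite lead_coefE szP coef_map.
  by rewrite lead_coef_eq0 -size_poly_gt0 szP.
have oV : rho ((P`_0).1^-1, (P`_0).2^-1).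
  by apply: max_specV => //; rewrite -surjective_pairing; exact: oP.
exists (size ((P`_0).1^-1 *: numer P)), ((P`_0).1^-1 *: numer P); split=> //.
- by rewrite hornerZ Pt mulr0.
- rewrite coefZ coef_map; have := specM rhoS oV (oP 0%N).
  by rewrite -[_ * _]/(_, _) /= (mulVf c0).
- move=> i i0; rewrite coefZ coef_map; have := specM rhoS oV (oP i).
  rewrite -[_ * _]/(_, _) /=; suff -> : (P`_i).2 = 0 by rewrite mulr0.
  have -> : (P`_i).2 = (resid P)`_i by rewrite coef_map.
  by rewrite nth_default // szP.
Qed.

(** Relations on [t] and on [t^-1] cancel each other's leading terms, as in the
    classical proof that a maximal local ring is a valuation ring: the relation
    on [t^-1], multiplied by a power of [t], has a unit as leading coefficient. *)
Lemma unit_relation_step t N : t != 0 -> (0 < N)%N ->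
  unit_relation t N -> unit_relation t^-1 N -> unit_relation t N.-1.
Proof.
case: N => // N t0 _ [p [pt szp p0 pi]] [r [rt szr r0 ri]] /=.
have r00 : r`_0 != 0.
  apply/eqP => r00; rewrite r00 in r0.
  by have /eqP := spec_fun rhoS r0; rewrite oner_eq0.
have oV : rho ((r`_0)^-1, 1).
  by have := max_specV r0 (oner_neq0 _); rewrite invr1.
case: N szp szr => [szp szr|N szp szr].
  have p00 : p`_0 = 0.
    by move: pt; rewrite (size1_polyC szp) hornerC coefC.
  by rewrite p00 in p0; have /eqP := spec_fun rhoS p0; rewrite oner_eq0.
have rN : rho (p`_N.+1 / r`_0, 0).
  by have := specM rhoS (pi N.+1 isT) oV; rewrite -[_ * _]/(_, _) /= mul0r.
have expK j l : (j <= l)%N -> t ^+ l * t^-1 ^+ (l - j) = t ^+ j.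
  by move=> jl; rewrite -{1}(subnKC jl) exprD exprVn mulfK // expf_neq0.
exists (\poly_(i < N.+1) (p`_i - p`_N.+1 / r`_0 * r`_(N.+1 - i))); split.
- set q := \poly_(i < _) _.
  suff : q.[t] = p.[t] - p`_N.+1 / r`_0 * (t ^+ N.+1 * r.[t^-1]).
    by rewrite pt rt !mulr0 subr0.
  rewrite (horner_coef_wide t szp) (horner_coef_wide t^-1 szr) horner_poly.
  rewrite !mulr_sumr [X in _ - X](reindex_inj rev_ord_inj) /= -sumrB [RHS]big_ord_recr /=.
  rewrite [X in _ = _ + (_ - X)](_ : _ = p`_N.+1 * t ^+ N.+1).
    rewrite subrr addr0; apply: eq_bigr => i _; rewrite mulrBl; congr (_ - _).
    rewrite subSS -!mulrA; congr (_ * (_ * _)).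
    rewrite mulrCA; congr (_ * _).
    by rewrite expK // ltnW.
  by rewrite subSS subnn expr0 mulr1 mulrCA mulrC divfK.
- exact: size_poly.
- rewrite coef_poly /=.
  have := specB rhoS p0 (specM rhoS rN (ri N.+1 isT)).
  by rewrite subn0 -[_ - _]/(_, _) /= mul0r subr0.
- move=> i i0; rewrite coef_poly; case: ltnP => [iN|_]; last exact: spec0.
  have hr : (0 < N.+1 - i)%N by lia.
  have := specB rhoS (pi _ i0) (specM rhoS rN (ri _ hr)).
  by rewrite -[_ - _]/(_, _) /= mul0r subr0.
Qed.

Lemma unit_relationS t N N' : (N <= N')%N -> unit_relation t N -> unit_relation t N'.
Proof. by move=> NN [p [? szp ? ?]]; exists p; split=> //; exact: leq_trans szp NN. Qed.

Lemma max_spec_valuation t : exists c, rho (t, c) \/ rho (t^-1, c).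
Proof.
apply: contrapT => /forallNP nt.
have nt1 c : ~ rho (t, c) by move=> h; apply: (nt c); left.
have nt2 c : ~ rho (t^-1, c) by move=> h; apply: (nt c); right.
have t0 : t != 0 by apply/eqP => t0; apply: (nt1 0); rewrite t0; exact: spec0.
have [N hN] := unit_relationP nt1; have [N' hN'] := unit_relationP nt2.
have no0 s : ~ unit_relation s 0.
  move=> [p [_]]; rewrite leqn0 size_poly_eq0 => /eqP -> + _.
  by rewrite coef0 => /(spec_fun rhoS)/eqP; rewrite oner_eq0.
have [s] := ubnP (N + N'); elim: s N N' t {nt nt1 nt2} t0 hN hN' => // s IH N N' t t0 hN hN'.
rewrite ltnS => hs.
wlog NN : N N' t t0 hN hN' hs / (N' <= N)%N => [wl|].
  have [|/ltnW h] := leqP N' N; first exact: (wl N N' t).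
  by apply: (wl N' N t^-1); rewrite ?invr_eq0 ?invrK 1?addnC.
case: N hN hs NN => [/no0//|N] hN hs NN.
apply: (IH N N' t) => //.
by apply: (unit_relation_step (N := N.+1)) => //; exact: unit_relationS hN'.
Qed.

End Maximal.

(** Chevalley's extension theorem: a maximal extension of the homomorphism is
    defined on a valuation ring. *)
Theorem chevalley (rho0 : set (K * E)) : specialization rho0 ->
  exists rho, [/\ rho0 `<=` rho, specialization rho &
    forall t, exists c, rho (t, c) \/ rho (t^-1, c)].
Proof.
move=> /Zorn_above/(_ specialization_chain)[rho [r0 rS rmax]].
by exists rho; split=> //; exact: max_spec_valuation.
Qed.

End Specializations.

(** * A homogeneous Nullstellensatz *)

Lemma seq_has_max (T : Type) (s : seq T) (le : T -> T -> Prop) x0 :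
  (forall x y, le x y \/ le y x) -> (forall y x z, le x y -> le y z -> le x z) ->
  exists x, forall i, (i < size s)%N -> le (nth x0 s i) x.
Proof.
move=> tot tr; elim: s => [|a s [x IH]]; first by exists x0.
have [ax|xa] := tot a x; first by exists x => -[|i] //=; exact: IH.
exists a => -[|i] //= hi; first by case: (tot a a).
exact: tr (IH _ hi) xa.
Qed.

Lemma dhomog_map (K L : fieldType) (j : {rmorphism K -> L}) n d (p : {mpoly K[n]}) :
  p \is d.-homog -> map_mpoly j p \is d.-homog.
Proof.
move=> /dhomogP hp; apply/dhomogP => mu.
by rewrite (perm_mem (msupp_map_mpoly p (fmorph_inj j))); exact: hp.
Qed.

Lemma map_mpoly_term (K L : fieldType) (j : {rmorphism K -> L}) n c mu
    (p : {mpoly K[n]}) :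
  map_mpoly j (c *: 'X_[mu] + p) = j c *: 'X_[mu] + map_mpoly j p.
Proof.
rewrite (raddfD (map_mpoly j)); congr (_ + _).
by rewrite -[LHS]/(map_mpoly j (c *: 'X_[mu])) map_mpolyZ map_mpolyX.
Qed.

(** Bringing the fractions [p / x ^ N] and [q / x ^ M] to a common denominator,
    modulo an ideal that contains [p - c * x ^ N] and [q - e * x ^ M]. *)
Section RingIdentities.
Variables (R : comNzRingType) (p q c e x : R) (N M : nat).

Lemma scaled_sub : (p - q) * x ^+ (N + M) = p * x ^+ N * x ^+ M - q * x ^+ M * x ^+ N.
Proof. rewrite exprD; ring. Qed.

Lemma shifted_sub : p * x ^+ M - q * x ^+ N - (c - e) * x ^+ (N + M) =
  x ^+ M * (p - c * x ^+ N) + (- x ^+ N) * (q - e * x ^+ M).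
Proof. rewrite exprD; ring. Qed.

Lemma shifted_mul : p * q - (c * e) * x ^+ (N + M) =
  q * (p - c * x ^+ N) + (c * x ^+ N) * (q - e * x ^+ M).
Proof. rewrite exprD; ring. Qed.

End RingIdentities.

Section Nullstellensatz.
Variables (k : fieldType) (E : closedFieldType) (iota : {rmorphism k -> E}).
Variables (n m d : nat) (f : projMorphism iota n m d).

Local Notation F := (forms f).
Local Notation K := {fraction {mpoly k[n.+1]}}.
Local Notation tf := (@tofrac {mpoly k[n.+1]}).

Definition formIdeal : set {mpoly k[n.+1]} :=
  [set q | exists G : 'I_m.+1 -> {mpoly k[n.+1]}, q = \sum_i G i * F i].

Lemma formIdeal0 : formIdeal 0.
Proof. by exists (fun=> 0); rewrite big1 // => i _; rewrite mul0r. Qed.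

Lemma formIdealD p q : formIdeal p -> formIdeal q -> formIdeal (p + q).
Proof.
move=> [G ->] [H ->]; exists (fun i => G i + H i); rewrite -big_split.
by apply: eq_bigr => i _; rewrite mulrDl.
Qed.

Lemma formIdealM p q : formIdeal q -> formIdeal (p * q).
Proof.
move=> [G ->]; exists (fun i => p * G i); rewrite mulr_sumr.
by apply: eq_bigr => i _; rewrite mulrA.
Qed.

Lemma formIdeal_form i : formIdeal (F i).
Proof.
exists (fun l => (l == i)%:R); rewrite (bigD1 i) //= eqxx mul1r big1 ?addr0 // => l.
by move=> /negPf->; rewrite mul0r.
Qed.

Definition constC : {rmorphism k -> K} := (tf \o @mpolyC n.+1 k)%FUN.

Lemma generic_value p : (map_mpoly constC p).@[fun i => tf 'X_i] = tf p.
Proof.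
elim/mpolyind: p => [|c mu p _ _ IH]; first by rewrite (raddf0 (map_mpoly _)) meval0 tofrac0.
rewrite map_mpoly_term mevalD mevalZ mevalX IH tofracD.
rewrite -mul_mpolyC tofracM; congr (_ * _ + _).
rewrite mpolyXE_id rmorph_prod; apply: eq_bigr => i _.
by rewrite rmorphXn.
Qed.

Lemma spec_meval (rho : set (K * E)) (y : 'I_n.+1 -> K) (b : 'I_n.+1 -> E) p :
  specialization rho -> (forall c, rho (constC c, iota c)) ->
  (forall i, rho (y i, b i)) ->
  rho ((map_mpoly constC p).@[y], (map_mpoly iota p).@[b]).
Proof.
move=> rhoS rhoC rhoy; elim/mpolyind: p => [|c mu p _ _ IH].
  by rewrite !(raddf0 (map_mpoly _)) !meval0; exact: spec0 rhoS.
rewrite !map_mpoly_term !mevalD !mevalZ !mevalX.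
have hX i l : rho (y i ^+ l, b i ^+ l).
  elim: l => [|l IHl]; first exact: spec1.
  by rewrite !exprS; exact: (specM rhoS (rhoy i) IHl).
have hP : rho (\prod_i y i ^+ mu i, \prod_i b i ^+ mu i).
  elim/big_rec2: _ => [|i u v _ h]; first exact: spec1.
  exact: (specM rhoS (hX _ _) h).
exact: (specD rhoS (specM rhoS (rhoC c) hP) IH).
Qed.

(** If no power of ['X_j] lies in the ideal of the forms, then sending every
    quotient of that ideal by a power of ['X_j] to 0 is a specialization of a
    subring of the field of rational functions; extend it to a valuation ring.
    Dividing the generic point by its coordinate of least valuation makes it
    integral, so that it specializes to a nonzero point of [E ^ n.+1], and the
    forms vanish there: their value at the scaled point is [F l / 'X_j ^ d],
    which specializes to 0, times a [d]-th power of an integral element. *)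
Theorem homogeneous_nullstellensatz (j : 'I_n.+1) :
  exists N, formIdeal ('X_j ^+ N).
Proof.
apply: contrapT => /forallNP nN.
pose x i := tf 'X_i.
have x0 i : x i != 0 by rewrite tofrac_eq0 -msupp_eq0 msuppX.
pose rho0 := [set p : K * E | exists c N q, [/\ p.2 = iota c,
  p.1 * x j ^+ N = tf q & formIdeal (q - c%:MP * 'X_j ^+ N)]].
have rho0S : specialization rho0.
  split.
  - exists 1, 0%N, 1; split; rewrite ?rmorph1 ?mulr1 ?tofrac1 //.
    by rewrite ?mpolyC1 ?mul1r subrr; exact: formIdeal0.
  - move=> [p1 p2] [q1 q2] [c [N [p [/= -> hp Ip]]]] [e [M [q [/= -> hq Iq]]]].
    exists (c - e), (N + M)%N, (p * 'X_j ^+ M - q * 'X_j ^+ N); split.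
    + exact: esym (rmorphB iota c e).
    + rewrite -[X in X * _]/(p1 - q1) rmorphB !rmorphM /= -hp -hq !rmorphXn /= -/(x j).
      exact: scaled_sub.
    + have -> : p * 'X_j ^+ M - q * 'X_j ^+ N - (c - e)%:MP * 'X_j ^+ (N + M) =
        'X_j ^+ M * (p - c%:MP * 'X_j ^+ N) +
        (- 'X_j ^+ N) * (q - e%:MP * 'X_j ^+ M) by rewrite mpolyCB; exact: shifted_sub.
      by apply: formIdealD; apply: formIdealM.
  - move=> [p1 p2] [q1 q2] [c [N [p [/= -> hp Ip]]]] [e [M [q [/= -> hq Iq]]]].
    exists (c * e), (N + M)%N, (p * q); split.
    + exact: esym (rmorphM iota c e).
    + by rewrite -[X in X * _]/(p1 * q1) rmorphM /= -hp -hq exprD mulrACA.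
    + have -> : p * q - (c * e)%:MP * 'X_j ^+ (N + M) =
        q * (p - c%:MP * 'X_j ^+ N) +
        (c%:MP * 'X_j ^+ N) * (q - e%:MP * 'X_j ^+ M) by rewrite mpolyCM; exact: shifted_mul.
      by apply: formIdealD; apply: formIdealM.
  - move=> y [c [N [q [/= -> /esym/eqP]]]]; rewrite mul0r tofrac_eq0 => /eqP -> Iq.
    have [->|c0] := eqVneq c 0; first by rewrite rmorph0.
    exfalso; apply: (nN N).
    have -> : 'X_j ^+ N = (- c^-1)%:MP * (0 - c%:MP * 'X_j ^+ N) :> {mpoly k[n.+1]}.
      by rewrite sub0r mulrN mulrA -mpolyCM mulNr mulVf // mpolyCN mpolyC1 mulNr mul1r opprK.
    exact: formIdealM.
have [rho [sub rhoS rhoV]] := chevalley rho0S.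
have rhoC c : rho (constC c, iota c).
  apply: sub; exists c, 0%N, c%:MP; split=> //=; first by rewrite mulr1.
  by rewrite mulr1 subrr; exact: formIdeal0.
have rhoF i : rho (tf (F i) / x j ^+ d, 0).
  apply: sub; exists 0, d, (F i); split=> /=; first by rewrite rmorph0.
    by rewrite divfK // expf_neq0.
  by rewrite mpolyC0 mul0r subr0; exact: formIdeal_form.
(* The preorder by decreasing valuation of the coordinates. *)
pose le i l := exists c, rho (x i / x l, c).
have le_total i l : le i l \/ le l i.
  have [c [h|]] := rhoV (x i / x l); first by left; exists c.
  by rewrite invfM invrK mulrC => h; right; exists c.
have le_tr l i h : le i l -> le l h -> le i h.
  move=> [b hb] [c hc]; exists (b * c); have := specM rhoS hb hc.
  by rewrite -[_ * _]/(_, _) /= mulrA divfK.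
have [i0 hi0] := seq_has_max (enum 'I_n.+1) j le_total le_tr.
have {}hi0 i : exists c, rho (x i / x i0, c).
  by have := hi0 (enum_rank i); rewrite nth_enum_rank; apply; rewrite -cardE; exact: ltn_ord.
pose b i := projT1 (cid (hi0 i)).
have hb i : rho (x i / x i0, b i) by rewrite /b; case: cid.
have bi0 : b i0 = 1.
  by have := hb i0; rewrite divff // => h; exact: spec_inj h (spec1 rhoS).
suff Fb : (\row_i b i) = 0.
  have /rowP/(_ i0) := Fb; rewrite !mxE bi0 => /eqP; by rewrite oner_eq0.
apply: (forms_nozero (p := f)); apply/rowP => l; rewrite !mxE.
pose y : 'rV[K]_n.+1 := (x i0)^-1 *: \row_i x i.
have yE : y 0 =1 (fun i => x i / x i0) by move=> i; rewrite !mxE mulrC.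
have bE : (\row_i b i : 'rV[E]_n.+1) 0 =1 b by move=> i; rewrite !mxE.
have h1 : rho ((map_mpoly constC (F l)).@[y 0], (map_mpoly iota (F l)).@[(\row_i b i) 0]).
  by apply: spec_meval => // i; rewrite yE bE.
apply: spec_inj h1 _ => //.
rewrite /y (meval_homog (d := d)); last exact: dhomog_map (forms_homog f l).
have -> : (map_mpoly constC (F l)).@[(\row_i x i) 0] = tf (F l).
  by rewrite -generic_value; apply: meval_eq => i; rewrite mxE.
have := specM rhoS (rhoF l) (specX rhoS d (hb j)).
have -> : ((x j / x i0, b j) ^+ d : K * E) = ((x j / x i0) ^+ d, b j ^+ d).
  by elim: (d) => // e IH; rewrite !exprS IH.
rewrite -[_ * _]/(_, _) /= mul0r.
by rewrite exprMn mulrA divfK ?expf_neq0 // exprVn mulrC.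
Qed.

End Nullstellensatz.

(** * Algebraic integers and prime ideals *)

Section IntegralElements.
Variable k : fieldExtType rat.
Local Notation O := (ringOfIntegers k).
Implicit Types x y : k.

Lemma OkN x : O x -> O (- x). Proof. exact: integral_opp. Qed.
Lemma OkB x y : O x -> O y -> O (x - y). Proof. exact: integral_sub. Qed.
Lemma OkX x i : O x -> O (x ^+ i).
Proof. by move=> Ox; elim: i => [|i IH]; [exact: Ok1|rewrite exprS; exact: OkM]. Qed.
Lemma Ok_sum (T : Type) (s : seq T) (P : pred T) (F : T -> k) :
  (forall i, P i -> O (F i)) -> O (\sum_(i <- s | P i) F i).
Proof. by move=> h; apply: (big_ind O) => //; [exact: Ok0|exact: OkD]. Qed.

Lemma Ok_horner_int (p : {poly int}) x : O x -> O (map_poly (intr : int -> k) p).[x].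
Proof.
move=> Ox; apply: integral_horner => //; apply/integral_poly => i.
by rewrite coef_map; exact: Okint.
Qed.

(** The constant term of an integral equation of [x] is a multiple of [x]. *)
Lemma Ok_dvd_int x : O x -> x != 0 ->
  exists2 y, O y & exists2 D : int, D != 0 & x * y = D%:~R.
Proof.
move=> Ox x0; have [p /monic_neq0 p0 /rootP px] := Ox.
elim/poly_ind: p p0 px => [|p c IH]; first by rewrite eqxx.
rewrite rmorphD rmorphM /= map_polyX map_polyC hornerD hornerMX hornerC.
have [-> pc /eqP|c0 _ /eqP] := eqVneq c 0.
  rewrite raddf0 addr0 mulf_eq0 (negPf x0) orbF => /eqP; apply: IH.
  by apply: contraNneq pc => ->; rewrite mul0r addr0.
rewrite addr_eq0 => /eqP h.
exists (map_poly (intr : int -> k) p).[x]; first exact: Ok_horner_int.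
by exists (- c); rewrite ?oppr_eq0 // mulrC h mulrNz.
Qed.

(** Multiply the equation of [x] by a power of its leading coefficient [a]: it
    becomes a monic equation for [a * x]. *)
Lemma Ok_lead_mul (p : {poly k}) x N : (forall i, O p`_i) -> (size p <= N.+2)%N ->
  p.[x] = 0 -> O (p`_N.+1 * x).
Proof.
move=> Op szp px; set a := p`_N.+1.
pose r : {poly k} := \poly_(i < N.+1) (p`_i * a ^+ (N - i)).
have szr : (size r < size ('X^(N.+1) : {poly k}))%N by rewrite size_polyXn ltnS size_poly.
apply: (@integral_root_monic _ _ _ _ ('X^(N.+1) + r)).
- by rewrite monicE lead_coefDl // lead_coefXn.
- rewrite rootE hornerD hornerXn horner_poly.
  have -> : \sum_(i < N.+1) p`_i * a ^+ (N - i) * (a * x) ^+ i =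
     a ^+ N * \sum_(i < N.+1) p`_i * x ^+ i.
    rewrite mulr_sumr; apply: eq_bigr => i _.
    have iN : (i <= N)%N by rewrite -ltnS.
    have -> : a ^+ N = a ^+ (N - i) * a ^+ i by rewrite -exprD subnK.
    by rewrite exprMn; ring.
  move: px; rewrite (horner_coef_wide x szp) big_ord_recr /= -/a.
  move=> /eqP; rewrite addr_eq0 => /eqP ->.
  by rewrite exprMn exprSr mulrN mulrA subrr.
- apply/integral_poly => i; rewrite coefD coefXn; apply: integral_add.
    by case: eqP => _; [exact: integral1|exact: integral0].
  rewrite coef_poly; case: ifP => _; last exact: integral0.
  by apply: OkM; [exact: Op|apply: OkX; exact: Op].
Qed.

(** More than [dim k] elements are linearly dependent over the rationals; clear
    denominators, then divide the coefficients by [q] as long as possible. *)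
Lemma int_relation (a : nat -> k) (q : nat) : prime q ->
  exists c : nat -> int, \sum_(i < (dim k).+1) (c i)%:~R * a i = 0 /\
    exists2 i : 'I_(dim k).+1, true & ~~ (q %| `|c i|)%N.
Proof.
move=> q_pr; set r := (dim k).+1.
have [b [b0 rel]] : exists b : 'I_r -> int, (exists i, b i != 0) /\
    \sum_i (b i)%:~R * a i = 0.
  pose X := [tuple a i | i < r].
  have nfree : ~~ free X.
    apply/negP; rewrite /free size_tuple => /eqP e.
    by have := dimvS (subvf <<X>>%VS); rewrite e dimvf ltnn.
  have /existsNP[c /not_implyP[relc /existsNP[i0 ci0]]] : ~ forall c : 'I_r -> rat,
     \sum_(i < r) c i *: X`_i = 0 -> forall i, c i = 0.
    by move=> h; move/negP: nfree; apply; apply/freeP.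
  pose p : {poly rat} := \poly_(i < r) c (inord i).
  have [s [e e0 pE]] := rat_poly_scale p.
  have cE i : c i = e%:~R^-1 * (s`_i)%:~R.
    have := congr1 (fun t : {poly rat} => t`_i) pE.
    by rewrite coef_poly ltn_ord inord_val coefZ coef_map_id0.
  exists (fun i => s`_i); split.
    by exists i0; apply/eqP => s0; apply: ci0; rewrite cE s0 mulr0.
  apply/eqP; have := relc.
  have -> : \sum_(i < r) c i *: X`_i =
      (e%:~R^-1 : rat) *: \sum_(i < r) (s`_i)%:~R * a i.
    rewrite scaler_sumr; apply: eq_bigr => i _.
    rewrite cE -scalerA scaler_int; congr (_ *: _).
    by rewrite -tnth_nth tnth_mktuple mulrzl.
  move/eqP; rewrite scaler_eq0 invr_eq0 intr_eq0 (negPf e0).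
  by [].
have [i0 bi0] := b0; clear b0.
have [s] := ubnP `|b i0|%N; elim: s b rel bi0 => // s IH b rel bi0; rewrite ltnS => hs.
have [/existsP[i hi]|] := boolP [exists i, ~~ (q %| `|b i|)%N].
  exists (fun i => b (inord i)); split; last by exists i; rewrite ?inord_val.
  by rewrite -[RHS]rel; apply: eq_bigr => i' _; rewrite inord_val.
rewrite negb_exists => /forallP dv.
have /choice[b' b'E] : forall i, exists b' : int, b i = b' * q%:Z.
  by move=> i; have := dv i; rewrite negbK => h; apply/dvdzP.
have q1 := prime_gt1 q_pr.
apply: (IH b').
- apply/eqP; have q0 : (q%:Z)%:~R != 0 :> k by apply: intr_neq0; lia.
  rewrite -(inj_eq (mulfI q0)) mulr0 -[X in _ == X]rel mulr_sumr; apply/eqP.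
  by apply: eq_bigr => i _; rewrite b'E intrM mulrA [_%:~R * _%:~R]mulrC.
- by apply: contraNneq bi0 => h; rewrite b'E h mul0r.
- have : b' i0 != 0 by apply: contraNneq bi0 => h; rewrite b'E h mul0r.
  move: hs; rewrite b'E abszM /=; move: q1; clear; nia.
Qed.

Record isPrimeIdeal (m : set k) : Prop := IsPrimeIdeal {
  primeI_sub : forall x, m x -> O x;
  primeI_D : forall x y, m x -> m y -> m (x + y);
  primeI_M : forall x y, O x -> m y -> m (x * y);
  primeI_1 : ~ m 1;
  primeI_prime : forall x y, O x -> O y -> m (x * y) -> m x \/ m y;
  primeI_neq0 : exists2 x, m x & x != 0 }.

Section PrimeIdeal.
Variables (m : set k) (mP : isPrimeIdeal m).

Lemma primeI_0 : m 0.
Proof.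
have [x mx _] := primeI_neq0 mP; rewrite -(mul0r x); apply: primeI_M => //.
exact: Ok0.
Qed.

Lemma primeI_N x : m x -> m (- x).
Proof. by move=> mx; rewrite -mulN1r; apply: primeI_M => //; exact/OkN/Ok1. Qed.

(** The least positive integer of [m] is the residue characteristic. *)
Lemma primeI_char : exists2 q : nat, prime q &
  forall c : int, m c%:~R <-> (q %| `|c|)%N.
Proof.
pose P := fun j : nat => (0 < j)%N && `[< m (j%:Z)%:~R >].
have mabs (c : int) : m c%:~R -> m (`|c|%:Z)%:~R.
  move=> mc; have [->//|->] : `|c|%:Z = c \/ `|c|%:Z = - c by lia.
  by rewrite rmorphN; exact: primeI_N.
have exP : exists j, P j.
  have [x mx x0] := primeI_neq0 mP.
  have [y Oy [D D0 xy]] := Ok_dvd_int (primeI_sub mP mx) x0.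
  exists `|D|%N; rewrite /P absz_gt0 D0; apply/asboolP/mabs.
  by rewrite -xy mulrC; apply: primeI_M.
case: (ex_minnP exP) => q /andP[q0 /asboolP mq] qmin.
have dvdE c : m c%:~R -> (q %| `|c|)%N.
  move=> /mabs mc; rewrite /dvdn; apply: contraT; rewrite -lt0n => r0.
  suff : (q <= `|c| %% q)%N by rewrite leqNgt ltn_mod q0.
  apply: qmin; rewrite /P r0; apply/asboolP.
  have -> : (`|c| %% q)%N%:Z = `|c|%:Z - (`|c| %/ q)%N%:Z * q%:Z.
    by rewrite {2}(divn_eq `|c| q); lia.
  rewrite rmorphB rmorphM /=; apply: primeI_D => //; apply: primeI_N.
  by apply: primeI_M => //; exact: Okint.
have q_pr : prime q.
  apply/primeP; split.
    rewrite ltn_neqAle q0 andbT; apply/eqP => q1.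
    by apply: (primeI_1 mP); move: mq; rewrite -q1.
  move=> e /dvdnP[e' qE]; move: (mq); rewrite qE PoszM rmorphM /= => mee.
  have [/dvdE|/dvdE] := primeI_prime mP (Okint _ _) (Okint _ _) mee.
    rewrite /= qE -{2}[e']muln1 dvdn_pmul2l ?dvdn1 => [->//|].
    by move: q0; rewrite qE muln_gt0 => /andP[].
  rewrite /= qE -{2}[e]mul1n dvdn_pmul2r ?dvdn1 => [/eqP->|].
    by rewrite mul1n eqxx orbT.
  by move: q0; rewrite qE muln_gt0 => /andP[].
exists q => // c; split; first exact: dvdE.
move=> h; have /dvdzP[e ->] : (q%:Z %| c)%Z by [].
by rewrite rmorphM; apply: primeI_M => //; exact: Okint.
Qed.

(** The reason why the local rings of the ring of integers are valuation rings.
    If [a] is the leading coefficient, then [a] and [a * x] are integral. When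
    both lie in [m], replacing the leading term [a * x ^ N.+1] by
    [(a * x) * x ^ N] gives an equation of smaller degree that still has a
    coefficient outside [m]. *)
Lemma prufer_relation (p : {poly k}) x : (forall i, O p`_i) -> p.[x] = 0 ->
  (exists i, ~ m p`_i) -> exists s, [/\ O s, O (s * x) & ~ m s \/ ~ m (s * x)].
Proof.
have [N] := ubnP (size p); elim: N p => // N IH p szp Op px [i0 hi0].
case: N IH szp => [|[|N]] IH szp.
- exfalso; apply: hi0; have hi : (size p <= i0)%N by lia.
  by rewrite (nth_default _ hi); exact: primeI_0.
- exfalso; apply: hi0; move: px; rewrite (size1_polyC szp) hornerC coefC => ->.
  by case: eqP => _; exact: primeI_0.
have Oax := Ok_lead_mul Op szp px.
have [ma|nma] := pselect (m p`_N.+1); last by exists p`_N.+1; split=> //; left.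
have [max|nmax] := pselect (m (p`_N.+1 * x)); last by exists p`_N.+1; split=> //; right.
pose p' := \poly_(i < N.+1) p`_i + (p`_N.+1 * x)%:P * 'X^N.
have p'E i : p'`_i = (if (i < N.+1)%N then p`_i else 0) + (if i == N then p`_N.+1 * x else 0).
  by rewrite coefD coef_poly coefCM coefXn mulr_natr mulrb.
apply: (IH p').
- rewrite ltnS; apply/leq_sizeP => j hj; rewrite p'E ifF; last by apply/negbTE; lia.
  by rewrite ifF ?addr0 //; apply/negbTE; lia.
- move=> i; rewrite p'E; apply: OkD; case: ifP => _ //; exact: Ok0.
- rewrite hornerD horner_poly hornerM hornerC hornerXn.
  rewrite -[RHS]px [RHS](horner_coef_wide x szp) [RHS]big_ord_recr /=.
  by rewrite exprS mulrA.
- apply: contrapT => /forallNP h; apply: hi0.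
  have {}h i : m p'`_i by apply: contrapT; exact: h.
  have := h i0; rewrite p'E.
  have [iN|Ni] := ltnP i0 N.+1.
    case: eqP => [_ h'|_]; last by rewrite addr0.
    by rewrite -[p`_i0](addrK (p`_N.+1 * x)); apply: primeI_D => //; exact: primeI_N.
  move=> _; have [->//|ne] := eqVneq i0 N.+1.
  have hi : (size p <= i0)%N by move: szp Ni ne; clear; lia.
  by rewrite (nth_default _ hi); exact: primeI_0.
Qed.

(** Apply [prufer_relation] to an integral equation of [x] with coprime
    coefficients. The conclusion means that [x] or [x^-1] lies in the local ring
    at [m]. *)
Lemma prufer x : exists s, [/\ O s, O (s * x) & ~ m s \/ ~ m (s * x)].
Proof.
have [D D0 [r rmon /rootP rx]] := integral_denominator x.
pose rD : {poly int} := r \Po (D *: 'X).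
have rDx : (map_poly (intr : int -> k) rD).[x] = 0.
  rewrite map_comp_poly horner_comp -[RHS]rx; congr (_.[_]).
  by rewrite linearZ /= map_polyX hornerZ hornerX.
have rD0 : rD != 0.
  by rewrite comp_poly_eq0 ?monic_neq0 // size_scale // size_polyX.
have [q q_pr qE] := primeI_char.
pose p : {poly int} := zprimitive rD.
apply: (@prufer_relation (map_poly intr p)).
- by move=> i; rewrite coef_map; exact: Okint.
- have := rDx; rewrite {1}(zpolyEprim rD) linearZ /= hornerZ => /eqP.
  rewrite mulf_eq0 => /orP[|/eqP//] /eqP h.
  have : (zcontents rD)%:~R != 0 :> k by apply: intr_neq0; rewrite zcontents_eq0.
  by rewrite h eqxx.
- apply: contrapT => /forallNP h.
  have : (q%:Z %| zcontents p)%Z.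
    rewrite dvdz_contents; apply/polyOverP => i.
    have : m (map_poly intr p : {poly k})`_i by apply: contrapT; exact: h.
    by rewrite coef_map => /qE.
  rewrite zcontents_primitive rD0 dvdzE /= dvdn1 => /eqP q1.
  by rewrite q1 in q_pr.
Qed.

End PrimeIdeal.
End IntegralElements.

(** * The local ring of a prime ideal is a discrete valuation ring *)

Section LocalRing.
Variable k : fieldExtType rat.
Variables (m : set k) (mP : isPrimeIdeal m).
Local Notation O := (ringOfIntegers k).
Implicit Types x y : k.

Definition localRing : set k := [set x | exists s, [/\ O s, ~ m s & O (s * x)]].
Definition localMax : set k := [set x | exists s, [/\ O s, ~ m s & m (s * x)]].
Local Notation V := localRing.
Local Notation M := localMax.

Lemma notm_mul x y : O x -> O y -> ~ m x -> ~ m y -> ~ m (x * y).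
Proof. by move=> Ox Oy nx ny /(primeI_prime mP Ox Oy)[]. Qed.

Lemma notm_neq0 x : ~ m x -> x != 0.
Proof. by move=> nx; apply/eqP => x0; apply: nx; rewrite x0; exact: primeI_0. Qed.

Lemma local_sub x : O x -> V x.
Proof. by move=> Ox; exists 1; split; rewrite ?mul1r //; [exact: Ok1|exact: primeI_1]. Qed.

Lemma localMax_sub x : M x -> V x.
Proof. by move=> [s [Os ns msx]]; exists s; split=> //; exact: primeI_sub msx. Qed.

Lemma localM x y : V x -> V y -> V (x * y).
Proof.
move=> [s [Os ns Osx]] [t [Ot nt Oty]]; exists (s * t); split.
- exact: OkM.
- exact: notm_mul.
- by rewrite mulrACA; exact: OkM.
Qed.

Lemma localD x y : V x -> V y -> V (x + y).
Proof.
move=> [s [Os ns Osx]] [t [Ot nt Oty]]; exists (s * t); split.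
- exact: OkM.
- exact: notm_mul.
- have -> : s * t * (x + y) = t * (s * x) + s * (t * y) by ring.
  by apply: OkD; apply: OkM.
Qed.

Lemma localMaxM x y : V x -> M y -> M (x * y).
Proof.
move=> [s [Os ns Osx]] [t [Ot nt mty]]; exists (s * t); split.
- exact: OkM.
- exact: notm_mul.
- by rewrite mulrACA; exact: primeI_M.
Qed.

Lemma localMaxD x y : M x -> M y -> M (x + y).
Proof.
move=> [s [Os ns msx]] [t [Ot nt mty]]; exists (s * t); split.
- exact: OkM.
- exact: notm_mul.
- have -> : s * t * (x + y) = t * (s * x) + s * (t * y) by ring.
  by apply: primeI_D => //; apply: primeI_M.
Qed.

Lemma local1 : V 1. Proof. exact/local_sub/Ok1. Qed.

Lemma localMax0 : M 0.
Proof. by exists 1; split; rewrite ?mulr0; [exact: Ok1|exact: primeI_1|exact: primeI_0]. Qed.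

Lemma localMax_sum (T : Type) (s : seq T) (P : pred T) (F : T -> k) :
  (forall i, P i -> M (F i)) -> M (\sum_(i <- s | P i) F i).
Proof. by move=> h; apply: (big_ind M) => //; [exact: localMax0|exact: localMaxD]. Qed.

Lemma localMaxN x : M x -> M (- x).
Proof. by move=> Mx; rewrite -mulN1r; apply: localMaxM => //; apply/local_sub/OkN/Ok1. Qed.

Lemma localMax1 : ~ M 1.
Proof. by move=> [s [_ ns]]; rewrite mulr1. Qed.

Lemma localMaxO x : O x -> M x -> m x.
Proof. by move=> Ox [s [Os ns msx]]; have [] := primeI_prime mP Os Ox msx. Qed.

Lemma localX x i : V x -> V (x ^+ i).
Proof. by move=> Vx; elim: i => [|i IH]; [exact: local1|rewrite exprS; exact: localM]. Qed.

Lemma localMaxX x i : M x -> (0 < i)%N -> M (x ^+ i).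
Proof.
by case: i => // i Mx _; rewrite exprSr; apply: localMaxM => //; apply/localX/localMax_sub.
Qed.

Lemma localMax_unit x : x != 0 -> M x -> ~ V x^-1.
Proof. by move=> x0 Mx Vx; apply: localMax1; rewrite -(mulVf x0); exact: localMaxM. Qed.

Lemma local_unit x : V x -> ~ M x -> V x^-1.
Proof.
move=> [s [Os ns Osx]] nMx; have nsx : ~ m (s * x) by move=> h; apply: nMx; exists s.
exists (s * x); split=> //; have x0 : x != 0.
  by have := notm_neq0 nsx; rewrite mulf_eq0 negb_or => /andP[].
by rewrite mulfK.
Qed.

Lemma local_total x : ~ V x -> M x^-1.
Proof.
move=> nVx; have [s [Os Osx h]] := prufer mP x.
have ms : m s by apply: contrapT => ns; apply: nVx; exists s.
case: h => // nsx; exists (s * x); split=> //.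
have x0 : x != 0 by have := notm_neq0 nsx; rewrite mulf_eq0 negb_or => /andP[].
by rewrite mulfK.
Qed.

(** The ramification index is at most [dim k]. In an integral relation between
    the [a i] whose coefficients are not all divisible by [q], the last term with
    coefficient prime to [q] has strictly smaller valuation than all the others,
    which is impossible. *)
Lemma value_chain_bound (q : nat) (a : nat -> k) : prime q ->
  (forall c : int, m c%:~R <-> (q %| `|c|)%N) ->
  (forall i, a i != 0) ->
  (forall i j, (i < j <= dim k)%N -> M (a i / a j)) ->
  ~ (forall i j, (i <= dim k)%N -> (j <= dim k)%N -> M (q%:R * a i / a j)).
Proof.
move=> q_pr qE a0 dec bnd.
have [c [rel [i0 _ hi0]]] := int_relation a q_pr.
pose P := [pred i : 'I_(dim k).+1 | ~~ (q %| `|c i|)%N].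
have [i Pi imax] := @arg_maxnP _ i0 P (fun i => val i) hi0.
suff /(localMaxO (Okint _ _))/qE h : M (c i)%:~R by rewrite /P /= h in Pi.
have rel' : (c i)%:~R = - \sum_(j < (dim k).+1 | j != i) (c j)%:~R * (a j / a i).
  apply: (mulIf (a0 i)); rewrite mulNr mulr_suml; apply/eqP; rewrite -addr_eq0 -[X in _ == X]rel.
  rewrite [X in _ == X](bigD1 i) //=; apply/eqP; congr (_ + _).
  by apply: eq_bigr => j _; rewrite mulrA divfK.
rewrite rel'; apply/localMaxN/localMax_sum => j ji.
have [ij|ji'] := ltnP i j; last first.
  apply: localMaxM; first exact/local_sub/Okint.
  apply: dec; rewrite ltn_neqAle ji' -ltnS ltn_ord !andbT.
  by apply: contraNneq ji => /val_inj->.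
have : ~~ P j by apply/negP => /imax h; move: (h : (j <= i)%N); rewrite leqNgt ij.
rewrite /P /= negbK => h; have /dvdzP[e ->] : (q%:Z %| c j)%Z by [].
rewrite intrM -mulrA; apply: localMaxM; first exact/local_sub/Okint.
by rewrite mulrA; apply: bnd; rewrite -ltnS ltn_ord.
Qed.

Lemma localMax_char q : (forall c : int, m c%:~R <-> (q %| `|c|)%N) -> M q%:R.
Proof.
move=> qE; exists 1; rewrite mul1r; split; [exact: Ok1|exact: primeI_1|].
by have /(qE q) : (q %| `|q%:Z|)%N by [].
Qed.

(** Otherwise an infinite chain of decreasing values below that of [q] could be
    chosen, against [value_chain_bound]. *)
Lemma localMax_principal : exists p, [/\ M p, p != 0 & forall x, M x -> V (x / p)].
Proof.
have [q q_pr qE] := primeI_char mP.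
apply: contrapT => /forallNP np.
have /choice[nxt nxtP] : forall p, exists x, M p -> p != 0 -> [/\ M x, x != 0 & M (p / x)].
  move=> p; have [[Mp p0]|h] := pselect (M p /\ p != 0); last first.
    by exists 0 => Mp p0; exfalso; apply: h.
  have /existsNP[x /not_implyP[Mx nV]] : ~ forall x, M x -> V (x / p).
    by move=> h; apply: (np p).
  exists x => _ _; have x0 : x != 0.
    by apply: contra_notN nV => /eqP->; rewrite mul0r; exact/localMax_sub/localMax0.
  by split=> //; have := local_total nV; rewrite invfM invrK mulrC.
pose u i := iter i nxt q%:R.
have q0 : q%:R != 0 :> k by rewrite -[q%:R]/(q%:Z%:~R) intr_neq0 //; have := prime_gt0 q_pr; lia.
have uP i : M (u i) /\ u i != 0.
  elim: i => [|i [Mu u0]]; first by split=> //; exact: localMax_char.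
  by have [] := nxtP _ Mu u0.
have uS i : M (u i / u i.+1) by have [Mu u0] := uP i; have [] := nxtP _ Mu u0.
have u0 i : u i != 0 by have [] := uP i.
have udec i j : (i < j)%N -> M (u i / u j).
  elim: j => // j IH; rewrite ltnS leq_eqVlt => /orP[/eqP->|/IH h]; first exact: uS.
  have -> : u i / u j.+1 = (u i / u j) * (u j / u j.+1) by rewrite mulrA divfK.
  by apply: localMaxM => //; exact: localMax_sub.
apply: (value_chain_bound (a := fun i => u i.+1) q_pr qE).
- by move=> i; exact: u0.
- by move=> i j /andP[ij _]; exact: udec.
- move=> i j _ _; rewrite mulrAC mulrC; apply: localMaxM; last by apply: (udec 0%N).
  by apply/localMax_sub; have [] := uP i.+1.
Qed.

Section Uniformizer.
Variable p : k.
Hypotheses (Mp : M p) (p0 : p != 0) (pgen : forall x, M x -> V (x / p)).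

Lemma expp0 i : p ^+ i != 0. Proof. exact: expf_neq0. Qed.

(** An algebraic integer divides a nonzero integer, which is a power of [q] up
    to a unit, and [q] divides a power of [p] because otherwise the powers of [p]
    would contradict [value_chain_bound]. *)
Lemma uniformizer_archi x : x != 0 -> exists i, V (p ^+ i / x).
Proof.
move=> x0; have [q q_pr qE] := primeI_char mP.
have q0 : q%:R != 0 :> k by rewrite -[q%:R]/(q%:Z%:~R) intr_neq0 //; have := prime_gt0 q_pr; lia.
have [N VN] : exists N, V (p ^+ N / q%:R).
  apply: contrapT => /forallNP nV.
  apply: (value_chain_bound (a := fun i => p ^+ (dim k - i)) q_pr qE) => [i|i j|i j _ _].
  - exact: expp0.
  - move=> /andP[ij jd]; have -> : (dim k - i = (j - i) + (dim k - j))%N by lia.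
    by rewrite exprD mulfK ?expp0 //; apply: localMaxX => //; rewrite subn_gt0.
  - rewrite mulrAC mulrC; apply: localMaxM; first exact/localX/localMax_sub.
    by have := local_total (nV (dim k - j)%N); rewrite invfM invrK mulrC.
have [D D0 Dx] := integral_denominator x.
have D0k := intr_neq0 k D0.
have [y Oy [D' D'0 DxyE]] := Ok_dvd_int Dx (mulf_neq0 D0k x0).
have [i VD'] : exists i, V (p ^+ i / D'%:~R).
  have [s] := ubnP `|D'|%N; elim: s D' D'0 {DxyE} => // s IH D' D'0; rewrite ltnS => hs.
  have [/dvdzP[e D'E]|nq] := boolP (q%:Z %| D')%Z; last first.
    exists 0%N; rewrite mul1r; apply: local_unit; first exact/local_sub/Okint.
    by move=> /(localMaxO (Okint _ _))/qE h; rewrite dvdzE /= h in nq.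
  have e0 : e != 0 by apply: contraNneq D'0 => e0; rewrite D'E e0 mul0r.
  have [|i Vi] := IH e e0.
    by move: hs e0 (prime_gt1 q_pr); rewrite D'E abszM /=; clear; nia.
  exists (i + N)%N; rewrite D'E intrM exprD invfM mulrACA.
  by apply: localM.
exists i; have -> : p ^+ i / x = p ^+ i / D'%:~R * (D%:~R * y).
  have y0 : y != 0.
    by apply/eqP => y0; move: DxyE; rewrite y0 mulr0 => /esym/eqP; apply/negP/intr_neq0.
  rewrite -DxyE; field.
  by rewrite y0 x0 D0k.
apply: localM => //; apply: localM; apply: local_sub => //; exact: Okint.
Qed.

Definition localUnit x := [/\ x != 0, V x & V x^-1].

Lemma localUnit_neq0 x y : localUnit (x / y) -> x != 0.
Proof. by case; rewrite mulf_eq0 negb_or => /andP[]. Qed.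

Lemma unit_exponent x : x != 0 -> exists i : int, localUnit (x / p ^ i).
Proof.
have wlg y : y != 0 -> V y -> exists i : nat, localUnit (y / p ^+ i).
  move=> y0 Vy; pose P := fun i : nat => `[< V (y / p ^+ i) >].
  have [N VN] := uniformizer_archi y0.
  have exP : exists i, P i by exists 0%N; apply/asboolP; rewrite divr1.
  have bP i : P i -> (i <= N)%N.
    move=> /asboolP Vi; rewrite leqNgt; apply/negP => Ni.
    apply: (localMax_unit (expp0 _) (localMaxX Mp (i := i - N) _)); first by rewrite subn_gt0.
    have -> : (p ^+ (i - N))^-1 = (y / p ^+ i) * (p ^+ N / y).
      have -> : p ^+ i = p ^+ (i - N) * p ^+ N by rewrite -exprD subnK // ltnW.
      by field; rewrite !expp0 y0.
    exact: localM.
  case: (ex_maxnP exP bP) => i /asboolP Vi imax; exists i; split=> //.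
    by rewrite mulf_neq0 ?invr_eq0 ?expp0.
  apply: local_unit => // /pgen Vp.
  suff : (i.+1 <= i)%N by rewrite ltnn.
  by apply: imax; apply/asboolP; rewrite exprSr invfM mulrA.
move=> x0; have [Vx|nV] := pselect (V x).
  by have [i hi] := wlg x x0 Vx; exists i%:Z.
have [||i [_ Vi Vi']] := wlg x^-1; first by rewrite invr_eq0.
  exact/localMax_sub/local_total.
exists (- i%:Z); rewrite -invr_expz invrK; split.
- by rewrite mulf_neq0 ?expp0.
- by move: Vi'; rewrite invfM !invrK.
- by move: Vi; rewrite invfM.
Qed.

Lemma localUnitM x y : localUnit x -> localUnit y -> localUnit (x * y).
Proof.
move=> [x0 Vx Vx'] [y0 Vy Vy']; split; rewrite ?mulf_neq0 ?invfM //; exact: localM.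
Qed.

Lemma exponent_le x (i : int) : localUnit (x / p ^ i) -> V x <-> 0 <= i.
Proof.
move=> hu; have x0 := localUnit_neq0 hu.
case: i hu => i hu; split=> // h.
- rewrite -(divfK (expp0 i) x); case: hu => _ hu _; apply: localM => //.
  exact/localX/localMax_sub.
- exfalso; rewrite NegzE -invr_expz invrK in hu.
  apply: (localMax_unit (expp0 _) (localMaxX Mp (i := i.+1) isT)).
  case: hu => _ _ hu; have -> : (p ^+ i.+1)^-1 = x * (x * p ^ i.+1)^-1.
    by rewrite invfM mulVKf.
  exact: localM.
Qed.

Lemma exponent_uniq x (i j : int) : localUnit (x / p ^ i) -> localUnit (x / p ^ j) -> i = j.
Proof.
have wlg y (a b : int) : localUnit (y / p ^ a) -> localUnit (y / p ^ b) -> b <= a.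
  move=> ha hb; rewrite -subr_ge0; apply/(@exponent_le (p ^ (a - b))).
    by split; rewrite divff ?invr1 ?oner_neq0 ?expfz_neq0 //; exact: local1.
  have y0 := localUnit_neq0 ha.
  have -> : p ^ (a - b) = (y / p ^ b) * (y / p ^ a)^-1.
    by rewrite expfzDr // -invr_expz invfM invrK; field; rewrite y0 !expfz_neq0.
  by apply: localM; [case: hb|case: ha].
by move=> hi hj; apply/eqP; rewrite eq_le !(wlg x).
Qed.

Definition localOrd x : \bar int :=
  xget +oo%E [set e | exists2 i, e = i%:E & localUnit (x / p ^ i)].

Lemma localOrdE x i : localUnit (x / p ^ i) -> localOrd x = i%:E.
Proof.
move=> hi; rewrite /localOrd; case: xgetP => [_ _ [j -> hj]|/(_ i%:E)].
  by rewrite (exponent_uniq hi hj).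
by case; exists i.
Qed.

Lemma localOrdP x : x != 0 -> exists2 i, localOrd x = i%:E & localUnit (x / p ^ i).
Proof. by move/unit_exponent => [i hi]; exists i => //; exact: localOrdE. Qed.

Lemma localOrd0 : localOrd 0 = +oo%E.
Proof.
rewrite /localOrd; case: xgetP => // e _ [i _ /localUnit_neq0].
by rewrite eqxx.
Qed.

Lemma localOrd_ge x i : (i%:E <= localOrd x)%E <-> V (x / p ^ i).
Proof.
have [->|x0] := eqVneq x 0.
  rewrite localOrd0 leey mul0r; split=> // _; exact/localMax_sub/localMax0.
have [j -> hj] := localOrdP x0; rewrite lee_fin -subr_ge0.
rewrite -(@exponent_le (x / p ^ i)) // -mulrA -invfM -expfzDr //.
by rewrite [i + _]addrC subrK.
Qed.

Lemma localOrd_pinfty x : localOrd x = +oo%E <-> x = 0.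
Proof.
split=> [|->]; last exact: localOrd0.
by have [//|x0] := eqVneq x 0; have [j ->] := localOrdP x0.
Qed.

Lemma localOrd_ninfty x : localOrd x != -oo%E.
Proof.
have [->|x0] := eqVneq x 0; first by rewrite localOrd0.
by have [j ->] := localOrdP x0.
Qed.

Lemma localOrdM x y : localOrd (x * y) = (localOrd x + localOrd y)%E.
Proof.
have [->|x0] := eqVneq x 0.
  rewrite mul0r localOrd0; have := localOrd_ninfty y.
  by case: (localOrd y).
have [->|y0] := eqVneq y 0.
  rewrite mulr0 localOrd0; have := localOrd_ninfty x.
  by case: (localOrd x).
have [i -> hi] := localOrdP x0; have [j -> hj] := localOrdP y0.
rewrite -EFinD; apply: localOrdE; rewrite expfzDr // invfM mulrACA.
exact: localUnitM.
Qed.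

Lemma localOrd_ultra x y : (mine (localOrd x) (localOrd y) <= localOrd (x + y)%R)%E.
Proof.
have [->|x0] := eqVneq x 0; first by rewrite localOrd0 add0r ge_min lexx orbT.
have [->|y0] := eqVneq y 0; first by rewrite localOrd0 addr0 ge_min lexx.
have [i xi _] := localOrdP x0; have [j yj _] := localOrdP y0.
rewrite xi yj minEle; case: ifPn => [ij|]; last rewrite -ltNge => /ltW ji;
by apply/localOrd_ge; rewrite mulrDl; apply: localD; apply/localOrd_ge; rewrite ?xi ?yj.
Qed.

Lemma localOrd_unif : exists x, localOrd x = 1%:E.
Proof.
exists p; apply: localOrdE; rewrite expr1z divff //.
by split; rewrite ?invr1 ?oner_neq0 //; exact: local1.
Qed.

Definition localPlace : finitePlace k :=
  DiscreteValuation localOrd_pinfty localOrd_ninfty localOrdM localOrd_ultra localOrd_unif.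

End Uniformizer.

(** The exponent of a generator of the maximal ideal is a normalized discrete
    valuation. *)
Theorem prime_place : exists v : finitePlace k, forall x, (0%:E <= v x)%E <-> V x.
Proof.
have [p [Mp p0 pgen]] := localMax_principal.
exists (localPlace Mp p0 pgen) => x.
by rewrite -{2}[x]divr1 -(expr0z p); exact: localOrd_ge.
Qed.

End LocalRing.

(** * Independence of the finite places *)

Section Valuations.
Variable K : fieldType.
Implicit Types (v w : discreteValuation K) (x y : K).

Lemma discreteValuation_ext v w :
  (forall x, v x = w x) -> v = w.
Proof.
case: v w => [v a b c d e] [w a' b' c' d' e'] /= vw.
have vw' : v = w by exact/funext.
by subst w; congr DiscreteValuation; exact: Prop_irrelevance.
Qed.

Lemma ordXz v x (a i : int) :
  v x = a%:E -> v (x ^ i) = (a * i)%:E.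
Proof.
move=> vx; case: i => j; first by rewrite (ordX _ vx) pmulrn mulrzz.
by rewrite NegzE -invr_expz (ordV (ordX j.+1 vx)) pmulrn mulrzz mulrN.
Qed.

Lemma exists_ord v (e : int) :
  exists2 x, x != 0 & v x = e%:E.
Proof.
have [x vx] := ord_uniformizer v; have vxe := ordXz e vx.
exists (x ^ e); last by rewrite vxe mul1r.
by apply/eqP => /(ord_pinfty v); rewrite vxe.
Qed.

Lemma ord_neq0 v x (a : int) : v x = a%:E -> x != 0.
Proof. by move=> vx; apply/eqP => /(ord_pinfty v); rewrite vx. Qed.

(** Units of [v] are units of [w], so [w] is a nonnegative multiple of [v];
    both are normalized. *)
Lemma valuation_dominates v w :
  (forall x, (0%:E <= v x)%E -> (0%:E <= w x)%E) -> v = w.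
Proof.
move=> dom; have [p vp] := ord_uniformizer v; have p0 := ord_neq0 vp.
have [c wp] := ord_fin w p0.
have c0 : 0 <= c by rewrite -lee_fin -wp; apply: dom; rewrite vp.
have wE x (a : int) : v x = a%:E -> w x = (c * a)%:E.
  move=> vx; have x0 := ord_neq0 vx; have [b wx] := ord_fin w x0.
  have vpa := ordXz a vp; have wpa := ordXz a wp; rewrite mul1r in vpa.
  have h1 : (0%:E <= w (x * (p ^ a)^-1)%R)%E.
    by apply: dom; rewrite ordM vx (ordV vpa) -EFinD subrr.
  have h2 : (0%:E <= w (p ^ a * x^-1)%R)%E.
    by apply: dom; rewrite ordM vpa (ordV vx) -EFinD subrr.
  move: h1 h2; rewrite !ordM wx wpa (ordV wpa) (ordV wx) -!EFinD !lee_fin => h1 h2.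
  by congr EFin; lia.
have [u wu] := ord_uniformizer w; have [a vu] := ord_fin v (ord_neq0 wu).
have c1 : c = 1.
  have := wE u a vu; rewrite wu => -[/(congr1 absz)/esym/eqP].
  by rewrite abszM muln_eq1 => /andP[/eqP c1 _]; lia.
apply: discreteValuation_ext => x; have [->|/(ord_fin v)[b vx]] := eqVneq x 0.
  by rewrite !Defs.ord0.
by rewrite vx (wE x b vx) c1 mul1r.
Qed.

Lemma ordD_gt v x y e : (e < v x)%E -> (e < v y)%E -> (e < v (x + y)%R)%E.
Proof. by move=> ex ey; apply: lt_le_trans (ord_ultra v x y); rewrite lt_min ex. Qed.

Lemma ordB_gt v x y e : (e < v x)%E -> (e < v y)%E -> (e < v (x - y)%R)%E.
Proof. by move=> ex ey; apply: ordD_gt => //; rewrite ordN. Qed.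

Lemma minOrdP N v (x : 'rV[K]_N) (e : int) :
  minOrd v x = e%:E <-> (forall i, (e%:E <= v (x 0%R i))%E) /\ exists i, v (x 0 i) = e%:E.
Proof.
split=> [xe|[ge [i xi]]].
  split=> [i|]; first by rewrite -xe /minOrd (bigD1 i) //= ge_min lexx.
  apply: contrapT => /forallNP ni; have : (minOrd v x != e%:E)%E.
    rewrite /minOrd; apply: (big_ind (fun y : \bar int => y != e%:E)) => // [y z|i _].
      by rewrite minEle; case: ifP.
    exact/eqP/ni.
  by rewrite xe eqxx.
apply/eqP; rewrite eq_le -{1}xi {1}/minOrd (bigD1 i) //= ge_min lexx /=.
rewrite /minOrd; apply: (big_ind (fun y : \bar int => e%:E <= y)%E) => // [|y z ey ez].
  exact: leey.
by rewrite le_min ey.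
Qed.

End Valuations.

Section Places.
Variable k : fieldExtType rat.
Local Notation O := (ringOfIntegers k).
Implicit Types (v w : finitePlace k) (x y : k).

Lemma ordMO_gt v x y e : O x -> (e < v y)%E -> (e < v (x * y)%R)%E.
Proof.
move=> /(ord_integral_ge0 v) vx vy; apply: lt_le_trans vy _.
by rewrite ordM -[leLHS]add0e; apply: leeD.
Qed.

Lemma ordMO_ge v x y e : O x -> (e <= v y)%E -> (e <= v (x * y)%R)%E.
Proof.
move=> /(ord_integral_ge0 v) vx vy; apply: le_trans vy _.
by rewrite ordM -[leLHS]add0e; apply: leeD.
Qed.

Lemma ord_prod_gt0 v x y : O x -> O y -> (0%:E < v (x * y)%R)%E ->
  (0%:E < v x)%E \/ (0%:E < v y)%E.
Proof.
move=> /(ord_integral_ge0 v) + /(ord_integral_ge0 v); rewrite ordM !le_eqVlt.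
by move=> /orP[/eqP <-|->]; [rewrite add0e; right|left].
Qed.

Lemma prime_setP v : isPrimeIdeal (prime_set v).
Proof.
split.
- by move=> x [].
- exact: primeD.
- exact: primeZ.
- by move=> [_]; rewrite Defs.ord1 ltxx.
- by move=> x y Ox Oy [_ /(ord_prod_gt0 Ox Oy)] [h|h]; [left|right].
- by have [x x0 px] := prime_neq0 v; exists x.
Qed.

Lemma ord_eq0 v x : O x -> ~ prime_set v x -> v x = 0%:E.
Proof.
move=> Ox np; have := ord_integral_ge0 v Ox; rewrite le_eqVlt => /orP[/eqP <-//|h].
by exfalso; apply: np.
Qed.

(** Otherwise the prime of [w] is contained in that of [v], and since elements
    that are integral at [v] are fractions of algebraic integers with
    denominator outside the prime of [v], the valuation ring of [v] is contained
    in that of [w]. *)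
Lemma places_sep v w : v != w -> exists a, [/\ O a, (0%:E < w a)%E & v a = 0%:E].
Proof.
move=> /eqP vw; apply: contrapT => /forallNP na; apply: vw.
apply: valuation_dominates => x vx.
have [s [Os Osx h]] := prufer (prime_setP v) x.
have vs : v s = 0%:E.
  case: h => /ord_eq0; first exact.
  move=> /(_ Osx); rewrite ordM; have := ord_integral_ge0 v Os; move: vx.
  have [x0|/(ord_fin v)[a ->]] := eqVneq x 0.
    by rewrite x0 Defs.ord0; case: (v s).
  by case: (v s) => [b||] //; rewrite -EFinD !lee_fin => ha hb -[] hab; congr EFin; lia.
have ws : w s = 0%:E.
  by apply: ord_eq0 => // -[_ ws]; apply: (na s).
have -> : x = s * x * s^-1 by rewrite mulrAC divff ?mul1r // (ord_neq0 vs).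
by rewrite ordM (ordV ws) oppr0 adde0; exact: ord_integral_ge0.
Qed.

Lemma place_char v : exists2 q : nat, prime q &
  forall c : int, (0%:E < v c%:~R)%E <-> (q %| `|c|)%N.
Proof.
have [q q_pr qE] := primeI_char (prime_setP v); exists q => // c.
rewrite -qE; split=> [h|[]//]; split=> //; exact: Okint.
Qed.

(** Modulo the prime of [v], strip from an integral equation of [a] the powers of
    [a] that divide it; the remaining constant term is an integer prime to the
    residue characteristic and a multiple of [a]. *)
Lemma prime_maximal v a : O a -> v a = 0%:E ->
  exists2 b, O b & (0%:E < v (a * b - 1)%R)%E.
Proof.
move=> Oa va; have [p pmon /rootP pa] := Oa.
have [q q_pr qE] := place_char v.
have : exists i, ~~ (q %| `|(p`_i)%R|)%N.
  exists (size p).-1; rewrite -lead_coefE (monicP pmon) /= dvdn1.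
  by apply: contraTneq q_pr => ->.
have : (0%:E < v (map_poly (intr : int -> k) p).[a])%E by rewrite pa Defs.ord0.
elim/poly_ind: p {pmon pa} => [|p c IH]; first by move=> _ [i]; rewrite coef0 dvdn0.
rewrite rmorphD rmorphM /= map_polyX map_polyC hornerD hornerMX hornerC.
rewrite -[ssrint_intmul__canonical__Algebra_Additive 1 c]/(c%:~R : k).
set P := (map_poly _ p).[a]; have OP : O P by exact: Ok_horner_int.
move=> hv [i hi].
have [qc|qc] := boolP (q %| `|c|)%N.
  have : (0%:E < v (P * a)%R)%E.
    by rewrite -[P * a](addrK (c%:~R)); apply: ordB_gt => //; apply/qE.
  rewrite ordM va adde0 => /IH; apply.
  exists i.-1; move: hi; rewrite coefD coefMX coefC.
  by case: i => [|i]; rewrite /= ?addr0 ?add0r ?qc.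
have /coprimezP[[u e] /= ue] : coprimez c q%:Z.
  by rewrite coprimezE coprime_sym prime_coprime.
exists (- u%:~R * P); first by apply: OkM => //; apply/OkN/Okint.
have -> : a * (- u%:~R * P) - 1 = - u%:~R * (P * a + c%:~R) - e%:~R * q%:Z%:~R.
  have -> : e%:~R * q%:Z%:~R = 1 - u%:~R * c%:~R :> k.
    have := congr1 (fun z : int => z%:~R : k) ue; rewrite /= intrD !intrM => h.
    by apply: (addIr (u%:~R * c%:~R)); rewrite subrK addrC h.
  ring.
apply: ordB_gt; first by apply: ordMO_gt => //; apply/OkN/Okint.
by apply: ordMO_gt; [exact: Okint|apply/qE].
Qed.

Lemma places_comaximal v w : v != w ->
  exists e, [/\ O e, (0%:E < v (e - 1)%R)%E & (0%:E < w e)%E].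
Proof.
move=> /places_sep[a [Oa wa va]]; have [b Ob hb] := prime_maximal Oa va.
by exists (a * b); split=> //; [exact: OkM|rewrite mulrC; exact: ordMO_gt].
Qed.

Lemma comaximal_seq v (T : seq (finitePlace k)) : v \notin T ->
  exists e, [/\ O e, (0%:E < v (e - 1)%R)%E & forall w, w \in T -> (0%:E < w e)%E].
Proof.
elim: T => [_|w T IH]; first by exists 1; rewrite subrr Defs.ord0; split=> //; exact: Ok1.
rewrite inE negb_or => /andP[/places_comaximal[a [Oa va wa]] /IH[b [Ob vb Tb]]].
exists (a * b); split; first exact: OkM.
  have -> : a * b - 1 = b * (a - 1) + (b - 1) by ring.
  by apply: ordD_gt => //; exact: ordMO_gt.
move=> u; rewrite inE => /orP[/eqP->|/Tb]; last exact: ordMO_gt.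
by rewrite mulrC; exact: ordMO_gt.
Qed.

Lemma ordX_ge v x (N : nat) : (0%:E < v x)%E -> (N%:Z%:E <= v (x ^+ N)%R)%E.
Proof.
have [->|/(ord_fin v)[a va]] := eqVneq x 0.
  by case: N => [|N] _; [rewrite Defs.ord1|rewrite expr0n Defs.ord0 leey].
rewrite va (ordX N va) lte_fin lee_fin pmulrn mulrzz; nia.
Qed.

(** With [a] close to 1 at [v] and to 0 at [T], take [1 - (1 - a ^ N) ^ N]. *)
Lemma almost_idempotent v (T : seq (finitePlace k)) (N : nat) : v \notin T ->
  exists e, [/\ O e, (N%:Z%:E <= v (e - 1)%R)%E &
    forall w, w \in T -> (N%:Z%:E <= w e)%E].
Proof.
move=> /comaximal_seq[a [Oa va Ta]]; case: N => [|N].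
  exists a; split=> // [|w _]; last exact: ord_integral_ge0.
  exact: ltW.
have Oa1 : O (1 - a ^+ N.+1) by apply: OkB; [exact: Ok1|exact: OkX].
exists (1 - (1 - a ^+ N.+1) ^+ N.+1); split.
- by apply: OkB; [exact: Ok1|exact: OkX].
- rewrite addrAC subrr sub0r ordN; apply: ordX_ge.
  rewrite -{1}(expr1n _ N.+1) subrXX mulrC; apply: ordMO_gt.
    by apply: Ok_sum => i _; rewrite expr1n mul1r; exact: OkX.
  by rewrite ordBC.
- move=> w /Ta wa; rewrite -{1}(expr1n _ N.+1) subrXX subKr mulrC.
  apply: ordMO_ge; last exact: ordX_ge.
  by apply: Ok_sum => i _; rewrite expr1n mul1r; exact: OkX.
Qed.

Lemma chinese_remainder (T : seq (finitePlace k)) (t : finitePlace k -> k) (N : nat) :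
  uniq T -> (forall v, v \in T -> O (t v)) ->
  exists2 y, O y & forall v, v \in T -> (N%:Z%:E <= v (y - t v)%R)%E.
Proof.
move=> uT Ot.
have /choice[e eP] : forall v, exists e, [/\ O e, (N%:Z%:E <= v (e - 1)%R)%E &
    forall w, w \in T -> w != v -> (N%:Z%:E <= w e)%E].
  move=> v; have [|e [Oe ve Te]] := @almost_idempotent v [seq w <- T | w != v] N.
    by rewrite mem_filter eqxx.
  by exists e; split=> // w wT wv; apply: Te; rewrite mem_filter wv.
exists (\sum_(v <- T) e v * t v).
  by rewrite big_seq; apply: Ok_sum => v vT; apply: OkM; [have [] := eP v|exact: Ot].
move=> v vT; rewrite (bigD1_seq v) //= addrAC.
have -> : e v * t v - t v = t v * (e v - 1) by ring.
apply: ordD_ge; first by apply: ordMO_ge; [exact: Ot|have [] := eP v].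
rewrite big_seq_cond; apply: ord_sum_ge => w /andP[wT wv].
rewrite mulrC; apply: ordMO_ge; first exact: Ot.
by have [_ _] := eP w; apply => //; rewrite eq_sym.
Qed.

(** Elements that are approximately idempotent at the places of [T] are linearly
    independent over the rationals: in an integral relation, a coefficient prime
    to [q] would have to vanish modulo the corresponding place. *)
Lemma places_above_bound (q : nat) (T : seq (finitePlace k)) : prime q -> uniq T ->
  (forall v, v \in T -> (0%:E < v q%:R)%E) -> (size T <= dim k)%N.
Proof.
move=> q_pr uT Tq; rewrite leqNgt; apply/negP => szT.
have [v0 _] : exists v0, v0 \in T by case: (T) szT => // v0 ? _; exists v0; rewrite mem_head.
have /choice[e eP] : forall v, exists e, [/\ O e, (1%:E <= v (e - 1)%R)%E &
    forall w, w \in T -> w != v -> (1%:E <= w e)%E].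
  move=> v; have [|e [Oe ve Te]] := @almost_idempotent v [seq w <- T | w != v] 1%N.
    by rewrite mem_filter eqxx.
  by exists e; split=> // w wT wv; apply: Te; rewrite mem_filter wv.
have [c [rel [i _ hi]]] := int_relation (fun i => e (nth v0 T i)) q_pr.
pose v := nth v0 T i.
have iT : (i < size T)%N by apply: leq_trans (ltn_ord i) szT.
have vT : v \in T by apply: mem_nth.
have : (0%:E < v (c i)%:~R)%E.
  have -> : (c i)%:~R = - (c i)%:~R * (e v - 1) -
     \sum_(j < (dim k).+1 | j != i) (c j)%:~R * e (nth v0 T j).
    by move: rel; rewrite (bigD1 i) //= => /eqP; rewrite addr_eq0 => /eqP h; 
       rewrite -[X in _ - X]opprK -h -/v; ring.
  have lt01 : (0%:E < 1%:E :> \bar int)%E by rewrite lte_fin.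
  apply: (lt_le_trans lt01); apply: ordB_ge.
    by apply: ordMO_ge; [apply/OkN/Okint|have [] := eP v].
  apply: ord_sum_ge => j ji; apply: ordMO_ge; first exact: Okint.
  have [_ _] := eP (nth v0 T j); apply=> //.
  by rewrite nth_uniq // ?(leq_trans (ltn_ord j) szT) // eq_sym.
have [q' q'_pr q'E] := place_char v; move=> /q'E h.
have : (q' %| q)%N by apply/(q'E q%:Z)/Tq.
by rewrite dvdn_prime2 // => /eqP qq; move: hi; rewrite -qq h.
Qed.

(** By induction over the prime factors of [D]. *)
Lemma places_above_finite (D : int) : D != 0 ->
  exists S : seq (finitePlace k), forall v, (0%:E < v D%:~R)%E -> v \in S.
Proof.
move=> D0.
have [s] := ubnP `|D|%N; elim: s D D0 => // s IH D D0; rewrite ltnS => hs.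
have [D1|D1] := leqP `|D| 1.
  exists [::] => v; have [q q_pr qE] := place_char v => /qE.
  have -> : `|D|%N = 1%N by lia.
  by rewrite dvdn1 => /eqP q1; rewrite q1 in q_pr.
pose q := pdiv `|D|; have q_pr : prime q by exact: pdiv_prime.
have /dvdzP[D' D'E] : (q%:Z %| D)%Z by rewrite dvdzE; exact: pdiv_dvd.
have D'0 : D' != 0 by apply: contraNneq D0 => h; rewrite D'E h mul0r.
have [|S hS] := IH D' D'0.
  by move: hs D'0 (prime_gt1 q_pr); rewrite D'E abszM /=; clear; nia.
suff [S' hS'] : exists S' : seq (finitePlace k), forall v, (0%:E < v q%:R)%E -> v \in S'.
  exists (S ++ S') => v; rewrite D'E intrM mem_cat.
  move=> /(ord_prod_gt0 (Okint _ _) (Okint _ _))[/hS->//|/hS'->]; by rewrite orbT.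
apply: contrapT => nS'.
have [T [uT Tq szT]] : exists T : seq (finitePlace k), [/\ uniq T,
    forall v, v \in T -> (0%:E < v q%:R)%E & size T = (dim k).+1].
  elim: (dim k).+1 => [|r [T [uT Tq szT]]]; first by exists [::].
  have /existsNP[v /not_implyP[vq /negP vT]] : ~ forall v, (0%:E < v q%:R)%E -> v \in T.
    by move=> h; apply: nS'; exists T.
  exists (v :: T); split; rewrite /= ?vT ?szT // => w; rewrite inE => /orP[/eqP->//|].
  exact: Tq.
by have := places_above_bound q_pr uT Tq; rewrite szT ltnn.
Qed.

Lemma ord_support_finite x : x != 0 ->
  exists S : seq (finitePlace k), forall v, v \notin S -> v x = 0%:E.
Proof.
move=> x0; have [D D0 ODx] := integral_denominator x.
have Dx0 : D%:~R * x != 0 by rewrite mulf_neq0 // intr_neq0.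
have [y Oy [D' D'0 xy]] := Ok_dvd_int ODx Dx0.
have [S hS] := places_above_finite D0; have [S' hS'] := places_above_finite D'0.
exists (S ++ S') => v; rewrite mem_cat negb_or => /andP[vS vS'].
have zero E : (0%:E < v E%:~R)%E = false -> v E%:~R = 0%:E.
  by have := ord_int_ge0 v E; rewrite le_eqVlt => /orP[/eqP//|->].
have vD : v D%:~R = 0%:E by apply: zero; apply/negP => /hS; apply/negP.
have vD' : v D'%:~R = 0%:E by apply: zero; apply/negP => /hS'; apply/negP.
have := ord_integral_ge0 v ODx; have := ord_integral_ge0 v Oy.
move: vD'; rewrite -xy !ordM vD add0e.
have [a ->] := ord_fin v x0; case: (v y) => [b||] //.
by rewrite -EFinD !lee_fin => -[] h hb ha; congr EFin; lia.
Qed.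

(** Clear the denominators of the targets by an integer [D], and apply the
    Chinese remainder theorem with the places above [D] included. *)
Lemma strong_approximation (T : seq (finitePlace k)) (t : finitePlace k -> k) (N : nat) :
  exists y, [/\ y != 0, forall v, v \in T -> (N%:Z%:E <= v (y - t v)%R)%E &
    forall v, v \notin T -> (0%:E <= v y)%E].
Proof.
have [y hy hy'] : exists2 y, forall v, v \in T -> (N%:Z%:E <= v (y - t v)%R)%E &
    forall v, v \notin T -> (0%:E <= v y)%E.
  have [D D0 OD] : exists2 D : int, D != 0 & forall v, v \in T -> O (D%:~R * t v).
    elim: T => [|w T [D D0 OD]]; first by exists 1.
    have [E E0 OE] := integral_denominator (t w); exists (D * E); first by rewrite mulf_neq0.
    move=> v; rewrite inE => /orP[/eqP->|/OD h].
      by rewrite intrM -mulrA; apply: OkM => //; exact: Okint.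
    by rewrite intrM mulrAC mulrC; apply: OkM => //; exact: Okint.
  have D0k := intr_neq0 k D0.
  have [S hS] := places_above_finite D0.
  have [M hM] : exists M : nat, forall v, v \in T ++ S -> (v D%:~R <= M%:Z%:E)%E.
    elim: (T ++ S) => [|w U [M hM]]; first by exists 0%N.
    have [a wa] := ord_fin w D0k; exists (maxn M `|a|) => v.
    rewrite inE => /orP[/eqP->|/hM h]; first by rewrite wa lee_fin; lia.
    by apply: le_trans h _; rewrite lee_fin; lia.
  have [|y Oy hy] := @chinese_remainder (undup (T ++ S))
    (fun v => if v \in T then D%:~R * t v else 0) (N + M)%N (undup_uniq _).
    by move=> v _; case: ifP => [/OD//|_]; exact: Ok0.
  have divD v z (e : int) : v \in T ++ S -> ((e + M%:Z)%:E <= v z)%E -> (e%:E <= v (z / D%:~R)%R)%E.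
    move=> /hM; have [a va] := ord_fin v D0k.
    rewrite va ordM (ordV va) lee_fin; case: (v z) => [b||] //; last by move=> *; rewrite leey.
    by rewrite -EFinD !lee_fin; lia.
  exists (y / D%:~R) => [v vT|v vT].
    have vTS : v \in T ++ S by rewrite mem_cat vT.
    have -> : y / D%:~R - t v = (y - D%:~R * t v) / D%:~R by field.
    by apply: divD => //; have := hy v; rewrite mem_undup vT; apply.
  have [vTS|vTS] := boolP (v \in T ++ S).
    apply: divD => //; have := hy v; rewrite mem_undup vTS (negPf vT) subr0 => /(_ isT).
    by apply: le_trans; rewrite lee_fin; lia.
  have vD : v D%:~R = 0%:E.
    have := ord_int_ge0 v D; rewrite le_eqVlt => /orP[/eqP//|/hS vS].
    by move: vTS; rewrite mem_cat vS orbT.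
  by rewrite ordM (ordV vD) oppr0 adde0; exact: ord_integral_ge0.
(* If 0 is a solution, so is a high power of an integer divisible by all of [T]. *)
have [y0|y0] := eqVneq y 0; last by exists y; split.
have [z [z0 hz]] : exists z : int, z != 0 /\ forall v, v \in T -> (0%:E < v z%:~R)%E.
  elim: (T) => [|w U [z [z0 hz]]]; first by exists 1.
  have [q q_pr qE] := place_char w.
  exists (q%:Z * z); split; first by rewrite mulf_neq0 //; have := prime_gt0 q_pr; lia.
  move=> v; rewrite inE intrM => /orP[/eqP->|/hz h].
    by rewrite mulrC; apply: ordMO_gt; [exact: Okint|apply/qE].
  by apply: ordMO_gt => //; exact: Okint.
exists (z%:~R ^+ N); split.
- by rewrite expf_neq0 // intr_neq0.
- move=> v vT; apply: ordB_ge; first exact/ordX_ge/hz.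
  by rewrite -[t v]opprK ordN -[- t v]sub0r -y0; exact: hy.
- by move=> v _; apply: ord_integral_ge0; apply/OkX/Okint.
Qed.

Lemma prescribed_ords (T : seq (finitePlace k)) (e : finitePlace k -> int) :
  exists y, [/\ y != 0, forall v, v \in T -> v y = (e v)%:E &
    forall v, v \notin T -> (0%:E <= v y)%E].
Proof.
have /choice[t tE] : forall v, exists x, v x = (e v)%:E.
  by move=> v; have [x _ vx] := exists_ord v (e v); exists x.
have [M hM] : exists M : nat, forall v, v \in T -> e v < M%:Z.
  elim: (T) => [|w U [M hM]]; first by exists 0%N.
  exists (maxn M `|e w|.+1) => v; rewrite inE => /orP[/eqP->|/hM]; lia.
have [y [y0 hy hy']] := strong_approximation T t M.
exists y; split=> // v vT; rewrite -tE; apply: ord_lt; rewrite tE.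
by apply: lt_le_trans (hy v vT); rewrite lte_fin hM.
Qed.

End Places.

(** * Fractional ideals are determined by their orders *)

Section Ideals.
Variable k : fieldExtType rat.
Local Notation O := (ringOfIntegers k).
Implicit Types (v w : finitePlace k) (x y : k) (I J : fracIdeal k).

(** Krull's theorem; the usual argument shows that a maximal ideal is prime. *)
Lemma prime_above (A : set k) : (forall x, A x -> O x) ->
    (forall x y, A x -> A y -> A (x + y)) -> (forall x y, O x -> A y -> A (x * y)) ->
    ~ A 1 -> (exists2 x, A x & x != 0) ->
  exists2 m, isPrimeIdeal m & A `<=` m.
Proof.
move=> A_O A_D A_M A_1 A_neq0.
pose P (B : set k) := [/\ forall x, B x -> O x, forall x y, B x -> B y -> B (x + y),
  forall x y, O x -> B y -> B (x * y) & ~ B 1].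
have [//|F FP [X0 FX0] Ftot|m [Am [m_O m_D m_M m_1] m_max]] := @Zorn_above _ P A.
  split.
  - by move=> x [X FX]; have [+ _ _ _] := FP _ FX; apply.
  - move=> x y [X FX Xx] [Y FY Yy]; have [XY|YX] := Ftot _ _ FX FY.
      by exists Y => //; have [_ + _ _] := FP _ FY; apply=> //; exact: XY.
    by exists X => //; have [_ + _ _] := FP _ FX; apply=> //; exact: YX.
  - by move=> x y Ox [X FX Xy]; exists X => //; have [_ _ + _] := FP _ FX; apply.
  - by move=> [X FX]; have [_ _ _] := FP _ FX.
exists m => //.
have [z Az z0] := A_neq0.
have m_0 : m 0 by rewrite -(mul0r z); apply: m_M; [exact: Ok0|exact: Am].
split=> //; last by exists z => //; exact: Am.
have comax x : O x -> ~ m x -> exists2 c, O c & m (1 - c * x).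
  move=> Ox nx; apply: contrapT => nc; apply: nx.
  pose B : set k := [set y | exists2 c, O c & m (y - c * x) /\ O y].
  apply: (m_max B).
  - move=> y my; exists 0; first exact: Ok0.
    by rewrite mul0r subr0; split=> //; exact: m_O.
  - split.
    + by move=> y [c _ []].
    + move=> y y' [c Oc [my Oy]] [c' Oc' [my' Oy']]; exists (c + c'); first exact: OkD.
      split; last exact: OkD.
      have -> : y + y' - (c + c') * x = (y - c * x) + (y' - c' * x) by ring.
      exact: m_D.
    + move=> a y Oa [c Oc [my Oy]]; exists (a * c); first exact: OkM.
      split; last exact: OkM.
      have -> : a * y - a * c * x = a * (y - c * x) by ring.
      exact: m_M.
    + by move=> [c Oc [mc _]]; apply: nc; exists c.
  - by exists 1; [exact: Ok1|rewrite mul1r subrr; split].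
move=> x y Ox Oy mxy; apply: contrapT => /not_orP[/comax[//|c Oc mc] /comax[//|e Oe me]].
apply: m_1; have -> : 1 = (1 - c * x) * 1 + (c * x) * (1 - e * y) + (c * e) * (x * y) by ring.
apply: (m_D); last by apply: (m_M) => //; exact: OkM.
apply: (m_D); last by apply: (m_M) => //; exact: OkM.
by rewrite mulr1.
Qed.

Definition isIdealOrd v I (e : int) :=
  (forall x, I x -> (e%:E <= v x)%E) /\ exists2 x, I x & v x = e%:E.

Lemma isIdealOrd_uniq v I e e' : isIdealOrd v I e -> isIdealOrd v I e' -> e = e'.
Proof.
move=> [h [x Ix vx]] [h' [x' Ix' vx']]; apply/eqP; rewrite eq_le.
have := h _ Ix'; have := h' _ Ix; rewrite vx vx' !lee_fin => -> ->.
by [].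
Qed.

Lemma isIdealOrd_exists v I : exists e, isIdealOrd v I e.
Proof.
have [c [c0 Oc cI]] := fideal_denom I; have [x x0 Ix] := fideal_neq0 I.
have [a va] := ord_fin v c0.
pose P (j : nat) := `[< exists2 y, I y & v y = (j%:Z - a)%:E >].
have exP : exists j, P j.
  have := ord_integral_ge0 v (cI _ Ix); have [b vb] := ord_fin v x0.
  rewrite ordM va vb -EFinD lee_fin => ab; exists `|(a + b)%R|%N; apply/asboolP.
  by exists x => //; rewrite vb; congr EFin; lia.
case: (ex_minnP exP) => j /asboolP[y Iy vy] jmin; exists (j%:Z - a); split; last by exists y.
move=> z Iz; have [->|z0] := eqVneq z 0; first by rewrite Defs.ord0 leey.
have := ord_integral_ge0 v (cI _ Iz); have [b vb] := ord_fin v z0.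
rewrite ordM va vb -EFinD !lee_fin => ab.
suff : (j <= `|(a + b)%R|)%N by lia.
by apply: jmin; apply/asboolP; exists z => //; rewrite vb; congr EFin; lia.
Qed.

(** If [x] is not in [I], the conductor of [x] into [I] lies in a prime ideal,
    and at the place of that prime [x] is a multiple of an element of [I] of
    least order; a denominator of the quotient lies in the conductor. *)
Theorem ideal_local I x :
  (forall v e, isIdealOrd v I e -> (e%:E <= v x)%E) -> I x.
Proof.
move=> hx; apply: contrapT => nIx.
have x0 : x != 0 by apply: contra_notN nIx => /eqP->; exact: fideal0.
pose A := [set a | O a /\ I (a * x)].
have [|||||m mP Am] := @prime_above A.
- by move=> a [].
- by move=> a b [Oa ha] [Ob hb]; split; [exact: OkD|rewrite mulrDl; exact: fidealD].
- by move=> a b Oa [Ob hb]; split; [exact: OkM|rewrite -mulrA; exact: fidealZ].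
- by rewrite /A /= mul1r => -[].
- have [z z0 Iz] := fideal_neq0 I.
  have [D D0 OD] := integral_denominator (z / x).
  exists (D%:~R * (z / x)); last by rewrite !mulf_neq0 ?invr_eq0 ?intr_neq0.
  by split=> //; rewrite -mulrA divfK //; apply: fidealZ => //; exact: Okint.
have [v vV] := prime_place mP.
have [e ve] := isIdealOrd_exists v I; have [_ [y Iy vy]] := ve.
have y0 := ord_neq0 vy.
have [s [Os ns Osxy]] : localRing m (x / y).
  apply/vV; rewrite ordM (ordV vy); have := hx _ _ ve.
  have [a ->] := ord_fin v x0; rewrite -EFinD !lee_fin; lia.
apply: ns; apply: Am; split=> //.
have -> : s * x = s * (x / y) * y by rewrite -mulrA divfK.
exact: fidealZ.
Qed.

Lemma isIdealOrd1 v : isIdealOrd v (fideal1 k) 0.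
Proof.
split=> [x|]; first exact: ord_integral_ge0.
by exists 1; [exact: Ok1|exact: Defs.ord1].
Qed.

Lemma Ok_local x : (forall v, (0%:E <= v x)%E) -> O x.
Proof.
move=> hx; apply: (@ideal_local (fideal1 k)) => v e /isIdealOrd_uniq -/(_ _ (isIdealOrd1 v)) ->.
exact: hx.
Qed.

Lemma ideal_ext I J : (forall v, exists2 e, isIdealOrd v I e & isIdealOrd v J e) -> I = J.
Proof.
have sub A B : (forall v, exists2 e, isIdealOrd v A e & isIdealOrd v B e) ->
    fideal A `<=` fideal B.
  move=> h x Ax; apply: ideal_local => v e he; have [e' [hA _] hB] := h v.
  by rewrite (isIdealOrd_uniq he hB); exact: hA.
move=> h; apply: fracIdealP; apply/seteqP; split; apply: sub => // v.
by have [e] := h v; exists e.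
Qed.

Lemma isIdealOrdM v I J e e' : isIdealOrd v I e -> isIdealOrd v J e' ->
  isIdealOrd v (fidealM I J) (e + e').
Proof.
move=> [hI [x Ix vx]] [hJ [y Jy vy]]; split; last first.
  by exists (x * y); [exact: product_mul|rewrite ordM vx vy].
move=> _ [s [hs ->]]; rewrite big_seq; apply: ord_sum_ge => p /hs[Ip Jp].
by rewrite ordM EFinD; apply: leeD; [exact: hI|exact: hJ].
Qed.

Lemma isIdealOrd_finite I :
  exists S : seq (finitePlace k), forall v, v \notin S -> isIdealOrd v I 0.
Proof.
have [c [c0 Oc cI]] := fideal_denom I; have [x x0 Ix] := fideal_neq0 I.
have [S hS] := ord_support_finite c0; have [S' hS'] := ord_support_finite x0.
exists (S ++ S') => v; rewrite mem_cat negb_or => /andP[vS vS'].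
split; last by exists x => //; exact: hS'.
by move=> z Iz; have := ord_integral_ge0 v (cI _ Iz); rewrite ordM hS // add0e.
Qed.

(** An element of the inverse of least order at [v] is found by prescribing its
    order at [v] and at the finitely many places where [I] is not trivial. *)
Lemma isIdealOrdV v I e : isIdealOrd v I e -> isIdealOrd v (fidealV I) (- e).
Proof.
move=> ve; split=> [y hy|].
  have [_ [x Ix vx]] := ve; have := ord_integral_ge0 v (hy _ Ix).
  rewrite ordM vx; case: (v y) => [b||] //; last by move=> *; exact: leey.
  by rewrite -EFinD !lee_fin; lia.
have /choice[E EP] : forall w, exists e, isIdealOrd w I e.
  by move=> w; exact: isIdealOrd_exists.
have [S hS] := isIdealOrd_finite I.
have [y [y0 hy hy']] := prescribed_ords (v :: S) (fun w => - E w).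
exists y; last by rewrite hy ?mem_head // (isIdealOrd_uniq ve (EP v)).
move=> z Iz; apply: Ok_local => w; have [Ew _] := EP w; rewrite ordM.
have [wT|wT] := boolP (w \in v :: S).
  rewrite hy //; have := Ew _ Iz; case: (w z) => [b||] //.
  by rewrite -EFinD !lee_fin; lia.
have [/(_ z Iz) wz _] : isIdealOrd w I 0.
  by apply: hS; move: wT; rewrite inE negb_or => /andP[].
by rewrite -[leLHS]adde0; apply: leeD => //; exact: hy'.
Qed.

Lemma isIdealOrd_prime v w : isIdealOrd v (primeIdeal w) (v == w)%:Z.
Proof.
have [<-|vw] := eqVneq v w.
  split=> [x [Ox vx]|].
    by have := vx; case: (v x) => [b||] //.
  have [x [x0 hx hx']] := prescribed_ords [:: v] (fun=> 1).
  exists x; last by rewrite hx ?mem_head.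
  split; last by rewrite hx ?mem_head // lte_fin.
  apply: Ok_local => u; have [uv|uv] := boolP (u \in [:: v]); last exact: hx'.
  by rewrite hx // lee_fin.
split=> [x [Ox _]|]; first exact: ord_integral_ge0.
by have [a [Oa wa va]] := places_sep vw; exists a.
Qed.

Lemma isIdealOrd_generated v N (x : 'rV[k]_N) (x0 : x != 0) e :
  minOrd v x = e%:E -> isIdealOrd v (generated x0) e.
Proof.
move=> /minOrdP[ge [i hi]]; split=> [_ [a [Oa ->]]|].
  by apply: ord_sum_ge => j _; apply: ordMO_ge; [exact: Oa|exact: ge].
exists (x 0 i) => //; exists (delta_mx 0 i); split=> [j|].
  by rewrite mxE; case: (_ && _); [exact: Ok1|exact: Ok0].
rewrite (bigD1 i) //= big1 ?addr0 ?mxE ?eqxx ?mul1r // => j ji.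
by rewrite mxE (negPf ji) andbF mul0r.
Qed.

(** As the orders of an ideal determine it, this relation reduces computations
    with ideal classes to additive computations with the functions [e]. *)
Definition classHasOrd (c : classGroup k) (e : finitePlace k -> int) :=
  exists2 I, c = idealClass I & forall v, isIdealOrd v I (e v).

Lemma classHasOrd_uniq c c' e : classHasOrd c e -> classHasOrd c' e -> c = c'.
Proof.
move=> [I -> hI] [J -> hJ]; congr idealClass; apply: ideal_ext => v.
by exists (e v).
Qed.

Lemma classHasOrd_exists c : exists2 e, classHasOrd c e &
  exists S : seq (finitePlace k), forall v, v \notin S -> e v = 0.
Proof.
have [I ->] := idealClass_surj c.
have /choice[e eP] : forall v, exists e, isIdealOrd v I e.
  by move=> v; exact: isIdealOrd_exists.
have [S hS] := isIdealOrd_finite I.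
by exists e; [exists I|exists S => v /hS/(isIdealOrd_uniq (eP v))].
Qed.

Lemma classHasOrd1 : classHasOrd 1%g (fun=> 0).
Proof. by exists (fideal1 k) => // v; exact: isIdealOrd1. Qed.

Lemma classHasOrdM c c' e e' : classHasOrd c e -> classHasOrd c' e' ->
  classHasOrd (c * c')%g (fun v => e v + e' v).
Proof.
move=> [I -> hI] [J -> hJ]; exists (fidealM I J) => [|v]; first exact: cl_mulE.
exact: isIdealOrdM.
Qed.

Lemma classHasOrdV c e : classHasOrd c e -> classHasOrd (c^-1)%g (fun v => - e v).
Proof.
move=> [I -> hI]; exists (fidealV I) => [|v]; first exact: cl_invE.
exact: isIdealOrdV.
Qed.

Lemma classHasOrd_ext c e e' : e =1 e' -> classHasOrd c e -> classHasOrd c e'.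
Proof. by move=> ee [I -> hI]; exists I => // v; rewrite -ee. Qed.

Lemma classHasOrdX c e j : classHasOrd c e -> classHasOrd (c ^+ j)%g (fun v => j%:Z * e v).
Proof.
move=> ce; elim: j => [|j IH].
  by apply: classHasOrd_ext classHasOrd1 => v; rewrite mul0r.
rewrite expgS; apply: classHasOrd_ext (classHasOrdM ce IH) => v /=; lia.
Qed.

Lemma classHasOrd_expz c e (a : int) : classHasOrd c e ->
  classHasOrd (cl_expz c a) (fun v => a * e v).
Proof.
move=> ce; case: a => j /=; first exact: classHasOrdX.
apply: classHasOrd_ext (classHasOrdV (classHasOrdX j.+1 ce)) => v /=; rewrite NegzE; lia.
Qed.

Lemma classHasOrd_prod (S : seq (finitePlace k)) (a : finitePlace k -> int) :
  uniq S -> (forall v, v \notin S -> a v = 0) ->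
  classHasOrd (\big[*%g/1%g]_(v <- S) cl_expz (idealClass (primeIdeal v)) (a v))%g a.
Proof.
move=> uS aS; apply: (@classHasOrd_ext _ (fun w => \sum_(v <- S) a v * (w == v)%:Z)).
  move=> w; have [wS|wS] := boolP (w \in S).
    rewrite (bigD1_seq w) //= eqxx mulr1 big1 ?addr0 // => v.
    by rewrite eq_sym => /negPf->; rewrite mulr0.
  rewrite aS // big_seq big1 // => v vS.
  by have [wv|_] := eqVneq w v; [rewrite wv vS in wS|rewrite mulr0].
elim: S {uS aS} => [|v S IH].
  by rewrite big_nil; apply: classHasOrd_ext classHasOrd1 => w; rewrite big_nil.
rewrite big_cons; apply: classHasOrd_ext (classHasOrdM (classHasOrd_expz (a v) _) IH).
  by move=> w /=; rewrite big_cons.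
by exists (primeIdeal v) => // w; exact: isIdealOrd_prime.
Qed.

End Ideals.

(** * Estimates over a discretely valued field *)

Lemma finite_bound (I : finType) (P : I -> nat -> Prop) :
  (forall i a b, (a <= b)%N -> P i a -> P i b) -> (forall i, exists a, P i a) ->
  exists a, forall i, P i a.
Proof.
move=> mono /choice[a aP]; exists (\max_i a i)%N => i.
by apply: mono (aP i); exact: leq_bigmax.
Qed.

Lemma seq_bound (T : eqType) (s : seq T) (P : T -> nat -> Prop) :
  (forall i a b, (a <= b)%N -> P i a -> P i b) -> (forall i, exists a, P i a) ->
  exists a, forall i, i \in s -> P i a.
Proof.
move=> mono ex; elim: s => [|x s [a aP]]; first by exists 0%N.
have [b xb] := ex x; exists (maxn a b) => i; rewrite inE => /orP[/eqP->|/aP h].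
  by apply: mono xb; exact: leq_maxr.
by apply: mono h; exact: leq_maxl.
Qed.

Section Estimates.
Variables (K : fieldType) (w : discreteValuation K).

Lemma valuation_sum_ge (T : Type) (s : seq T) (P : pred T) (F : T -> K) e :
  (forall i, P i -> (e <= w (F i))%E) -> (e <= w (\sum_(i <- s | P i) F i)%R)%E.
Proof.
move=> h; apply: (big_ind (fun y => e <= w y)%E) => //; first by rewrite Defs.ord0 leey.
by move=> x y; exact: ordD_ge.
Qed.

Lemma ord_lower x : exists C : nat, ((- C%:Z)%:E <= w x)%E.
Proof.
have [->|/(ord_fin w)[a ->]] := eqVneq x 0; first by exists 0%N; rewrite Defs.ord0 leey.
by exists `|a|%N; rewrite lee_fin; lia.
Qed.

Lemma ord_lower_mono x (a b : nat) : (a <= b)%N ->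
  ((- a%:Z)%:E <= w x)%E -> ((- b%:Z)%:E <= w x)%E.
Proof. by move=> ab; apply: le_trans; rewrite lee_fin; lia. Qed.

Definition coefs_ge n (p : {mpoly K[n]}) (C : nat) :=
  forall mu, ((- C%:Z)%:E <= w p@_mu)%E.

Lemma coefs_ge_exists n (p : {mpoly K[n]}) : exists C, coefs_ge p C.
Proof.
have [C hC] := @seq_bound _ (msupp p) (fun mu (C : nat) => ((- C%:Z)%:E <= w p@_mu)%E)
  (fun mu => @ord_lower_mono _) (fun mu => ord_lower _).
exists C => mu; have [/hC//|h] := boolP (mu \in msupp p).
by rewrite memN_msupp_eq0 // Defs.ord0 leey.
Qed.

Lemma coefs_ge_mono n (p : {mpoly K[n]}) (a b : nat) : (a <= b)%N ->
  coefs_ge p a -> coefs_ge p b.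
Proof. by move=> ab h mu; exact: ord_lower_mono (h mu). Qed.

Lemma meval_ge n (p : {mpoly K[n]}) C (x : 'I_n -> K) : coefs_ge p C ->
  (forall i, (0%:E <= w (x i))%E) -> ((- C%:Z)%:E <= w p.@[x])%E.
Proof.
move=> pC x0; rewrite mevalE; apply: valuation_sum_ge => mu _.
rewrite ordM -[leLHS]adde0; apply: leeD; first exact: pC.
apply: (big_ind (fun y => 0%:E <= w y)%E) => [|a b ha hb|i _]; first by rewrite Defs.ord1.
  by rewrite ordM -[leLHS]adde0; exact: leeD.
elim: (mu i) => [|l IH]; first by rewrite Defs.ord1.
by rewrite exprS ordM -[leLHS]adde0; exact: leeD.
Qed.

(** Continuity at [x] for the topology of [w]; the precision [N] is a natural
    number, so that a finite number of them has a maximum. *)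
Definition ord_continuous n (x : 'I_n -> K) (g : ('I_n -> K) -> K) :=
  forall M : int, exists N : nat, forall y,
    (forall i, (N%:Z%:E <= w (y i - x i)%R)%E) -> (M%:E <= w (g y - g x)%R)%E.

Lemma ord_continuousD n (x : 'I_n -> K) g h :
  ord_continuous x g -> ord_continuous x h -> ord_continuous x (fun y => g y + h y).
Proof.
move=> cg ch M; have [N gN] := cg M; have [N' hN'] := ch M.
exists (maxn N N') => y yx; rewrite opprD addrACA; apply: ordD_ge.
  by apply: gN => i; apply: le_trans (yx i); rewrite lee_fin; lia.
by apply: hN' => i; apply: le_trans (yx i); rewrite lee_fin; lia.
Qed.

Lemma ord_continuousM n (x : 'I_n -> K) g h :
  ord_continuous x g -> ord_continuous x h -> ord_continuous x (fun y => g y * h y).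
Proof.
move=> cg ch M; have [A gA] := ord_lower (g x); have [B hB] := ord_lower (h x).
have [N gN] := cg (M + B%:Z); have [N' hN'] := ch (M + A%:Z); have [N'' hN''] := ch (- B%:Z).
exists (maxn N (maxn N' N'')) => y yx.
have -> : g y * h y - g x * h x = (g y - g x) * h y + g x * (h y - h x) by ring.
apply: ordD_ge.
  have -> : M = (M + B%:Z) + (- B%:Z) by lia.
  apply: ordM_ge.
    by apply: gN => i; apply: le_trans (yx i); rewrite lee_fin; lia.
  rewrite -(subrK (h x) (h y)); apply: ordD_ge => //.
  by apply: hN'' => i; apply: le_trans (yx i); rewrite lee_fin; lia.
have -> : M = - A%:Z + (M + A%:Z) by lia.
apply: ordM_ge => //.
by apply: hN' => i; apply: le_trans (yx i); rewrite lee_fin; lia.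
Qed.

Lemma ord_continuous_cst n (x : 'I_n -> K) c : ord_continuous x (fun=> c).
Proof. by move=> M; exists 0%N => y _; rewrite subrr Defs.ord0 leey. Qed.

Lemma ord_continuous_proj n (x : 'I_n -> K) i : ord_continuous x (fun y => y i).
Proof.
by move=> M; exists `|M|%N => y yx; apply: le_trans (yx i); rewrite lee_fin; lia.
Qed.

Lemma ord_continuous_ext n (x : 'I_n -> K) g h : g =1 h ->
  ord_continuous x g -> ord_continuous x h.
Proof. by move=> gh; rewrite (funext gh). Qed.

Lemma ord_continuous_meval n (x : 'I_n -> K) (p : {mpoly K[n]}) :
  ord_continuous x (fun y => p.@[y]).
Proof.
elim/mpolyind: p => [|c mu p _ _ IH].
  by apply: ord_continuous_ext (ord_continuous_cst x 0) => y; rewrite meval0.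
apply: (@ord_continuous_ext _ _ (fun y => c * \prod_i y i ^+ mu i + p.@[y])).
  by move=> y; rewrite mevalD mevalZ mevalX.
apply: ord_continuousD => //; apply: ord_continuousM; first exact: ord_continuous_cst.
have prodC (s : seq 'I_n) : ord_continuous x (fun y => \prod_(i <- s) y i ^+ mu i).
  elim: s => [|i s IHs].
    by apply: ord_continuous_ext (ord_continuous_cst x 1) => y; rewrite big_nil.
  apply: (@ord_continuous_ext _ _ (fun y => y i ^+ mu i * \prod_(i <- s) y i ^+ mu i)).
    by move=> y; rewrite big_cons.
  apply: ord_continuousM => //; elim: (mu i) => [|l IHl].
    exact: ord_continuous_cst.
  apply: (@ord_continuous_ext _ _ (fun y => y i * y i ^+ l)); first by move=> y; rewrite exprS.
  by apply: ord_continuousM => //; exact: ord_continuous_proj.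
exact: prodC.
Qed.

Lemma minOrd_close N (x y : 'rV[K]_N) (e : int) : minOrd w x = e%:E ->
  (forall i, ((e + 1)%:E <= w (y 0 i - x 0 i)%R)%E) -> minOrd w y = e%:E.
Proof.
move=> /minOrdP[xge [i xi]] yx; apply/minOrdP; split.
  move=> l; rewrite -(subrK (x 0 l) (y 0 l)); apply: ordD_ge => //.
  by apply: le_trans (yx l); rewrite lee_fin; lia.
exists i; rewrite -xi; apply: ord_lt; rewrite xi; apply: lt_le_trans (yx i).
by rewrite lte_fin; lia.
Qed.

Lemma minOrd_forms_close n m (F : 'I_m.+1 -> {mpoly K[n.+1]}) (x : 'rV[K]_n.+1) :
  x != 0 -> polyEval F x != 0 ->
  exists N : nat, forall y : 'rV[K]_n.+1, (forall i, (N%:Z%:E <= w (y 0 i - x 0 i)%R)%E) ->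
    minOrd w y = minOrd w x /\ minOrd w (polyEval F y) = minOrd w (polyEval F x).
Proof.
move=> x0 Fx0; have [e xe] := minOrd_fin w x0; have [g Fg] := minOrd_fin w Fx0.
have [N hN] : exists N : nat, forall l (y : 'rV[K]_n.+1),
    (forall i, (N%:Z%:E <= w (y 0 i - x 0 i)%R)%E) ->
    ((g + 1)%:E <= w ((F l).@[y 0] - (F l).@[x 0])%R)%E.
  apply: finite_bound => [l a b ab h y yx|l].
    by apply: h => i; apply: le_trans (yx i); rewrite lee_fin; lia.
  have [N hN] := ord_continuous_meval (x 0) (F l) (g + 1); exists N => y yx; exact: hN.
exists (maxn N `|(e + 1)%R|) => y yx; split.
  rewrite xe; apply: (minOrd_close xe) => i; apply: le_trans (yx i).
  by rewrite lee_fin; lia.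
rewrite Fg; apply: (minOrd_close Fg) => l; rewrite !mxE; apply: hN => i.
by apply: le_trans (yx i); rewrite lee_fin; lia.
Qed.

End Estimates.

(** * Local defects and the image of a linear subspace *)

Lemma cofinite_forall (I : finType) (k : fieldExtType rat) (P : I -> finitePlace k -> Prop) :
  (forall i, exists S : seq (finitePlace k), forall v, v \notin S -> P i v) ->
  exists S : seq (finitePlace k), forall v, v \notin S -> forall i, P i v.
Proof.
move=> /choice[S SP]; exists (flatten [seq S i | i <- enum I]) => v vS i.
apply: SP; apply: contra vS => vS; apply/flattenP; exists (S i) => //.
by apply: map_f; rewrite mem_enum.
Qed.

Lemma places_integral (k : fieldExtType rat) (x : k) :
  exists S : seq (finitePlace k), forall v, v \notin S -> (0%:E <= v x)%E.
Proof.
have [->|/ord_support_finite[S hS]] := eqVneq x 0.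
  by exists [::] => v _; rewrite Defs.ord0 leey.
by exists S => v /hS->.
Qed.

Lemma places_coefs_integral (k : fieldExtType rat) n (p : {mpoly k[n]}) :
  exists S : seq (finitePlace k), forall v, v \notin S -> coefs_ge v p 0.
Proof.
have [S hS] := @cofinite_forall 'I_(size (msupp p)) k
  (fun i v => (0%:E <= v p@_(nth 0%MM (msupp p) i))%E) (fun i => places_integral _).
exists S => v /hS h mu; have [mup|mup] := boolP (mu \in msupp p).
  have ip : (index mu (msupp p) < size (msupp p))%N by rewrite index_mem.
  by have := h (Ordinal ip); rewrite /= nth_index // oppr0.
by rewrite memN_msupp_eq0 // Defs.ord0 leey.
Qed.

Section Main.
Variables (k : fieldExtType rat) (E : closedFieldType) (iota : {rmorphism k -> E}).
Variables (n m d : nat) (f : projMorphism iota n m d).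
Local Notation F := (forms f).
Implicit Types (v w : finitePlace k).

(** The Nullstellensatz identity, evaluated over any extension field; the
    extensions of interest are the completions of [k]. *)
Lemma coordinate_power (j : 'I_n.+1) : exists N (G : 'I_m.+1 -> {mpoly k[n.+1]}),
  forall (K : fieldType) (h : {rmorphism k -> K}) (x : 'I_n.+1 -> K),
    x j ^+ N = \sum_i (map_mpoly h (G i)).@[x] * (map_mpoly h (F i)).@[x].
Proof.
have [N [G GE]] := homogeneous_nullstellensatz f j; exists N, G => K h x.
have <- : (map_mpoly h ('X_j ^+ N)).@[x] = x j ^+ N.
  rewrite -[map_mpoly h _]/(map_mpoly h _) (rmorphXn (map_mpoly h)) rmorphXn /=.
  by rewrite -[X in X.@[x]]/(map_mpoly h ('X_j)) map_mpolyX mevalXU.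
rewrite GE (raddf_sum (map_mpoly h)) (raddf_sum (meval x)); apply: eq_bigr => i _ /=.
by rewrite (rmorphM (map_mpoly h)) mevalM.
Qed.

Lemma forms_neq0_ext (K : fieldType) (h : {rmorphism k -> K}) (x : 'rV[K]_n.+1) :
  x != 0 -> polyEval (fun i => map_mpoly h (F i)) x != 0.
Proof.
move=> /rV0Pn[j xj]; apply: contraNneq xj => Fx0.
have [N [G GE]] := coordinate_power j.
have : x 0 j ^+ N = 0.
  rewrite (GE _ h); apply: big1 => i _.
  by have := congr1 (fun y : 'rV_m.+1 => y 0 i) Fx0; rewrite !mxE => ->; rewrite mulr0.
by move/eqP; rewrite expf_eq0 => /andP[].
Qed.

(** The local defect of a point with coordinates in [k]. *)
Definition delta v (x : 'rV[k]_n.+1) : int :=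
  fine (minOrd v (polyEval F x)) - d%:Z * fine (minOrd v x).

Lemma delta_scale v (c : k) (x : 'rV[k]_n.+1) : c != 0 -> x != 0 ->
  delta v (c *: x) = delta v x.
Proof.
move=> c0 x0; have [a vc] := ord_fin v c0.
have [e xe] := minOrd_fin v x0; have [g Fg] := minOrd_fin v (forms_neq0 f x0).
rewrite /delta (polyEval_scale _ _ (forms_homog f)) (minOrd_scale _ vc).
rewrite (minOrd_scale _ (ordX d vc)) xe Fg /= pmulrn mulrzz; lia.
Qed.

Lemma delta_normalized v (x : 'rV[k]_n.+1) : x != 0 -> exists c,
  [/\ c != 0, minOrd v (c *: x) = 0%:E & minOrd v (polyEval F (c *: x)) = (delta v x)%:E].
Proof.
move=> x0; have [e xe] := minOrd_fin v x0; have [c c0 vc] := exists_ord v (- e).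
have h : minOrd v (c *: x) = 0%:E by rewrite (minOrd_scale _ vc) xe -EFinD addNr.
exists c; split=> //; rewrite -(delta_scale v c0 x0) /delta h /= mulr0 subr0.
have cx0 : c *: x != 0 by rewrite scaler_eq0 negb_or c0.
by have [g ->] := minOrd_fin v (forms_neq0 f cx0).
Qed.

(** For normalized [x] the forms take values of order at least [- C]; and a
    coordinate of order 0 satisfies [x j ^ N = \sum_i G j i * F i], so that they
    cannot all have order larger than [C]. *)
Lemma delta_bound : exists G : 'I_n.+1 -> 'I_m.+1 -> {mpoly k[n.+1]},
  forall v (C : nat), (forall i, coefs_ge v (F i) C) -> (forall j i, coefs_ge v (G j i) C) ->
  forall x, x != 0 -> (`|delta v x| <= C)%N.
Proof.
have /choice[N /choice[G GE]] := coordinate_power.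
exists G => v C FC GC x x0; have [c [c0 cx Fcx]] := delta_normalized v x0.
move/minOrdP: cx => [xge [j xj]]; move/minOrdP: Fcx => [Fge [i Fi]].
have h1 : - C%:Z <= delta v x.
  by rewrite -lee_fin -Fi mxE; apply: meval_ge.
have idE (p : {mpoly k[n.+1]}) : map_mpoly (idfun : {rmorphism k -> k}) p = p.
  by apply/mpolyP => mu; rewrite mcoeff_map_mpoly.
have h2 : delta v x <= C%:Z.
  have h := congr1 v (GE j k idfun ((c *: x) 0)); rewrite (ordX (N j) xj) mul0rn in h.
  have : ((- C%:Z + delta v x)%R%:E <= 0%:E)%E.
    rewrite h; apply: ord_sum_ge => l _; rewrite !idE.
    apply: ordM_ge; first exact: meval_ge.
    by have := Fge l; rewrite mxE.
  by rewrite lee_fin; lia.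
move: h1 h2; lia.
Qed.

Lemma delta_finite : (forall v, exists C : nat, forall x, x != 0 -> (`|delta v x| <= C)%N) /\
  exists S : seq (finitePlace k), forall v, v \notin S -> forall x, x != 0 -> delta v x = 0.
Proof.
have [G GP] := delta_bound; split.
  move=> v.
  have [A FA] : exists A : nat, forall i, coefs_ge v (F i) A.
    by apply: finite_bound => [i|i]; [exact: coefs_ge_mono|exact: coefs_ge_exists].
  have [B GB] : exists B : nat, forall ji : 'I_n.+1 * 'I_m.+1, coefs_ge v (G ji.1 ji.2) B.
    by apply: finite_bound => [i|i]; [exact: coefs_ge_mono|exact: coefs_ge_exists].
  exists (maxn A B) => x x0; apply: GP => // [i|j i].
    by apply: coefs_ge_mono (FA i); exact: leq_maxl.
  by apply: coefs_ge_mono (GB (j, i)); exact: leq_maxr.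
have [S hS] := @cofinite_forall _ _ _ (fun i => places_coefs_integral (F i)).
have [S' hS'] := @cofinite_forall ('I_n.+1 * 'I_m.+1)%type _ _
  (fun ji => places_coefs_integral (G ji.1 ji.2)).
exists (S ++ S') => v; rewrite mem_cat negb_or => /andP[vS vS'] x x0.
suff : (`|delta v x| <= 0)%N by lia.
by apply: GP => // [i|j i]; [exact: hS|exact: (hS' v vS' (j, i))].
Qed.

Variable L : {vspace 'rV[k]_n.+1}.

Lemma minOrd_embed v N (x : 'rV[k]_N) :
  minOrd (completion_ord v) (map_mx (completion_embed v) x) = minOrd v x.
Proof. by apply: eq_bigr => i _; rewrite mxE completion_ord_embed. Qed.

Lemma localDefect_embed v (x : 'rV[k]_n.+1) (y : 'rV[completion v]_n.+1) (y0 : y != 0) :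
  minOrd (completion_ord v) y = minOrd v x ->
  minOrd (completion_ord v) (polyEval (fun i => map_mpoly (completion_embed v) (F i)) y) =
    minOrd v (polyEval F x) ->
  localDefect (completion_ord v) d (fun i => map_mpoly (completion_embed v) (F i)) (Defs.point y0)
    = delta v x.
Proof.
move=> h1 h2; rewrite localDefect_point ?h1 ?h2 //; last exact: forms_neq0_ext.
by move=> i; exact: dhomog_map (forms_homog f i).
Qed.

Lemma defectSet_delta v (x : 'rV[k]_n.+1) : x \in L -> x != 0 -> defectSet f L v (delta v x).
Proof.
move=> xL x0; have y0 : map_mx (completion_embed v) x != 0 by rewrite map_mx_eq0.
exists (Defs.point y0).
  rewrite /linearSubspace /= -memvE (coord_vbasis xL) raddf_sum /=.
  apply: memv_suml => i _.
  rewrite map_mxZ; apply: memvZ; apply: memv_span; apply: map_f.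
  by apply: mem_nth; rewrite size_tuple.
apply: localDefect_embed; first exact: minOrd_embed.
by rewrite polyEval_map minOrd_embed.
Qed.

(** The coordinates of a point over the completion can be approximated by
    elements of [k], and the defect is locally constant; therefore all local
    defects are defects of [k]-rational points of the subspace. *)
Lemma defectSetP v a : defectSet f L v a ->
  exists x, [/\ x \in L, x != 0 & delta v x = a].
Proof.
move=> [P PL <-]; set j := completion_embed v; set W := completion_ord v.
have h0 := homCoords_neq0 P; set h := homCoords P in h0.
have Fh0 := forms_neq0_ext j h0.
have [N hN] := minOrd_forms_close W h0 Fh0.
pose X := [tuple of [seq map_mx j b | b <- vbasis L]].
have hX : h \in <<X>>%VS by move/subvP: PL; apply; exact: memv_pick.
have [B hB] : exists B : nat, forall il : 'I_(\dim L) * 'I_n.+1,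
    ((- B%:Z)%:E <= W (X`_il.1 0 il.2)%R)%E.
  by apply: finite_bound => [i|i]; [exact: ord_lower_mono|exact: ord_lower].
have /choice[s sP] : forall i, exists s : k,
    ((N%:Z + B%:Z)%R%:E <= W (coord X i h - j s)%R)%E.
  by move=> i; exact: completion_dense.
pose x := \sum_i s i *: (vbasis L)`_i.
have XE (i : 'I_(\dim L)) : X`_i = map_mx j (vbasis L)`_i.
  by rewrite (nth_map 0) // size_tuple ltn_ord.
have embx l : map_mx j x 0 l = \sum_i j (s i) * X`_i 0 l.
  rewrite /j mxE summxE (rmorph_sum (completion_embed v)); apply: eq_bigr => i _.
  by rewrite XE /j !mxE (rmorphM (completion_embed v)).
have close l : (N%:Z%:E <= W (map_mx j x 0 l - h 0 l)%R)%E.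
  rewrite {1}(coord_span hX) ordBC summxE embx -sumrB.
  apply: valuation_sum_ge => i _; rewrite mxE -mulrBl.
  have -> : N%:Z = (N%:Z + B%:Z) + - B%:Z by lia.
  by apply: ordM_ge; [exact: sP|exact: (hB (i, l))].
have [xE FxE] := hN _ close.
have x0 : x != 0.
  apply/eqP => x0; move: xE; rewrite x0 map_mx0.
  have [e ->] := minOrd_fin W h0.
  move=> /minOrdP[_ [i]]; by rewrite mxE Defs.ord0.
exists x; split=> //.
  apply: memv_suml => i _; apply: memvZ; apply: vbasis_mem; apply: mem_nth.
  by rewrite size_tuple.
rewrite -[P]point_homCoords; apply/esym/localDefect_embed.
  by rewrite -/h -xE minOrd_embed.
by rewrite -/h -FxE polyEval_map minOrd_embed.
Qed.

(** The defects are bounded at every place and vanish outside a finite set of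
    places. *)
Lemma defectClasses_finite : exists S : seq (classGroup k),
  forall c, defectClasses f L c -> c \in S.
Proof.
have [/choice[C CP] [T TP]] := delta_finite.
have [S hS] : exists S : seq (classGroup k), forall a : finitePlace k -> int,
    (forall v, (`|a v| <= C v)%N) ->
    (\big[*%g/1%g]_(v <- undup T) cl_expz (idealClass (primeIdeal v)) (a v))%g \in S.
  elim: (undup T) => [|v U [S hS]].
    by exists [:: 1%g] => a _; rewrite big_nil mem_head.
  exists [seq (cl_expz (idealClass (primeIdeal v)) e * s)%g |
     e <- [seq i%:Z - (C v)%:Z | i <- seq.iota 0 (C v).*2.+1], s <- S] => a aC.
  rewrite big_cons; apply: allpairs_f; last exact: hS.
  apply/mapP; exists `|(a v + (C v)%:Z)%R|%N.
    by rewrite mem_iota; have := aC v; lia.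
  by have := aC v; lia.
exists S => c [a [U [aD uU aU ->]]].
have aC v : (`|a v| <= C v)%N.
  by have [x [_ x0 <-]] := defectSetP (aD v); exact: CP.
have aT v : v \notin undup T -> a v = 0.
  by rewrite mem_undup => vT; have [x [_ x0 <-]] := defectSetP (aD v); exact: TP.
rewrite (classHasOrd_uniq (classHasOrd_prod uU aU) (classHasOrd_prod (undup_uniq T) aT)).
exact: hS.
Qed.

Lemma Phi_projMap_hasOrd (x : 'rV[k]_n.+1) (x0 : x != 0) :
  classHasOrd (Phi (projMap f (Defs.point x0))) (fun v => fine (minOrd v (polyEval F x))).
Proof.
rewrite projMap_point Phi_point; exists (generated (forms_neq0 f x0)) => // v.
by have [g Fg] := minOrd_fin v (forms_neq0 f x0); apply: isIdealOrd_generated; rewrite Fg.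
Qed.

(** The factorization of the ideal of [F x]: its order at [v] is the defect plus
    [d] times the order of the ideal of [x]. *)
Lemma Phi_projMap_sub (x : 'rV[k]_n.+1) (x0 : x != 0) : x \in L ->
  exists2 a, defectClasses f L a &
    exists2 b, classPowers k d b & (a * b)%g = Phi (projMap f (Defs.point x0)).
Proof.
move=> xL; have [_ [T TP]] := delta_finite.
pose a v := delta v x.
have aT v : v \notin undup T -> a v = 0 by rewrite mem_undup => vT; exact: TP.
exists (\big[*%g/1%g]_(v <- undup T) cl_expz (idealClass (primeIdeal v)) (a v))%g.
  by exists a, (undup T); split=> // [v|]; [exact: defectSet_delta|exact: undup_uniq].
have gen : classHasOrd (idealClass (generated x0)) (fun v => fine (minOrd v x)).
  exists (generated x0) => // v.
  by have [e xe] := minOrd_fin v x0; apply: isIdealOrd_generated; rewrite xe.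
exists (idealClass (generated x0) ^+ d)%g; first by exists (idealClass (generated x0)).
apply: classHasOrd_uniq (Phi_projMap_hasOrd x0).
apply: classHasOrd_ext (classHasOrdM (classHasOrd_prod (undup_uniq T) aT) (classHasOrdX d gen)).
by move=> v /=; rewrite /a /delta subrK.
Qed.

(** Any choice of local defects [a] and any ideal, with orders [e], are realized
    simultaneously by a [k]-rational point of the subspace. Scale [k]-rational
    points [y v] with defect [a v] to order [e v], and approximate them at a
    finite set [T] of places outside which the defect vanishes, [e] vanishes and
    the basis of [L] is unimodular. The coordinates [t i] of the approximation
    must be coprime outside [T]. Here the dimension is used: after the first
    coordinate [t0], which is nonzero, only the finite set [T1] of places outside
    [T] where [t0] is not a unit matters, and the other coordinates are
    chosen congruent to 1 there. *)
Lemma global_point (e a : finitePlace k -> int) (S : seq (finitePlace k)) :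
  (2 <= \dim L)%N -> (forall v, defectSet f L v (a v)) ->
  (forall v, v \notin S -> e v = 0) ->
  exists x, [/\ x \in L, x != 0 & forall v, minOrd v x = (e v)%:E /\ delta v x = a v].
Proof.
move=> dimL aD eS; have [_ [T0 T0P]] := delta_finite.
set r := \dim L in dimL; pose b (i : 'I_r) := (vbasis L)`_i.
have bL i : b i \in L by apply: vbasis_mem; apply: mem_nth; rewrite size_tuple.
(* The matrices of the basis of [L] and of a left inverse to it. *)
pose c (l : 'I_n.+1) (i : 'I_r) := coord (vbasis L) i (delta_mx 0 l).
have cE i (x : 'rV[k]_n.+1) : coord (vbasis L) i x = \sum_l x 0 l * c l i.
  by rewrite {1}(row_sum_delta x) linear_sum; apply: eq_bigr => l _; rewrite linearZ.
have coordb (t : 'I_r -> k) i : coord (vbasis L) i (\sum_l t l *: b l) = t i.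
  by rewrite coord_sum_free //; exact: basis_free (vbasisP L).
have [Tb TbP] := @cofinite_forall ('I_r * 'I_n.+1)%type k _
  (fun il => places_integral (b il.1 0 il.2)).
have [Tc TcP] := @cofinite_forall ('I_n.+1 * 'I_r)%type k _
  (fun li => places_integral (c li.1 li.2)).
pose T := undup (T0 ++ S ++ Tb ++ Tc).
have notT v : v \notin T -> [/\ v \notin T0, v \notin S, v \notin Tb & v \notin Tc].
  by rewrite mem_undup !mem_cat !negb_or => /and4P[].
have /choice[y yP] : forall v, exists y, [/\ y \in L, y != 0, minOrd v y = (e v)%:E
    & delta v y = a v].
  move=> v; have [x [xL x0 xa]] := defectSetP (aD v).
  have [g xg] := minOrd_fin v x0; have [z z0 vz] := exists_ord v (e v - g).
  exists (z *: x); split.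
  - exact: memvZ.
  - by rewrite scaler_eq0 negb_or z0.
  - by rewrite (minOrd_scale _ vz) xg -EFinD subrK.
  - by rewrite delta_scale.
have [N hN] : exists N : nat, forall v, v \in T -> forall t : 'I_r -> k,
    (forall i, (N%:Z%:E <= v (t i - coord (vbasis L) i (y v))%R)%E) ->
    minOrd v (\sum_i t i *: b i) = (e v)%:E /\ delta v (\sum_i t i *: b i) = a v.
  apply: seq_bound => [v A B AB h t tA|v].
    by apply: h => i; apply: le_trans (tA i); rewrite lee_fin; lia.
  have [yL y0 ye ya] := yP v.
  have [A hA] := minOrd_forms_close v y0 (forms_neq0 f y0).
  have [B hB] : exists B : nat, forall il : 'I_r * 'I_n.+1,
      ((- B%:Z)%:E <= v (b il.1 0%R il.2))%E.
    by apply: finite_bound => [i|i]; [exact: ord_lower_mono|exact: ord_lower].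
  exists (A + B)%N => t tA.
  have [|h1 h2] := hA (\sum_i t i *: b i).
    move=> l; rewrite [in X in _ - X](coord_vbasis yL) !summxE -sumrB.
    apply: ord_sum_ge => i _; rewrite !mxE -mulrBl.
    have -> : A%:Z = (A + B)%N%:Z + - B%:Z by lia.
    by apply: ordM_ge; [exact: tA|exact: (hB (i, l))].
  by rewrite h1 ye; split=> //; rewrite -ya /delta h1 h2.
pose i0 : 'I_r := Ordinal (ltnW dimL); pose i1 : 'I_r := Ordinal dimL.
have [t0 [t00 t0T t0N]] := strong_approximation T (fun v => coord (vbasis L) i0 (y v)) N.
have [T1 T1P] := ord_support_finite t00.
have /choice[t' t'P] : forall i, exists t', 
    (forall v, v \in T -> (N%:Z%:E <= v (t' - coord (vbasis L) i (y v))%R)%E) /\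
    forall v, v \notin T -> (0%:E <= v t')%E /\ (v \in T1 -> v t' = 0%:E).
  move=> i; have [t' [_ h1 h2]] := strong_approximation (T ++ T1)
    (fun v => if v \in T then coord (vbasis L) i (y v) else 1) N.+1.
  exists t'; split=> v vT.
    have := h1 v; rewrite mem_cat vT => /(_ isT); apply: le_trans.
    by rewrite lee_fin; lia.
  have [vT1|vT1] := boolP (v \in T1).
    have := h1 v; rewrite mem_cat vT1 orbT (negPf vT) => /(_ isT) h.
    have -> : v t' = 0%:E; last by split.
    rewrite -(Defs.ord1 v); apply: ord_lt; rewrite Defs.ord1; apply: lt_le_trans h.
    by rewrite lte_fin.
  by split=> //; apply: h2; rewrite mem_cat negb_or vT.
pose t i := if i == i0 then t0 else t' i.
pose x := \sum_i t i *: b i.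
have tT v : v \in T -> forall i, (N%:Z%:E <= v (t i - coord (vbasis L) i (y v))%R)%E.
  by move=> vT i; rewrite /t; case: eqP => [->|_]; [exact: t0T|have [h _] := t'P i; exact: h].
have tge v : v \notin T -> forall i, (0%:E <= v (t i))%E.
  move=> vT i; rewrite /t; case: eqP => [_|_]; first exact: t0N.
  by have [_ /(_ v vT)[]] := t'P i.
have t1 v : v \notin T -> exists i, v (t i) = 0%:E.
  move=> vT; have [vT1|vT1] := boolP (v \in T1); last by exists i0; rewrite /t eqxx T1P.
  by exists i1; rewrite /t; have [_ /(_ v vT)[_]] := t'P i1; apply.
have xL : x \in L by apply: memv_suml => i _; exact: memvZ.
have x0 : x != 0.
  apply/eqP => x0; have := coordb t i0; rewrite -/x x0 linear0 /t eqxx => t0E.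
  by rewrite -t0E eqxx in t00.
exists x; split=> // v; have [vT|vT] := boolP (v \in T); first exact: hN (tT v vT).
have [vT0 vS vTb vTc] := notT v vT.
have -> : delta v x = a v.
  have [z [_ z0 <-]] := defectSetP (aD v).
  by rewrite !T0P.
split=> //; rewrite eS //; apply/minOrdP.
have xge l : (0%:E <= v (x 0%R l))%E.
  rewrite summxE; apply: ord_sum_ge => i _; rewrite mxE ordM -[leLHS]adde0.
  by apply: leeD; [exact: tge|exact: (TbP v vTb (i, l))].
split=> //; apply: contrapT => /forallNP xN.
have [i ti] := t1 v vT.
have : (0%:E < v (t i))%E.
  rewrite -(coordb t i) -/x cE.
  have lt01 : (0%:E < 1%:E :> \bar int)%E by rewrite lte_fin.
  apply: (lt_le_trans lt01); apply: ord_sum_ge => l _; rewrite ordM -[leLHS]adde0.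
  apply: leeD; last exact: (TcP v vTc (l, i)).
  have := xge l; have := xN l; case: (v (x 0 l)) => [g||] //.
  rewrite !lee_fin => gN g_ge; have g0 : g <> 0 by move=> g0; apply: gN; rewrite g0.
  lia.
by rewrite ti ltxx.
Qed.

End Main.

Theorem theorem1p3 (k : fieldExtType rat) (kbar : closedFieldType)
    (iota : {rmorphism k -> kbar}) (kbar_alg : integralRange iota)
    (n m d : nat) (n_gt0 : (0 < n)%N) (m_gt0 : (0 < m)%N) (d_gt0 : (0 < d)%N)
    (f : projMorphism iota n m d)
    (L : {vspace 'rV[k]_n.+1}) (dimL : (2 <= \dim L)%N) :
  [set Phi Q | Q in [set projMap f P | P in linearSubspace L]] =
    [set (a * b)%g | a in defectClasses f L & b in classPowers k d]
  /\
  exists S : seq (classGroup k),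
    [set Phi Q | Q in [set projMap f P | P in linearSubspace L]] =
      \bigcup_(c in [set` S]) [set (c * b)%g | b in classPowers k d].
Proof.
have main : [set Phi Q | Q in [set projMap f P | P in linearSubspace L]] =
    [set (a * b)%g | a in defectClasses f L & b in classPowers k d].
  apply/seteqP; split=> [_ [_ [P PL <-] <-]|_ [_ [a [S [aD uS aS ->]]] [_ [c _ <-] <-]]].
    have xL : homCoords P \in L by move/subvP: PL; apply; exact: memv_pick.
    have [a aD [b bP ab]] := Phi_projMap_sub f (homCoords_neq0 P) xL.
    by exists a => //; exists b => //; rewrite ab point_homCoords.
  have [e ce [U eU]] := classHasOrd_exists c.
  have [x [xL x0 xP]] := global_point dimL aD eU.
  exists (projMap f (Defs.point x0)); first by exists (Defs.point x0).
  apply: classHasOrd_uniq (Phi_projMap_hasOrd f x0) _.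
  apply: classHasOrd_ext (classHasOrdM (classHasOrd_prod uS aS) (classHasOrdX d ce)).
  move=> v /=; have [xe <-] := xP v; by rewrite /delta xe /= subrK.
split=> //; have [S hS] := defectClasses_finite f L.
exists [seq c <- S | `[< defectClasses f L c >]]; rewrite main.
apply/seteqP; split=> [_ [a aD [b bP <-]]|_ [c cS [b bP <-]]].
  by exists a; [rewrite /= mem_filter hS // andbT; exact/asboolP|exists b].
move: cS; rewrite /= mem_filter => /andP[/asboolP cD _].
by exists c => //; exists b.
Qed.
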